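(* Let $n\geqslant 8$. Let $V$ be a vector space of dimension $k$, with $k<2n-4$, over an algebraically closed field of characteristic other than $2$, and let $\pi\colon \mathrm{SAut}(F_n)\to\mathrm{PGL}(V)$ be a projective representation. If $\pi$ does not factor through the natural map $\mathrm{SAut}(F_n)\to\mathrm{SL}_n(\mathbb{Z})$, then $k\geqslant n+1$ and the projective module $V$ contains a trivial projective module of dimension $k-n-1$.
   Context: $F_n$ is the free group of rank $n$. For $n\geqslant 3$, $\mathrm{SAut}(F_n)$ is the unique subgroup of index $2$ in $\mathrm{Aut}(F_n)$; it consists of the automorphisms whose induced action on the abelianisation $\mathbb{Z}^n$ of $F_n$ has determinant $1$. The natural map $\mathrm{SAut}(F_n)\to\mathrm{SL}_n(\mathbb{Z})$ is given by this action on $\mathbb{Z}^n$. A trivial projective module contained in $V$ is a linear subspace $V_0\leqslant V$ which is invariant under (any lifts to $\mathrm{GL}(V)$ of) the elements $\pi(\xi)$, $\xi\in\mathrm{SAut}(F_n)$, and on which each such lift acts as a scalar; its dimension is the dimension of $V_0$ as a vector space. *)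

(* Defs.v *)
From HB Require Import structures.
From mathcomp Require Import all_boot all_algebra.
From mathcomp Require Import boolp.

Set Implicit Arguments.
Unset Strict Implicit.
Unset Printing Implicit Defensive.

Import GRing.Theory.

Local Open Scope ring_scope.
Local Open Scope group_scope.

(* The letter (i, false) stands for x_i and (i, true) for its inverse. *)
Definition letter (n : nat) : Type := ('I_n * bool)%type.

Definition linv n (a : letter n) : letter n := (a.1, ~~ a.2).

Definition reduced n : pred (seq (letter n)) :=
  sorted (fun a b => b != linv a).

HB.instance Definition _ n := Choice.on (letter n).

Record free_group (n : nat) :=
  FreeGroup { word :> seq (letter n); word_reduced : reduced word }.

HB.instance Definition _ n := [isSub for @word n].
HB.instance Definition _ n := [Choice of free_group n by <:].

Section FreeGroup.
Variable n : nat.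
Implicit Types (a b : letter n) (u v w : seq (letter n)).

(* Multiplies a reduced word by a letter on the left. *)
Definition push a w : seq (letter n) :=
  if w is b :: w' then if b == linv a then w' else a :: w else [:: a].

Lemma linvK a : linv (linv a) = a.
Proof. by case: a => i s; rewrite /linv negbK. Qed.

Lemma reduced_behead a w : reduced (a :: w) -> reduced w.
Proof. by case: w => //= b w /andP[]. Qed.

Lemma push_reduced a w : reduced w -> reduced (push a w).
Proof.
case: w => //= b w rw; case: ifPn => [_|ab]; first exact: path_sorted rw.
by rewrite /= ab.
Qed.

Lemma push_cons a w : reduced (a :: w) -> push a w = a :: w.
Proof. by case: w => //= b w /andP[/negPf->]. Qed.

Lemma pushK a w : reduced w -> push (linv a) (push a w) = w.
Proof.
case: w => [|b w] rw /=; first by rewrite linvK eqxx.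
have [eb|nb] := eqVneq b (linv a); last by rewrite /= linvK eqxx.
by rewrite -eb push_cons.
Qed.

Lemma pushVK a w : reduced w -> push a (push (linv a) w) = w.
Proof. by move=> rw; rewrite -{1}(linvK a) pushK. Qed.

Lemma foldr_push_reduced u w : reduced w -> reduced (foldr push w u).
Proof. by move=> rw; elim: u => //= a u; apply: push_reduced. Qed.

Lemma foldr_push1 u : reduced u -> foldr push [::] u = u.
Proof.
elim: u => //= a u IH rau.
by rewrite IH ?push_cons //; exact: reduced_behead rau.
Qed.

Lemma foldr_push_push a u w : reduced w ->
  foldr push w (push a u) = push a (foldr push w u).
Proof.
move=> rw; case: u => //= b u; have [->|//] := eqVneq b (linv a).
by rewrite pushVK ?foldr_push_reduced.
Qed.

Definition wordV u := rev (map (@linv n) u).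

Lemma wordV_reduced u : reduced u -> reduced (wordV u).
Proof.
rewrite /reduced /wordV rev_sorted sorted_map.
apply: sub_sorted => a b /=; rewrite linvK; apply: contraNN => /eqP->.
exact/eqP.
Qed.

Lemma wordVK u v : reduced v -> foldr push (foldr push v u) (wordV u) = v.
Proof.
elim: u v => //= a u IH v rv; rewrite /wordV /= rev_cons foldr_rcons.
by rewrite pushK ?foldr_push_reduced ?IH.
Qed.

Definition free_one : free_group n := @FreeGroup n [::] isT.
Definition free_mul (x y : free_group n) : free_group n :=
  FreeGroup (foldr_push_reduced (word x) (word_reduced y)).
Definition free_inv (x : free_group n) : free_group n :=
  FreeGroup (wordV_reduced (word_reduced x)).

Fact free_mulA : associative free_mul.
Proof.
move=> x y z; apply: val_inj => /=; elim: (word x) => //= a u ->.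
by rewrite foldr_push_push // (word_reduced z).
Qed.
Fact free_mul1 : left_id free_one free_mul.
Proof. by move=> x; apply: val_inj. Qed.
Fact free_mulr1 : right_id free_one free_mul.
Proof. by move=> x; apply: val_inj; rewrite /= foldr_push1 // (word_reduced x). Qed.
Fact free_mulV : left_inverse free_one free_inv free_mul.
Proof.
move=> x; apply: val_inj => /=.
by rewrite -{1}(foldr_push1 (word_reduced x)) wordVK.
Qed.
Fact free_mulVr : right_inverse free_one free_inv free_mul.
Proof.
move=> x; set y := free_inv x.
rewrite -[LHS]free_mul1 -{1}(free_mulV y) -free_mulA.
by rewrite (free_mulA y x) free_mulV free_mul1 free_mulV.
Qed.

HB.instance Definition _ := isGroup.Build (free_group n)
  free_mulA free_mul1 free_mulr1 free_mulV free_mulVr.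

Definition free_gen (i : 'I_n) : free_group n := @FreeGroup n [:: (i, false)] isT.

Definition letter_val a : free_group n :=
  if a.2 then (free_gen a.1)^-1 else free_gen a.1.

Lemma val_letter_val a : val (letter_val a) = [:: a].
Proof. by case: a => i []. Qed.

Lemma free_group_ind (P : free_group n -> Prop) :
  P 1 -> (forall a x, P x -> P (letter_val a * x)) -> forall x, P x.
Proof.
move=> P1 PM [w]; elim: w => [|a w IH] rw.
  by rewrite (_ : FreeGroup rw = 1) //; apply: val_inj.
have rw' := reduced_behead rw.
suff -> : FreeGroup rw = letter_val a * FreeGroup rw' by apply: PM.
by apply: val_inj; rewrite /= val_letter_val /= push_cons.
Qed.

End FreeGroup.

Arguments free_gen {n} i.

Section FreeGroupLift.
Variables (n : nat) (G : groupType) (f : 'I_n -> G).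

Definition free_lift (x : free_group n) : G :=
  \prod_(a <- word x) (if a.2 then (f a.1)^-1 else f a.1).

Fact free_lift_is_multiplicative : {morph free_lift : x y / x * y}.
Proof.
move=> x y; rewrite /free_lift /=; elim: (word x) => [|a u IH] /=.
  by rewrite big_nil mul1g.
rewrite big_cons -mulgA -{}IH; case: (foldr _ _ _) => [|b w] /=.
  by rewrite big_seq1 big_nil mulg1.
case: eqP => [->|_]; last by rewrite big_cons.
by rewrite big_cons /=; case: a.2; rewrite /= ?mulKg ?mulVKg.
Qed.

HB.instance Definition _ :=
  isMultiplicative.Build _ _ free_lift free_lift_is_multiplicative.

Lemma free_lift_gen i : free_lift (free_gen i) = f i.
Proof. by rewrite /free_lift big_seq1. Qed.

Lemma free_lift_unique (g : {multiplicative free_group n -> G}) :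
  (forall i, g (free_gen i) = f i) -> g =1 free_lift.
Proof.
move=> gf; have g1 : g 1 = 1 by apply: (mulgI (g 1)); rewrite -gmulfM !mulg1.
have l1 : free_lift 1 = 1 by rewrite /free_lift big_nil.
have morV (h : {multiplicative free_group n -> G}) x : h 1 = 1 ->
    h x^-1 = (h x)^-1.
  by move=> h1; apply: (mulgI (h x)); rewrite -gmulfM !mulgV.
move=> x; elim/free_group_ind: x => [|a x IH]; first by rewrite g1 l1.
rewrite !gmulfM IH /letter_val; congr (_ * _).
by case: a.2; rewrite ?(morV g _ g1) ?(morV free_lift _ l1) gf /= free_lift_gen.
Qed.

End FreeGroupLift.

Record group_aut (G : groupType) := GroupAut {
  aut_fun :> G -> G;
  aut_inv : G -> G;
  aut_morph : {morph aut_fun : x y / x * y};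
  aut_funK : cancel aut_fun aut_inv;
  aut_invK : cancel aut_inv aut_fun
}.

HB.instance Definition _ (G : groupType) := gen_eqMixin (group_aut G).
HB.instance Definition _ (G : groupType) := gen_choiceMixin (group_aut G).

Section Automorphisms.
Variable G : groupType.
Implicit Types f g h : group_aut G.

HB.instance Definition _ f :=
  isMultiplicative.Build G G (aut_fun f) (aut_morph f).

Lemma group_autP f g : f =1 g -> f = g.
Proof.
case: f g => [f f' fM fK f'K] [g g' gM gK g'K] /= /funext efg.
rewrite -{}efg in gM gK g'K *.
have e : g' = f' by apply/funext => x; rewrite -{1}(f'K x) gK.
rewrite {g'}e in gK g'K *.
by rewrite (Prop_irrelevance gM fM) (Prop_irrelevance gK fK)
  (Prop_irrelevance g'K f'K).
Qed.

Definition aut_one : group_aut G :=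
  @GroupAut G id id (fun _ _ => erefl) (fun _ => erefl) (fun _ => erefl).

Fact aut_comp_morph f g : {morph f \o g : x y / x * y}.
Proof. by move=> x y /=; rewrite !aut_morph. Qed.

Definition aut_mul f g : group_aut G :=
  GroupAut (aut_comp_morph f g)
    (can_comp (aut_funK f) (aut_funK g)) (can_comp (aut_invK g) (aut_invK f)).

Fact aut_inv_morph f : {morph aut_inv f : x y / x * y}.
Proof.
by move=> x y; apply: (can_inj (aut_funK f)); rewrite aut_morph !aut_invK.
Qed.

Definition aut_V f : group_aut G :=
  GroupAut (@aut_inv_morph f) (aut_invK f) (aut_funK f).

Fact aut_mulA : associative aut_mul.
Proof. by move=> f g h; apply: group_autP. Qed.
Fact aut_mul1 : left_id aut_one aut_mul.
Proof. by move=> f; apply: group_autP. Qed.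
Fact aut_mulr1 : right_id aut_one aut_mul.
Proof. by move=> f; apply: group_autP. Qed.
Fact aut_mulV : left_inverse aut_one aut_V aut_mul.
Proof. by move=> f; apply: group_autP => x /=; rewrite aut_funK. Qed.
Fact aut_mulVr : right_inverse aut_one aut_V aut_mul.
Proof. by move=> f; apply: group_autP => x /=; rewrite aut_invK. Qed.

HB.instance Definition _ := isGroup.Build (group_aut G)
  aut_mulA aut_mul1 aut_mulr1 aut_mulV aut_mulVr.

End Automorphisms.

(* The image of x in the abelianisation Z^n, as a column vector: entry i is
   the exponent sum of x_i in x. *)
Definition abelianise n (x : free_group n) : 'cV[int]_n :=
  \col_i (\sum_(a <- val x | a.1 == i) (if a.2 then -1 else 1))%R.

Lemma abelianiseM n (x y : free_group n) :
  abelianise (x * y) = (abelianise x + abelianise y)%R.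
Proof.
apply/matrixP => i j; rewrite !mxE /=; elim: (val x) => [|a u IH] /=.
  by rewrite big_nil add0r.
rewrite [in RHS]big_cons.
suff -> w : (\sum_(b <- push a w | b.1 == i) (if b.2 then -1 else 1) =
  (if a.1 == i then (if a.2 then -1 else 1) else 0) +
  \sum_(b <- w | b.1 == i) (if b.2 then -1 else 1) :> int)%R.
  by rewrite IH; case: ifP; rewrite ?add0r ?addrA.
case: w => [|b w] /=.
  by rewrite big_cons big_nil; case: ifP; rewrite ?addr0.
case: eqP => [->|_]; last by rewrite big_cons; case: ifP; rewrite ?add0r.
rewrite big_cons /=; case: ifP => _; last by rewrite add0r.
by case: a.2; rewrite /= addrA ?subrr ?addNr add0r.
Qed.

Lemma abelianise1 n : abelianise (1 : free_group n) = 0%R.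
Proof. by apply/matrixP => i j; rewrite !mxE big_nil. Qed.

Lemma abelianiseV n (x : free_group n) :
  abelianise x^-1 = (- abelianise x)%R.
Proof.
by apply: (addrI (abelianise x)); rewrite -abelianiseM mulgV abelianise1 subrr.
Qed.

Lemma abelianise_gen n (i : 'I_n) : abelianise (free_gen i) = delta_mx i 0.
Proof.
apply/matrixP => j k; rewrite !mxE big_cons big_nil /= ord1 eqxx andbT eq_sym.
by case: ifP.
Qed.

(* The matrix of the induced endomorphism of Z^n acting on column vectors:
   column j is the image of x_j. *)
Definition abel_mx n (f : free_group n -> free_group n) : 'M[int]_n :=
  \matrix_(i, j) abelianise (f (free_gen j)) i 0.

Lemma abel_mxP n (f : group_aut (free_group n)) (x : free_group n) :
  abelianise (f x) = (abel_mx f *m abelianise x)%R.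
Proof.
have f1 : f 1 = 1 by apply: (mulgI (f 1)); rewrite -aut_morph !mulg1.
have fV y : f y^-1 = (f y)^-1.
  by apply: (mulgI (f y)); rewrite -aut_morph !mulgV.
have fgen i : abelianise (f (free_gen i)) =
    (abel_mx f *m abelianise (free_gen i))%R.
  by rewrite abelianise_gen -colE; apply/colP => j; rewrite !mxE.
elim/free_group_ind: x => [|a x IH].
  by rewrite f1 abelianise1 mulmx0.
rewrite aut_morph !abelianiseM mulmxDr -IH /letter_val; congr (_ + _)%R.
by case: a.2; rewrite ?fV ?abelianiseV ?mulmxN fgen.
Qed.

Lemma abel_mxM n (f g : group_aut (free_group n)) :
  abel_mx (f * g) = (abel_mx f *m abel_mx g)%R.
Proof.
apply/matrixP => i j; rewrite mxE /= abel_mxP !mxE.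
by apply: eq_bigr => k _; rewrite [abel_mx g k j]mxE.
Qed.

Lemma abel_mx1 n : abel_mx (1 : group_aut (free_group n)) = 1%:M%R.
Proof. by apply/matrixP => i j; rewrite mxE abelianise_gen !mxE eqxx andbT. Qed.

Definition is_SAut n : pred (group_aut (free_group n)) :=
  fun f => (\det (abel_mx f) == 1)%R.

Record SAut (n : nat) :=
  MkSAut { saut :> group_aut (free_group n); _ : is_SAut saut }.

HB.instance Definition _ n := [isSub for @saut n].
HB.instance Definition _ n := [Choice of SAut n by <:].

Fact is_SAut_group_closed n : group_closed (@is_SAut n).
Proof.
split; first by rewrite unfold_in /is_SAut abel_mx1 det1.
move=> f g; rewrite !unfold_in /is_SAut => /eqP df /eqP dg.
have := congr1 determinant (abel_mxM (f / g) g).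
by rewrite mulgVK det_mulmx df dg mulr1 => <-.
Qed.

HB.instance Definition _ n := SubChoice_isSubGroup.Build
  (group_aut (free_group n)) (@is_SAut n) (SAut n) (@is_SAut_group_closed n).

Record SL (n : nat) :=
  MkSL { SL_mx :> 'M[int]_n; _ : (\det SL_mx == 1)%R }.

HB.instance Definition _ n := [isSub for @SL_mx n].
HB.instance Definition _ n := [Choice of SL n by <:].

Section SpecialLinear.
Variable n : nat.
Implicit Types A B : SL n.

Lemma SL_unitmx A : val A \in unitmx.
Proof. by rewrite unitmxE (eqP (valP A)) unitr1. Qed.

Fact SL_one_subproof : (\det (1%:M : 'M[int]_n) == 1)%R.
Proof. by rewrite det1. Qed.
Fact SL_mul_subproof A B : (\det (val A *m val B) == 1)%R.
Proof. by rewrite det_mulmx (eqP (valP A)) (eqP (valP B)) mulr1. Qed.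
Fact SL_inv_subproof A : (\det (invmx (val A)) == 1)%R.
Proof. by rewrite det_inv (eqP (valP A)) invr1. Qed.

Definition SL_one : SL n := MkSL SL_one_subproof.
Definition SL_mul A B : SL n := MkSL (SL_mul_subproof A B).
Definition SL_inv A : SL n := MkSL (SL_inv_subproof A).

Fact SL_mulA : associative SL_mul.
Proof. by move=> A B C; apply: val_inj; rewrite /= mulmxA. Qed.
Fact SL_mul1 : left_id SL_one SL_mul.
Proof. by move=> A; apply: val_inj; rewrite /= mul1mx. Qed.
Fact SL_mulr1 : right_id SL_one SL_mul.
Proof. by move=> A; apply: val_inj; rewrite /= mulmx1. Qed.
Fact SL_mulV : left_inverse SL_one SL_inv SL_mul.
Proof. by move=> A; apply: val_inj; rewrite /= mulVmx ?SL_unitmx. Qed.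
Fact SL_mulVr : right_inverse SL_one SL_inv SL_mul.
Proof. by move=> A; apply: val_inj; rewrite /= mulmxV ?SL_unitmx. Qed.

HB.instance Definition _ := isGroup.Build (SL n)
  SL_mulA SL_mul1 SL_mulr1 SL_mulV SL_mulVr.

Definition SAut_to_SL (f : SAut n) : SL n := @MkSL n (abel_mx (val f)) (valP f).

Fact SAut_to_SL_is_multiplicative : {morph SAut_to_SL : f g / f * g}.
Proof. by move=> f g; apply: val_inj; rewrite /= -abel_mxM. Qed.

HB.instance Definition _ :=
  isMultiplicative.Build _ _ SAut_to_SL SAut_to_SL_is_multiplicative.

End SpecialLinear.

Arguments SAut_to_SL : clear implicits.

Record GL (K : fieldType) (V : vectType K) :=
  MkGL { GL_lfun :> 'End(V); _ : lker GL_lfun == 0%VS }.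

HB.instance Definition _ (K : fieldType) (V : vectType K) :=
  [isSub for @GL_lfun K V].
HB.instance Definition _ (K : fieldType) (V : vectType K) :=
  [Choice of GL V by <:].

Section GeneralLinear.
Variables (K : fieldType) (V : vectType K).
Implicit Types f g h : GL V.

Fact GL_one_subproof : lker (\1%VF : 'End(V)) == 0%VS.
Proof. by apply/lker0P => u v; rewrite !id_lfunE. Qed.
Fact GL_mul_subproof f g : lker (val f \o val g)%VF == 0%VS.
Proof.
apply/lker0P => u v; rewrite !comp_lfunE.
by move/(lker0P (valP f))/(lker0P (valP g)).
Qed.
Fact GL_inv_subproof f : lker (val f)^-1%VF == 0%VS.
Proof. by apply/lker0P; apply: can_inj (lker0_lfunVK (valP f)). Qed.

Definition GL_one : GL V := MkGL GL_one_subproof.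
Definition GL_mul f g : GL V := MkGL (GL_mul_subproof f g).
Definition GL_inv f : GL V := MkGL (GL_inv_subproof f).

Fact GL_mulA : associative GL_mul.
Proof. by move=> f g h; apply: val_inj; rewrite /= comp_lfunA. Qed.
Fact GL_mul1 : left_id GL_one GL_mul.
Proof. by move=> f; apply: val_inj; rewrite /= comp_lfun1l. Qed.
Fact GL_mulr1 : right_id GL_one GL_mul.
Proof. by move=> f; apply: val_inj; rewrite /= comp_lfun1r. Qed.
Fact GL_mulV : left_inverse GL_one GL_inv GL_mul.
Proof. by move=> f; apply: val_inj; rewrite /= lker0_compVf // (valP f). Qed.
Fact GL_mulVr : right_inverse GL_one GL_inv GL_mul.
Proof. by move=> f; apply: val_inj; rewrite /= lker0_compfV // (valP f). Qed.

HB.instance Definition _ := isGroup.Build (GL V)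
  GL_mulA GL_mul1 GL_mulr1 GL_mulV GL_mulVr.

Definition proportional : rel (GL V) := fun f g =>
  `[< exists2 c : K, c != 0%R & val f = (c *: val g)%R >].

Fact proportional_refl : reflexive proportional.
Proof. by move=> f; apply/asboolP; exists 1%R; rewrite ?oner_neq0 ?scale1r. Qed.

Fact proportional_imp f g : proportional f g -> proportional g f.
Proof.
move=> /asboolP[c c0 e]; apply/asboolP; exists c^-1%R; rewrite ?invr_eq0 //.
by rewrite e scalerA mulVf ?scale1r.
Qed.

Fact proportional_sym : symmetric proportional.
Proof. by move=> f g; apply/idP/idP; apply: proportional_imp. Qed.

Fact proportional_trans : transitive proportional.
Proof.
move=> g f h /asboolP[c c0 e] /asboolP[d d0 e']; apply/asboolP.
by exists (c * d)%R; rewrite ?mulf_neq0 // e e' scalerA.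
Qed.

Canonical proportional_equiv := EquivRel proportional
  proportional_refl proportional_sym proportional_trans.

Lemma proportionalM f f' g g' : proportional f f' -> proportional g g' ->
  proportional (f * g) (f' * g').
Proof.
move=> /asboolP[c c0 e] /asboolP[d d0 e']; apply/asboolP.
exists (c * d)%R; rewrite ?mulf_neq0 //=.
by rewrite e e' -comp_lfunZl -comp_lfunZr scalerA.
Qed.

Lemma proportionalV f g : proportional f g -> proportional f^-1 g^-1.
Proof.
move=> fg; have := proportionalM (proportional_refl f^-1)
  (proportionalM fg (proportional_refl g^-1)).
by rewrite mulKg mulgV mulg1 proportional_sym.
Qed.

End GeneralLinear.

Definition PGL (K : fieldType) (V : vectType K) : Type :=
  {eq_quot @proportional_equiv K V}%qT.

HB.instance Definition _ (K : fieldType) (V : vectType K) :=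
  EqQuotient.on (PGL V).
HB.instance Definition _ (K : fieldType) (V : vectType K) :=
  Choice.on (PGL V).

Section ProjectiveLinear.
Variables (K : fieldType) (V : vectType K).
Implicit Types p q r : PGL V.

Definition to_PGL (f : GL V) : PGL V := (\pi_(PGL V) f)%qT.

Lemma to_PGL_eq f g : to_PGL f = to_PGL g <-> proportional f g.
Proof. by split=> [/eqmodP | fg]; last exact/eqmodP. Qed.

Lemma to_PGL_repr p : to_PGL (repr p) = p.
Proof. exact: reprK. Qed.

Lemma repr_to_PGL f : proportional (repr (to_PGL f)) f.
Proof. by apply/to_PGL_eq; rewrite to_PGL_repr. Qed.

Definition PGL_one : PGL V := to_PGL 1.
Definition PGL_mul p q : PGL V := to_PGL (repr p * repr q).
Definition PGL_inv p : PGL V := to_PGL (repr p)^-1.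

Lemma PGL_mulE f g : PGL_mul (to_PGL f) (to_PGL g) = to_PGL (f * g).
Proof. by apply/to_PGL_eq; apply: proportionalM; apply: repr_to_PGL. Qed.

Lemma PGL_invE f : PGL_inv (to_PGL f) = to_PGL f^-1.
Proof. by apply/to_PGL_eq; apply: proportionalV; apply: repr_to_PGL. Qed.

Fact PGL_mulA : associative PGL_mul.
Proof.
move=> p q r; rewrite -(to_PGL_repr p) -(to_PGL_repr q) -(to_PGL_repr r).
by rewrite !PGL_mulE mulgA.
Qed.
Fact PGL_mul1 : left_id PGL_one PGL_mul.
Proof. by move=> p; rewrite -(to_PGL_repr p) PGL_mulE mul1g. Qed.
Fact PGL_mulr1 : right_id PGL_one PGL_mul.
Proof. by move=> p; rewrite -(to_PGL_repr p) PGL_mulE mulg1. Qed.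
Fact PGL_mulV : left_inverse PGL_one PGL_inv PGL_mul.
Proof. by move=> p; rewrite -(to_PGL_repr p) PGL_invE PGL_mulE mulVg. Qed.
Fact PGL_mulVr : right_inverse PGL_one PGL_inv PGL_mul.
Proof. by move=> p; rewrite -(to_PGL_repr p) PGL_invE PGL_mulE mulgV. Qed.

HB.instance Definition _ := isGroup.Build (PGL V)
  PGL_mulA PGL_mul1 PGL_mulr1 PGL_mulV PGL_mulVr.

Fact to_PGL_is_multiplicative : {morph to_PGL : f g / f * g}.
Proof. by move=> f g; rewrite -PGL_mulE. Qed.

HB.instance Definition _ :=
  isMultiplicative.Build _ _ to_PGL to_PGL_is_multiplicative.

End ProjectiveLinear.

Definition trivial_projective_submodule (G : groupType) (K : fieldType)
    (V : vectType K) (rho : G -> PGL V) (V0 : {vspace V}) : Prop :=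
  forall (xi : G) (f : GL V), to_PGL f = rho xi ->
    (val f @: V0 <= V0)%VS /\
    exists c : K, forall v : V, v \in V0 -> val f v = (c *: v)%R.

Definition factors_through (G H L : groupType) (p : G -> H) (rho : G -> L) :
    Prop :=
  exists sigma : {multiplicative H -> L}, forall x : G, rho x = sigma (p x).

(* Main.v *)
(* Write E_ab for the transvection a -> a b, for letters a, b with distinct
   indices. Nielsen reduction shows that the E_ab generate SAut(F_n).
   Commutators of arbitrary lifts of transvections do not depend on the
   lifts, and by Steinberg's argument they do not depend on the intermediate
   letter either; so the E_ab lift to GL(V) in such a way that the
   Steinberg-type relations and the action of the Weyl elements w_ab (a ->
   b^-1, b -> a) hold exactly.

   Put d_ab = w_ab^2, the flip of the signs of a and b. Its square is a
   scalar, which is 1: otherwise the flips generate an extraspecial group too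
   large for dim V < 2n - 4. Hence the flips are commuting involutions, V is
   a sum of weight spaces indexed by sets of letters up to complement, and
   since the Weyl elements permute the weights, only the empty set and the
   singletons can occur, the latter with multiplicity at most one. If no
   singleton occurs all E_ab are trivial. Otherwise V is the sum of E0, on
   which the Weyl elements act trivially, and of lines spanned by e_1, ...,
   e_n, and solving the relations for the coefficients of E_ab leaves two
   cases. Either E_ab fixes e_b, maps e_a to e_a + e_b and f in E0 to f +
   t(f) e_b; or it fixes e_a and E0 and maps e_b to e_b - e_a + u with u in
   E0. If t = 0, respectively u = 0, the representation is the standard one,
   respectively its dual, plus a trivial one, and factors through SL_n(Z). If
   not, the kernel of t, respectively a complement of u in E0, is a trivial
   module of dimension dim E0 - 1 = k - n - 1. *)

Require Import Defs.
From HB Require Import structures.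
From mathcomp Require Import all_boot all_algebra perm.
From mathcomp Require Import boolp.
From mathcomp Require Import zify ring.

Set Implicit Arguments.
Unset Strict Implicit.
Unset Printing Implicit Defensive.

Import GRing.Theory.

Local Open Scope ring_scope.
Local Open Scope group_scope.

(** * Transvections and the Weyl group of Aut(F_n) *)

(** Everything is excluded by counting against [dim V < 2n - 4], in two ways. Exchanging a sign -1
    with a sign 1 in a weight with [p] signs -1 yields [p (n - p)] weights, and [2n - 4] is the
    value at [p = 2]; the same bound keeps the [n] conjugate singletons at multiplicity one.
    Secondly, [m] anticommuting pairs of operators need dimension [2^m]. This removes the
    -1-eigenspace of a transvection wherever letters cannot be told from their inverses: there
    [m = n - 4], and [2^(n-4) > 2n - 4] holds from [n = 8] on. The flips only supply about [n / 2]
    pairs, enough for [n >= 9] but not for [n = 8], which is why that rank needs an argument of its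
    own.

    The relations have to be lifted exactly first, because operators that commute only up to scalars
    need not share eigenvectors. The relation [w^4 = 1] is the one that this lifting does not
    provide: it holds up to a scalar, and that scalar is what the study of the squares of flips has
    to determine. *)

Lemma fresh_ord n (s : seq 'I_n) : (size s < n)%N -> exists i, i \notin s.
Proof.
move=> hs; case: (pickP (fun i => i \notin s)) => [i hi|h]; first by exists i.
have /card_geqP : (n <= #|s|)%N.
  by rewrite -[n in (n <= _)%N]card_ord; apply/subset_leq_card/subsetP => i _; rewrite -[_ \in _]negbK h.
move=> [t [ut st _]]; have := card_size s; rewrite leqNgt => /negP[].
apply: leq_trans hs _; rewrite -[n in (n <= _)%N]card_ord.
by apply/subset_leq_card/subsetP => i _; rewrite -[_ \in _]negbK h.
Qed.

Section MultiplicativeMaps.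
Variables (G H : groupType) (f : {multiplicative G -> H}).

Lemma gmul_morph1 : f 1 = 1.
Proof. by apply: (mulgI (f 1)); rewrite -gmulfM !mulg1. Qed.
Lemma gmul_morphV x : f x^-1 = (f x)^-1.
Proof. by apply: (mulgI (f x)); rewrite -gmulfM !mulgV gmul_morph1. Qed.

End MultiplicativeMaps.

Lemma aut_morph1 (G : groupType) (f : group_aut G) : f 1 = 1.
Proof. exact: (gmul_morph1 (aut_fun f : {multiplicative G -> G})). Qed.
Lemma aut_morphV (G : groupType) (f : group_aut G) x : f x^-1 = (f x)^-1.
Proof. exact: (gmul_morphV (aut_fun f : {multiplicative G -> G})). Qed.

Section Letters.
Variable n : nat.
Implicit Types (a b c d : letter n).

Lemma linv_neq a : linv a != a.
Proof. by case: a => i s; rewrite /linv xpair_eqE eqxx /=; case: s. Qed.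
Lemma linv_eq a b : (linv a == linv b) = (a == b).
Proof. by apply/eqP/eqP=> [/(congr1 (@linv n))|->//]; rewrite !linvK. Qed.
Lemma letterP a b : a.1 = b.1 -> a = b \/ a = linv b.
Proof.
case: a b => i s [j t] /= ->; case: s t => [] []; rewrite /linv /=; by [left|right].
Qed.
Lemma letter_neq a b : a.1 != b.1 -> a != b.
Proof. by apply: contraNneq => ->. Qed.

Lemma letter_valV a : letter_val (linv a) = (letter_val a)^-1.
Proof. by case: a => i []; rewrite /letter_val /= ?invgK. Qed.

Lemma letter_val_inj : injective (@letter_val n).
Proof. by move=> a b /(congr1 val); rewrite !val_letter_val => -[]. Qed.

(** One letter of each index is enough, and its sign may be chosen to suit the computation. *)
Lemma free_autP (f g : group_aut (free_group n)) :
  (forall i, exists2 c, c.1 = i & f (letter_val c) = g (letter_val c)) -> f = g.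
Proof.
move=> h; apply: group_autP => x.
have hl a : f (letter_val a) = g (letter_val a).
  have [c] := h a.1; case/letterP => -> //; rewrite letter_valV !aut_morphV.
  by move/invg_inj.
elim/free_group_ind: x => [|a x IH]; first by rewrite !aut_morph1.
by rewrite !aut_morph IH hl.
Qed.

Lemma free_liftV (G : groupType) (g : 'I_n -> G) x :
  free_lift g x^-1 = (free_lift g x)^-1.
Proof. exact: (gmul_morphV (free_lift g)). Qed.

(** For an inverse letter [a], the rule a -> a b means that the generator is multiplied by b^-1 on
    the left. When the indices coincide the map is the identity, so that it is invertible for all
    [a] and [b]. *)
Definition transv_fun a b : free_group n -> free_group n :=
  free_lift (fun i => if (i == a.1) && (a.1 != b.1) then
    if a.2 then (letter_val b)^-1 * free_gen i else free_gen i * letter_val b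
    else free_gen i).

Lemma transv_fun_out a b c : c.1 != a.1 -> transv_fun a b (letter_val c) = letter_val c.
Proof.
by rewrite /transv_fun /letter_val => /negPf h; case: c.2; rewrite ?free_liftV free_lift_gen h.
Qed.

Lemma transv_fun_in a b : a.1 != b.1 ->
  transv_fun a b (letter_val a) = letter_val a * letter_val b.
Proof.
case: a => i s /= h; rewrite /transv_fun /= [letter_val (i, s)]/letter_val /=.
by case: s; rewrite ?free_liftV free_lift_gen eqxx h ?invgM ?invgK.
Qed.

Lemma transv_funM a b : {morph transv_fun a b : x y / x * y}.
Proof. exact: free_lift_is_multiplicative. Qed.
Lemma transv_fun1 a b : transv_fun a b 1 = 1.
Proof. exact: gmul_morph1. Qed.
Lemma transv_funV a b x : transv_fun a b x^-1 = (transv_fun a b x)^-1.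
Proof. exact: gmul_morphV. Qed.

Lemma transv_fun_id a b : a.1 = b.1 -> transv_fun a b =1 id.
Proof.
move=> h x; symmetry; apply: (@free_lift_unique n _ _ idfun) => i.
by rewrite h eqxx andbF.
Qed.

Lemma transv_funK a b : cancel (transv_fun a b) (transv_fun a (linv b)).
Proof.
have [h|h] := eqVneq a.1 b.1; first by move=> x; rewrite !transv_fun_id.
have hl c : c = a \/ c.1 != a.1 ->
    transv_fun a (linv b) (transv_fun a b (letter_val c)) = letter_val c.
  case=> [->|ca]; last by rewrite !transv_fun_out.
  rewrite transv_fun_in // transv_funM transv_fun_in // transv_fun_out 1?eq_sym //.
  by rewrite letter_valV mulgVK.
have hl' c : transv_fun a (linv b) (transv_fun a b (letter_val c)) = letter_val c.
  have [/letterP[->|->]|h'] := eqVneq c.1 a.1; first by apply: hl; left.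
    by rewrite letter_valV !transv_funV hl //; left.
  by apply: hl; right.
by elim/free_group_ind => [|c x IH]; rewrite ?transv_fun1 // !transv_funM IH hl'.
Qed.

Definition transv a b : group_aut (free_group n) :=
  @GroupAut _ (transv_fun a b) (transv_fun a (linv b))
    (@free_lift_is_multiplicative _ _ _) (@transv_funK a b)
    (fun x => eq_ind _ (fun c => transv_fun a c _ = x)
       (transv_funK a (linv b) x) _ (linvK b)).

Arguments transv : simpl never.

Lemma transv_out a b c : c.1 != a.1 -> transv a b (letter_val c) = letter_val c.
Proof. exact: transv_fun_out. Qed.

Lemma transv_in a b : a.1 != b.1 ->
  transv a b (letter_val a) = letter_val a * letter_val b.
Proof. exact: transv_fun_in. Qed.

Lemma transv_inV a b c : a.1 != b.1 -> c = linv a ->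
  transv a b (letter_val c) = (letter_val b)^-1 * letter_val c.
Proof. by move=> h ->; rewrite letter_valV aut_morphV transv_in // invgM. Qed.

Lemma transvV a b : transv a (linv b) = (transv a b)^-1.
Proof. by apply: group_autP. Qed.

Lemma transv_id a b : a.1 = b.1 -> transv a b = 1.
Proof. by move=> h; apply: group_autP => x; apply: transv_fun_id. Qed.

Lemma aut_mulE (f g : group_aut (free_group n)) x : (f * g) x = f (g x).
Proof. by []. Qed.

(** The case [c = linv a] is included: one map multiplies the same generator on the right, the other
    on the left. *)
Lemma transv_commute a b c d : a.1 != b.1 -> c.1 != d.1 -> a != c ->
  a.1 != d.1 -> b.1 != c.1 -> commute (transv a b) (transv c d).
Proof.
move=> ab cd ac ad bc; have da : d.1 != a.1 by rewrite eq_sym.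
apply: free_autP => i; have [ia|ia] := eqVneq i a.1; last first.
  have [ic|ic] := eqVneq i c.1; last first.
    by exists (i, false) => //; rewrite !aut_mulE !transv_out.
  exists c => //; rewrite !aut_mulE (transv_out b) -?ic //.
  by rewrite !transv_in // aut_morph !transv_out // -ic.
exists a => //; rewrite !aut_mulE [in RHS]transv_in // aut_morph.
rewrite [transv c d (letter_val b)]transv_out //.
have [ac1|ac1] := eqVneq a.1 c.1; last first.
  by rewrite transv_out // transv_in.
have /letterP[e|e] := ac1; first by rewrite e eqxx in ac.
rewrite transv_inV // aut_morph aut_morphV transv_in // transv_out //.
by rewrite mulgA.
Qed.

(** The inverse of [b] is needed: with [transv b c] in its place, [a] would go to a b c^-1 b^-1,
    which is not the image under a transvection of this kind. *)
Lemma transv_commutator a b c : a.1 != b.1 -> a.1 != c.1 -> b.1 != c.1 ->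
  transv a b * transv (linv b) c / transv a b / transv (linv b) c = transv a c.
Proof.
move=> ab ac bc; apply: (mulIg (transv (linv b) c)); rewrite mulgVK.
apply: (mulIg (transv a b)); rewrite mulgVK; apply: free_autP => i.
have [->|ia] := eqVneq i a.1.
  exists a => //; rewrite !aut_mulE [in LHS]transv_out // !transv_in //.
  rewrite !aut_morph (transv_out _ (c := a)) // (@transv_inV (linv b) c b) ?linvK //.
  rewrite aut_morph aut_morphV transv_in // !transv_out 1?eq_sym //.
  by rewrite mulgA mulgK.
have [->|ib] := eqVneq i b.1.
  exists (linv b) => //; rewrite !aut_mulE.
  rewrite (transv_out b) // 1?eq_sym // transv_in // !aut_morph !transv_out //= 1?eq_sym //.
by exists (i, false) => //; rewrite !aut_mulE !transv_out.
Qed.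

Definition sw a b c : letter n :=
  if c == a then linv b else if c == linv a then b else
  if c == b then a else if c == linv b then linv a else c.

(** The analogue of writing the rotation by a right angle in SL_2 as a product of three elementary
    matrices. *)
Definition weyl a b := transv (linv b) (linv a) * transv (linv a) b * transv b a.

Lemma sw_out a b c : c.1 != a.1 -> c.1 != b.1 -> sw a b c = c.
Proof.
rewrite /sw => ca cb; do 4! (case: eqP => [e|_]; first by rewrite e eqxx in ca cb).
by [].
Qed.
Lemma sw_fst a b : sw a b a = linv b. Proof. by rewrite /sw eqxx. Qed.
Lemma sw_snd a b : a.1 != b.1 -> sw a b b = a.
Proof.
rewrite eq_sym /sw eqxx => h; rewrite (negPf (letter_neq h)).
by rewrite (negPf (_ : b != linv a)) // letter_neq.
Qed.
Lemma swV a b c : a.1 != b.1 -> sw a b (linv c) = linv (sw a b c).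
Proof.
move=> h; have h' : b.1 != a.1 by rewrite eq_sym.
have [e|ca] := eqVneq c.1 a.1.
  have /letterP[->|->] := e; rewrite ?linvK /sw ?eqxx ?(negPf (linv_neq _)) ?linvK //.
have [e|cb] := eqVneq c.1 b.1; last by rewrite !sw_out.
have hab : (b == a) = false by apply: negbTE; apply: letter_neq.
have hab' : (b == linv a) = false by apply: negbTE; apply: letter_neq.
have hab2 : (linv b == a) = false by apply: negbTE; apply: letter_neq.
have /letterP[->|->] := e; rewrite ?linvK /sw ?linv_eq ?hab ?hab' ?hab2 ?eqxx ?(negPf (linv_neq _)) ?linvK //.
Qed.
Lemma sw1 a b c : a.1 != b.1 -> (sw a b c).1 = tperm a.1 b.1 c.1.
Proof.
move=> ab; have [/letterP[->|->]|ca] := eqVneq c.1 a.1.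
- by rewrite sw_fst tpermL.
- by rewrite swV // sw_fst linvK /= tpermL.
have [/letterP[->|->]|cb] := eqVneq c.1 b.1.
- by rewrite sw_snd // tpermR.
- by rewrite swV // sw_snd //= tpermR.
by rewrite sw_out // tpermD // eq_sym.
Qed.
Lemma sw_neq1 a b c d : a.1 != b.1 -> ((sw a b c).1 != (sw a b d).1) = (c.1 != d.1).
Proof. by move=> ab; rewrite !sw1 // (inj_eq perm_inj). Qed.

Lemma weylE a b c : a.1 != b.1 -> weyl a b (letter_val c) = letter_val (sw a b c).
Proof.
move=> ab; have ba : b.1 != a.1 by rewrite eq_sym.
have ha : weyl a b (letter_val a) = letter_val (linv b).
  rewrite /weyl !aut_mulE (transv_out (a := b)) // (@transv_inV (linv a) b a) ?linvK //.
  rewrite aut_morph aut_morphV (@transv_inV (linv b) (linv a) b) ?linvK // transv_out //.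
  by rewrite !letter_valV invgM !invgK mulgVK.
have hb : weyl a b (letter_val b) = letter_val a.
  rewrite /weyl !aut_mulE transv_in // aut_morph (transv_out _ (c := b)) //.
  rewrite (@transv_inV (linv a) b a) ?linvK // mulVKg transv_out //.
have [/letterP[->|->]|ca] := eqVneq c.1 a.1; rewrite ?swV ?sw_fst // ?letter_valV ?aut_morphV ?ha //.
  by rewrite letter_valV.
have [/letterP[->|->]|cb] := eqVneq c.1 b.1; rewrite ?swV ?sw_snd // ?letter_valV ?aut_morphV ?hb //.
by rewrite sw_out // /weyl !aut_mulE !transv_out.
Qed.

Lemma transv_conj (f : group_aut (free_group n)) (s : letter n -> letter n) a b :
  (forall c, f (letter_val c) = letter_val (s c)) -> a.1 != b.1 ->
  injective (fst \o s \o pair^~ false) ->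
  (forall c d, c.1 = d.1 -> (s c).1 = (s d).1) ->
  f * transv a b = transv (s a) (s b) * f.
Proof.
move=> fs ab s_inj s1; apply: free_autP => i.
have s_neq c d : c.1 != d.1 -> (s c).1 != (s d).1.
  apply: contraNneq => e; apply/eqP/s_inj => /=.
  by rewrite (s1 (c.1, false) c) // (s1 (d.1, false) d).
have [->|ia] := eqVneq i a.1.
  by exists a => //; rewrite !aut_mulE transv_in // aut_morph !fs transv_in // s_neq.
by exists (i, false) => //; rewrite !aut_mulE transv_out // !fs transv_out // s_neq.
Qed.

Lemma weyl_conj a b c d : a.1 != b.1 -> c.1 != d.1 ->
  weyl a b * transv c d / weyl a b = transv (sw a b c) (sw a b d).
Proof.
move=> ab cd; apply: (mulIg (weyl a b)); rewrite mulgVK.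
apply: transv_conj => //; first by move=> e; apply: weylE.
- by move=> i j /=; rewrite !sw1 // => /perm_inj.
- by move=> e f ef; rewrite !sw1 // ef.
Qed.

Lemma sw_sw a b c : a.1 != b.1 -> sw a b (sw a b c) =
  if (c.1 == a.1) || (c.1 == b.1) then linv c else c.
Proof.
move=> ab; have [/letterP[->|->]|ca] := eqVneq c.1 a.1.
- by rewrite sw_fst swV // sw_snd.
- by rewrite !swV // sw_fst swV // sw_snd.
have [/letterP[->|->]|cb] := eqVneq c.1 b.1.
- by rewrite sw_snd // sw_fst.
- by rewrite !swV // sw_snd // sw_fst.
by rewrite !sw_out.
Qed.

Lemma weyl4 a b : a.1 != b.1 -> weyl a b * weyl a b * (weyl a b * weyl a b) = 1.
Proof.
move=> ab; apply: free_autP => i; exists (i, false) => //.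
rewrite 3!aut_mulE !weylE // !sw_sw //=.
by case h: ((i == a.1) || (i == b.1)); rewrite /= h ?linvK.
Qed.

End Letters.

(** * Words *)

Section CommonPrefix.
Variable T : eqType.
Implicit Types s t : seq T.

(** Length of the longest common prefix; applied to [wordV u] and [v] it counts the letters
    cancelled from each factor of u v. *)
Fixpoint lcp s t : nat :=
  if s is x :: s' then
    if t is y :: t' then if x == y then (lcp s' t').+1 else 0%N else 0%N
  else 0%N.

Lemma lcpC s t : lcp s t = lcp t s.
Proof. by elim: s t => [|x s IH] [|y t] //=; rewrite eq_sym IH. Qed.

Lemma lcp_sizel s t : (lcp s t <= size s)%N.
Proof. by elim: s t => [|x s IH] [|y t] //=; case: ifP => // _; rewrite ltnS IH. Qed.

Lemma lcp_sizer s t : (lcp s t <= size t)%N.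
Proof. by rewrite lcpC lcp_sizel. Qed.

Lemma take_lcp s t : take (lcp s t) s = take (lcp s t) t.
Proof. by elim: s t => [|x s IH] [|y t] //=; case: eqP => // -> /=; rewrite IH. Qed.

Lemma nth_lcp x0 s t i : (i < lcp s t)%N -> nth x0 s i = nth x0 t i.
Proof. by move=> h; rewrite -(nth_take x0 h s) take_lcp nth_take. Qed.

Lemma lcp_congr k s t t' : (lcp s t < k)%N -> take k t = take k t' ->
  lcp s t' = lcp s t.
Proof.
elim: k s t t' => // k IH [|x s] [|y t] [|z t'] //=.
case: (eqVneq x y) => [->|ne] h [<- e]; last by rewrite (negPf ne).
by rewrite eqxx (IH _ t).
Qed.

Lemma leq_lcp k s t : (k <= size s)%N -> (k <= size t)%N -> take k s = take k t ->
  (k <= lcp s t)%N.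
Proof.
elim: k s t => // k IH [|x s] [|y t] //= hs ht [-> e].
by rewrite eqxx ltnS IH.
Qed.

End CommonPrefix.

Section Words.
Variable n : nat.
Implicit Types (a b c d : letter n) (u v w : seq (letter n)).

Lemma wordV_rcons w a : wordV (rcons w a) = linv a :: wordV w.
Proof. by rewrite /wordV map_rcons rev_rcons. Qed.
Lemma size_wordV w : size (wordV w) = size w.
Proof. by rewrite /wordV size_rev size_map. Qed.
Lemma wordVV w : wordV (wordV w) = w.
Proof. by rewrite /wordV map_rev revK -map_comp map_id_in // => a _ /=; rewrite linvK. Qed.
Lemma wordV_cat u v : wordV (u ++ v) = wordV v ++ wordV u.
Proof. by rewrite /wordV map_cat rev_cat. Qed.

Lemma push_reduced_cat u v : reduced (u ++ v) -> foldr (@push n) v u = u ++ v.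
Proof.
elim: u => //= a u IH r; rewrite IH ?push_cons //; exact: reduced_behead r.
Qed.

Lemma reduced_cat_cons u a v : reduced (rcons u a) -> reduced (a :: v) ->
  reduced (u ++ a :: v).
Proof.
rewrite /reduced; case: u => [|b u] //=.
by rewrite rcons_path cat_path /= => /andP[-> ->] ->.
Qed.

Lemma foldr_push_lcp u v : reduced u -> reduced v ->
  foldr (@push n) v u =
  take (size u - lcp (wordV u) v) u ++ drop (lcp (wordV u) v) v.
Proof.
elim/last_ind: u v => [|u a IH] v; first by rewrite /= drop0.
rewrite foldr_rcons wordV_rcons => ru rv.
have ru' : reduced u.
  by move: ru; rewrite /reduced; case: u {IH} => //= b u; rewrite rcons_path => /andP[].
case: v rv => [|b v] rv.
  by rewrite /= subn0 take_size cats0 push_reduced_cat ?cats1.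
rewrite [lcp _ _]/= eq_sym [push _ _]/=; case: eqP => [e|ne].
  have rv' := reduced_behead rv.
  by rewrite IH // size_rcons subSS -cats1 takel_cat // leq_subr.
rewrite subn0 take_size drop0 push_reduced_cat ?cat_rcons //.
by apply: reduced_cat_cons => //; rewrite /reduced /=; apply/andP; split; [apply/eqP|].
Qed.

Lemma size_foldr_push u v : reduced u -> reduced v ->
  (size (foldr (@push n) v u) + 2 * lcp (wordV u) v = size u + size v)%N.
Proof.
move=> ru rv; rewrite foldr_push_lcp // size_cat size_takel ?leq_subr // size_drop.
have h1 : (lcp (wordV u) v <= size v)%N by exact: lcp_sizer.
have h2 : (lcp (wordV u) v <= size (wordV u))%N by exact: lcp_sizel.
by rewrite size_wordV in h2; lia.
Qed.

(* A word meets its inverse in less than half of its length: otherwise one of its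
   letters would be its own inverse, or be followed by its inverse. *)
Lemma lcp_wordV_lt w : reduced w -> w != [::] -> (2 * lcp (wordV w) w < size w)%N.
Proof.
case: w => // a w; set s := a :: w => rs _; rewrite ltnNge; apply/negP => h.
have nthV i : (i < size s)%N -> (i < lcp (wordV s) s)%N ->
    nth a s i = linv (nth a s (size s - i.+1)).
  move=> is_ il; rewrite -(nth_lcp a il) /wordV nth_rev ?size_map //.
  by rewrite (nth_map a) // ltn_subrL.
have s0 : (0 < size s)%N by [].
have [/eqP|o] := boolP (odd (size s)); last first.
  have es : size s = (2 * (size s)./2)%N by lia.
  set t := (size s)./2 in es.
  have t0 : (0 < t)%N by lia.
  have := nthV t.-1 ltac:(lia) ltac:(lia).
  have -> : (size s - t.-1.+1 = t)%N by lia.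
  move=> e; move/(sortedP a)/(_ t.-1): rs; rewrite prednK //.
  by move/(_ ltac:(lia)); rewrite e linvK eqxx.
rewrite eqb_id => o; have es : size s = (2 * (size s)./2).+1 by lia.
set t := (size s)./2 in es.
have := nthV t ltac:(lia) ltac:(lia); have -> : (size s - t.+1 = t)%N by lia.
by move/eqP; rewrite eq_sym (negPf (linv_neq _)).
Qed.

Definition digit a : nat := (2 * a.1 + a.2)%N.
(** The word read in base 2n, first letter as lowest digit. It is injective on words of a given
    length and so breaks the ties of length in Nielsen reduction. *)
Definition num w : nat := foldr (fun a x => digit a + 2 * n * x)%N 0%N w.

Lemma digit_lt a : (digit a < 2 * n)%N.
Proof. by rewrite /digit; case: a => i [] /=; have := ltn_ord i; lia. Qed.

Lemma digit_inj : injective digit.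
Proof.
case=> i s [j t]; rewrite /digit /= => h; congr (_, _); last by case: s t h => [] []; lia.
by apply: val_inj => /=; case: s t h => [] []; lia.
Qed.

Lemma num_cat u v : num (u ++ v) = (num u + (2 * n) ^ size u * num v)%N.
Proof.
elim: u => [|a u IH] /=; first by rewrite mul1n.
by rewrite IH expnS; lia.
Qed.

Lemma num_inj u v : size u = size v -> num u = num v -> u = v.
Proof.
elim: u v => [|a u IH] [|b v] //= [suv] e.
have ea : digit a = digit b.
  have := congr1 (modn^~ (2 * n)%N) e.
  by rewrite !(addnC (digit _)) !(mulnC (2 * n)%N) !modnMDl !modn_small ?digit_lt.
have n0 : (0 < 2 * n)%N by exact: leq_ltn_trans (digit_lt a).
congr (_ :: _); first exact: digit_inj.
by apply: IH => //; apply/eqP; rewrite -(eqn_pmul2l n0); apply/eqP; lia.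
Qed.

End Words.

(** * Nielsen reduction *)

Section Nielsen.
Variable n : nat.
Implicit Types (a b c d : letter n) (u v w : seq (letter n)).
Implicit Types f g : group_aut (free_group n).

Lemma val_prod_letters w : reduced w -> val (\prod_(c <- w) letter_val c) = w.
Proof.
elim: w => [|a w IH] rw; first by rewrite big_nil.
rewrite big_cons /= -[word (letter_val a)]/(val (letter_val a)) val_letter_val /=.
by rewrite -[word _]/(val _) IH ?push_cons //; exact: reduced_behead rw.
Qed.

Lemma prod_letters (x : free_group n) : \prod_(c <- val x) letter_val c = x.
Proof. by apply: val_inj; rewrite val_prod_letters // (word_reduced x). Qed.

Definition img f a : seq (letter n) := val (f (letter_val a)).

Lemma img_reduced f a : reduced (img f a). Proof. exact: word_reduced. Qed.

Lemma imgV f a : img f (linv a) = wordV (img f a).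
Proof. by rewrite /img letter_valV aut_morphV. Qed.

Lemma img_neq0 f a : img f a != [::].
Proof.
apply/eqP => h; have e : letter_val a = 1.
  by apply: (can_inj (aut_funK f)); rewrite aut_morph1; apply: val_inj.
by have := val_letter_val a; rewrite e.
Qed.

(** The number of letters cancelled from each factor in f(a)^-1 f(b). *)
Definition cancels f a b : nat := lcp (img f a) (img f b).

Lemma cancelsC f a b : cancels f a b = cancels f b a.
Proof. exact: lcpC. Qed.

(** In f(d)^-1 f(b) f(d') at least one letter of the middle factor survives the cancellation from
    both sides. *)
Definition nielsen_reduced f := forall b d d', d != b -> d' != linv b ->
  (cancels f d b + cancels f d' (linv b) < size (img f b))%N.

(** Since a letter of f(a) survives, what follows f(a) cannot affect how the product cancels against
    f(d), and each further factor adds at least one letter. *)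
Lemma nielsen_growth f a v : nielsen_reduced f -> reduced (a :: v) ->
  let F := val (f (\prod_(c <- a :: v) letter_val c)) in
  forall d, d != a -> lcp (img f d) F = cancels f d a /\
    (cancels f d a + (size v).+1 <= size F)%N.
Proof.
move=> fr; elim: v a => [|b v IH] a rv /= d da.
  rewrite big_seq1; split=> //; rewrite addn1.
  apply: leq_ltn_trans (fr a d a da _); first exact: leq_addr.
  by rewrite eq_sym linv_neq.
have rbv : reduced (b :: v) by exact: reduced_behead rv.
have ba : b != linv a by move: rv => /= /andP[].
rewrite big_cons aut_morph /=; set G := f (\prod_(c <- b :: v) letter_val c).
have [|e lG] := IH b rbv (linv a); first by rewrite eq_sym.
rewrite -/G in e lG.
have ra := img_reduced f a; have rG : reduced (val G) by exact: word_reduced.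
have -> : word (f (letter_val a)) = img f a by [].
rewrite -[word G]/(val G) foldr_push_lcp // -imgV e.
set m := cancels f (linv a) b in e lG *; set l := cancels f d a.
have hl : (l + m < size (img f a))%N by rewrite /m cancelsC; apply: fr.
split.
  apply: (lcp_congr (k := (size (img f a) - m)%N)); first by rewrite -/(cancels f d a) -/l; lia.
  by rewrite take_size_cat // size_takel // leq_subr.
rewrite size_cat size_takel ?leq_subr // size_drop; move: lG => /=; lia.
Qed.

(** The image of the preimage has length one, so by the growth bound the preimage is a single
    letter. *)
Lemma nielsen_reduced_letter f b : nielsen_reduced f ->
  exists a, aut_inv f (letter_val b) = letter_val a.
Proof.
move=> fr; set x := aut_inv f (letter_val b).
have fx : f x = letter_val b by exact: aut_invK.
have := prod_letters x; case e: (val x) => [|a v] => h.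
  by move: fx; rewrite -h big_nil aut_morph1 => /(congr1 val); rewrite val_letter_val.
have rv : reduced (a :: v) by rewrite -e; exact: word_reduced.
have [_] := nielsen_growth fr rv (linv_neq a).
rewrite h fx val_letter_val /=; case: v {e rv} h => [|c v] /= h; last by lia.
by exists a; rewrite -h big_seq1.
Qed.

Definition total_size f := (\sum_(i < n) size (img f (i, false)))%N.
(** In [nielsen_tie], of the initial halves of an image and of its inverse, one stays the same and
    the other gets a prefix with smaller [num]. *)
Definition half_num w := num (take (size w)./2 w).
Definition total_num f :=
  (\sum_(i < n) (half_num (img f (i, false)) + half_num (img f (i, true))))%N.

Lemma img_transv_out f a b c : c.1 != a.1 -> img (f * transv a b) c = img f c.
Proof. by move=> ca; rewrite /img aut_mulE transv_out. Qed.
Lemma img_transv_in f a b : a.1 != b.1 ->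
  img (f * transv a b) a = foldr (@push n) (img f b) (img f a).
Proof. by move=> ca; rewrite /img aut_mulE transv_in // aut_morph. Qed.

Lemma size_img f a : size (img f (a.1, false)) = size (img f a).
Proof.
by case: a => i [] //=; rewrite (_ : (i, true) = linv (i, false)) // imgV size_wordV.
Qed.

Lemma half_num_img f a :
  (half_num (img f (a.1, false)) + half_num (img f (a.1, true)) =
   half_num (img f a) + half_num (img f (linv a)))%N.
Proof. by case: a => i [] //=; rewrite addnC. Qed.

Lemma total_size_transv f a b : a.1 != b.1 ->
  (total_size (f * transv a b)%g + size (img f a) =
   total_size f + size (img (f * transv a b)%g a))%N.
Proof.
move=> ab; rewrite /total_size (bigD1 a.1) //= [in RHS](bigD1 a.1) //= !size_img.
rewrite (eq_bigr (fun i => size (img f (i, false)))); first by lia.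
by move=> i ia; rewrite img_transv_out.
Qed.

Lemma total_num_transv f a b : a.1 != b.1 ->
  (total_num (f * transv a b)%g + (half_num (img f a) + half_num (img f (linv a))) =
   total_num f + (half_num (img (f * transv a b)%g a) +
     half_num (img (f * transv a b)%g (linv a))))%N.
Proof.
move=> ab; rewrite /total_num (bigD1 a.1) //= [in RHS](bigD1 a.1) //= !half_num_img.
rewrite (eq_bigr (fun i => half_num (img f (i, false)) + half_num (img f (i, true))))%N.
  by lia.
by move=> i ia; rewrite !img_transv_out.
Qed.

Definition nielsen_smaller f g :=
  (total_size f < total_size g)%N \/
  total_size f = total_size g /\ (total_num f < total_num g)%N.

Lemma size_img_transv f a b : a.1 != b.1 ->
  (size (img (f * transv a b)%g a) + 2 * cancels f (linv a) b =
   size (img f a) + size (img f b))%N.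
Proof.
by move=> ab; rewrite img_transv_in // /cancels imgV size_foldr_push ?img_reduced.
Qed.

Lemma nielsen_shorten f b d : d.1 != b.1 -> (size (img f b) < 2 * cancels f d b)%N ->
  exists a c, nielsen_smaller (f * transv a c) f.
Proof.
move=> db h; exists (linv d), b; left.
have := @total_size_transv f (linv d) b db; have := @size_img_transv f (linv d) b db.
by rewrite linvK !imgV size_wordV; lia.
Qed.

Lemma half_leq m k : (2 * m <= k -> m <= k./2)%N.
Proof. by move=> h; rewrite -[m]doubleK -mul2n half_leq. Qed.

(* A middle factor [p q^-1] that is cancelled half from each side is not shortened
   by any move; replacing the prefix [p] of a neighbour by [q] lowers [total_num]
   instead. *)
Lemma nielsen_tie f b d (l := cancels f d b) : d.1 != b.1 ->
  (2 * l = size (img f b))%N -> (2 * l <= size (img f d))%N ->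
  (num (take l (img f (linv b))) < num (take l (img f b)))%N ->
  exists a c, nielsen_smaller (f * transv a c) f.
Proof.
move=> db eb led hnum; exists (linv d), b; right.
set f' := f * _.
have db' : (linv d).1 != b.1 by [].
have es := size_img_transv f db'; rewrite linvK -/l in es.
split.
  by have := total_size_transv f db'; rewrite -/f' (imgV f) size_wordV in es *; lia.
have := total_num_transv f db'; rewrite -/f' linvK.
set p := take l (img f b) in hnum; set r := drop l (img f b).
set t := drop l (img f d).
have eub : img f b = p ++ r by rewrite cat_take_drop.
have eud : img f d = p ++ t.
  by rewrite /p {1}/l cancelsC /cancels take_lcp -/(cancels f b d) cancelsC cat_take_drop.
have sp : size p = l by rewrite size_takel //; lia.
have sr : size r = l by rewrite size_drop; lia.
have edV : img f (linv d) = wordV t ++ wordV p by rewrite imgV eud wordV_cat.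
have eb' : take l (img f (linv b)) = wordV r.
  by rewrite imgV eub wordV_cat take_size_cat // size_wordV.
rewrite eb' in hnum.
have edV' : img f' (linv d) = wordV t ++ r.
  rewrite img_transv_in // foldr_push_lcp ?img_reduced // -imgV linvK.
  rewrite -/(cancels f d b) -/l -/r edV size_cat !size_wordV sp addnK.
  by rewrite take_size_cat // size_wordV.
have ed' : img f' d = wordV r ++ t by rewrite -[d in LHS]linvK imgV edV' wordV_cat wordVV.
have st : (2 * l <= l + size t)%N by move: led; rewrite eud size_cat sp.
rewrite edV edV' eud ed' /half_num !size_cat !size_wordV sp sr [(size t + l)%N]addnC.
set h := (l + size t)./2.
have lh : (l <= h)%N by apply: half_leq.
have ht : (h <= size t)%N by rewrite /h; lia.
rewrite ![take h (wordV t ++ _)]take_cat size_wordV.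
have e2 x : (if (h < size t)%N then take h (wordV t) else wordV t ++ take (h - size t) x) =
   take h (wordV t).
  by case: ltnP => // h'; rewrite (_ : h = size t) ?subnn ?take0 ?cats0 ?take_oversize ?size_wordV //; lia.
rewrite !e2 !take_cat size_wordV sp sr ltnNge lh /= !num_cat size_wordV sp sr.
move: (_ ^ _ * _)%N (num (take h _)) => X Y; lia.
Qed.

(** If no move shortens, each cancellation takes at most half of a factor. A violation then cancels
    exactly half of f(b) from either side, and the tie can be broken at one side or the other
    according to which half has the smaller number. Equal numbers would make f(b) share half of its
    letters with its inverse, contrary to [lcp_wordV_lt]. *)
Lemma nielsen_step f : ~ nielsen_reduced f ->
  exists a c, nielsen_smaller (f * transv a c) f.
Proof.
move=> nf; apply: contrapT => min; apply: nf => b d d' db d'b.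
have bound x y : x.1 != y.1 -> (2 * cancels f x y <= size (img f y))%N.
  by move=> xy; rewrite leqNgt; apply/negP => /(nielsen_shorten xy).
have self y : (2 * cancels f (linv y) y < size (img f y))%N.
  by rewrite /cancels imgV lcp_wordV_lt ?img_reduced ?img_neq0.
have weak x y : x != y -> (2 * cancels f x y <= size (img f y))%N.
  move=> xy; have [/letterP[e|->]|] := eqVneq x.1 y.1; last exact: bound.
    by rewrite e eqxx in xy.
  exact/ltnW/self.
have sV : size (img f (linv b)) = size (img f b) by rewrite imgV size_wordV.
have h1 := weak _ _ db; have h2 := weak _ _ d'b; rewrite sV in h2.
rewrite ltnNge; apply/negP => h3.
have e1 : (2 * cancels f d b = size (img f b))%N by lia.
have e2 : (2 * cancels f d' (linv b) = size (img f b))%N by lia.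
have ne x y : x != y -> (2 * cancels f x y = size (img f y))%N -> x.1 != y.1.
  move=> xy e; apply/eqP => /letterP[exy|exy]; first by rewrite exy eqxx in xy.
  by have := self y; rewrite -exy e ltnn.
have n1 := ne _ _ db e1; have n2 := ne _ _ d'b (etrans e2 (esym sV)).
have el : cancels f d' (linv b) = cancels f d b by lia.
have f1 := bound b d ltac:(by rewrite eq_sym); rewrite cancelsC in f1.
have f2 := bound (linv b) d' ltac:(by rewrite eq_sym); rewrite cancelsC el in f2.
case: (ltngtP (num (take (cancels f d b) (img f b)))
              (num (take (cancels f d b) (img f (linv b))))) => hn.
- by apply: min; apply: (nielsen_tie n2); rewrite ?linvK ?el ?sV.
- by apply: min; apply: (nielsen_tie n1).
have /(@num_inj n) : size (take (cancels f d b) (img f b)) =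
    size (take (cancels f d b) (img f (linv b))) by rewrite !size_take sV.
move/(_ hn)/esym/leq_lcp => hl.
have := self b; rewrite /cancels ltnNge => /negP[].
have hc : (cancels f d b <= size (img f b))%N by lia.
by rewrite -e1 leq_pmul2l //; apply: hl; rewrite ?sV.
Qed.

Definition transv_prod (s : seq (letter n * letter n)) : group_aut (free_group n) :=
  \prod_(p <- s) transv p.1 p.2.

Lemma exists_nielsen_reduced f : exists s, nielsen_reduced (f * transv_prod s).
Proof.
(* Lexicographic induction through two bounds: when [total_size] drops, the bound on [total_num] is
   chosen afresh. *)
suff main N1 N2 g : (total_size g < N1)%N -> (total_num g < N2)%N ->
    exists s, nielsen_reduced (g * transv_prod s).
  exact: (main (total_size f).+1 (total_num f).+1).
elim: N1 N2 g => // N1 IH1; elim=> // N2 IH2 g h1 h2.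
have [gr|/nielsen_step[a [c hs]]] := pselect (nielsen_reduced g).
  by exists [::]; rewrite /transv_prod big_nil mulg1.
have [s rs] : exists s, nielsen_reduced (g * transv a c * transv_prod s).
  case: hs => [h|[e h]]; last by apply: IH2; rewrite ?e //; exact: leq_trans h h2.
  apply: (IH1 (total_num (g * transv a c)%g).+1) => //; exact: leq_trans h h1.
by exists ((a, c) :: s); rewrite /transv_prod big_cons mulgA.
Qed.

End Nielsen.

(** * Transvections generate SAut(F_n) *)

Section Generation.
Variable n : nat.
Implicit Types (a b c d : letter n).
Implicit Types f g h : group_aut (free_group n).

Lemma det_abel_mxM f g :
  \det (abel_mx (f * g)%g) = (\det (abel_mx f) * \det (abel_mx g))%R.
Proof. by rewrite abel_mxM det_mulmx. Qed.

Lemma det_abel_mxV f : (\det (abel_mx f) * \det (abel_mx f^-1%g) = 1)%R.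
Proof. by rewrite -det_abel_mxM mulgV abel_mx1 det1. Qed.

(** A transvection is a commutator by way of a third index, and determinants of commutators are
    1. *)
Lemma det_transv a b : (2 < n)%N -> \det (abel_mx (transv a b)) = 1%R.
Proof.
move=> n2; have [ab|ab] := eqVneq a.1 b.1; first by rewrite transv_id // abel_mx1 det1.
have [k] := @fresh_ord n [:: a.1; b.1] n2.
rewrite !inE negb_or => /andP[ka kb].
rewrite -(@transv_commutator _ a (k, false) b) // 1?eq_sym //.
set x := transv a _; set y := transv (linv _) _.
rewrite !det_abel_mxM; have := det_abel_mxV x; have := det_abel_mxV y.
move: (\det _) (\det _) (\det _) (\det _) => p q r s; lia.
Qed.

Lemma transv_is_SAut a b : (2 < n)%N -> is_SAut (transv a b).
Proof. by move=> n2; rewrite /is_SAut det_transv. Qed.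

Definition gen_transv f := exists s, f = transv_prod s.

Lemma gen_transvM f g : gen_transv f -> gen_transv g -> gen_transv (f * g).
Proof.
by move=> [s ->] [t ->]; exists (s ++ t); rewrite /transv_prod big_cat.
Qed.

Lemma gen_transv1 : gen_transv 1.
Proof. by exists [::]; rewrite /transv_prod big_nil. Qed.

Lemma gen_transv_transv a b : gen_transv (transv a b).
Proof. by exists [:: (a, b)]; rewrite /transv_prod big_seq1. Qed.

Lemma gen_transvV f : gen_transv f -> gen_transv f^-1.
Proof.
move=> [s ->]; elim: s => [|p s IH].
  rewrite /transv_prod big_nil invg1; exact: gen_transv1.
rewrite /transv_prod big_cons invgM -transvV; apply: gen_transvM => //.
exact: gen_transv_transv.
Qed.

Lemma gen_weyl a b : gen_transv (weyl a b).
Proof. by do 2! (apply: gen_transvM; last exact: gen_transv_transv); exact: gen_transv_transv. Qed.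

Lemma gen_transv_cancel f g : gen_transv g -> gen_transv (g * f) -> gen_transv f.
Proof.
by move=> hg hf; rewrite -(mulKg g f); apply: gen_transvM => //; exact: gen_transvV.
Qed.

Definition monomial f := forall b, exists a, f (letter_val b) = letter_val a.

Lemma monomial_weyl f a b : a.1 != b.1 -> monomial f -> monomial (weyl a b * f).
Proof.
move=> ab fm c; have [d e] := fm c; exists (sw a b d).
by rewrite aut_mulE e weylE.
Qed.

(** Weyl elements put a signed permutation in order one generator at a time, [m] being the number
    already fixed. A wrong sign is corrected by the square of a Weyl element, which also flips the
    next generator; at the last generator a wrong sign would make the determinant -1. *)
Lemma gen_monomial f : (2 < n)%N -> monomial f -> \det (abel_mx f) = 1%R ->
  gen_transv f.
Proof.
move=> n2.
have detw a b : \det (abel_mx (weyl a b)) = 1%R.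
  by rewrite /weyl !det_abel_mxM !det_transv // !mul1r.
suff main k m h : (n - m <= k)%N -> (m <= n)%N -> monomial h ->
    \det (abel_mx h) = 1%R ->
    (forall i : 'I_n, (i < m)%N -> h (letter_val (i, false)) = letter_val (i, false)) ->
    gen_transv h.
  by move=> fm f1; apply: (main n 0%N) => //; rewrite subn0.
elim: k m h => [|k IH] m h hk hm hmon h1 hfix.
  have -> : h = 1; last exact: gen_transv1.
  apply: free_autP => i; exists (i, false) => //; apply: hfix.
  by have := ltn_ord i; lia.
have [mn|mn] := ltnP m n; last first.
  by apply: (IH m) => //; lia.
pose i := Ordinal mn; have [c hc] := hmon (i, false).
have fixV (j : 'I_n) s : (j < m)%N -> h (letter_val (j, s)) = letter_val (j, s).
  move=> jm; case: s; last exact: hfix.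
  by rewrite (_ : (j, true) = linv (j, false)) // letter_valV aut_morphV hfix.
have cm : (m <= c.1)%N.
  rewrite leqNgt; apply/negP => cm; have := fixV c.1 c.2 cm.
  rewrite -surjective_pairing -hc => e1.
  have := can_inj (aut_funK h) e1; rewrite hc => /letter_val_inj ec.
  by move: cm; rewrite ec ltnn.
have step g : (forall j : 'I_n, (j < m)%N -> g (letter_val (j, false)) = letter_val (j, false)) ->
    gen_transv g -> monomial (g * h) -> \det (abel_mx g) = 1%R ->
    (g * h) (letter_val (i, false)) = letter_val (i, false) -> gen_transv h.
  move=> gfix gg gm g1 ghi; apply: (gen_transv_cancel gg).
  apply: (IH m.+1) => //; first by lia.
    by rewrite det_abel_mxM g1 h1 mulr1.
  move=> j; rewrite ltnS leq_eqVlt => /orP[/eqP ej|jm].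
    by rewrite (_ : j = i) //; apply: val_inj.
  by rewrite aut_mulE hfix // gfix.
have [ci|ci] := eqVneq c.1 i; last first.
  have ic : (i, false).1 != c.1 by rewrite eq_sym.
  apply: (step (weyl (i, false) c)).
  - move=> j jm; rewrite weylE // sw_out //.
      by apply/eqP => /(congr1 val) /= e; lia.
    by apply/eqP => /(congr1 val) /= e; lia.
  - exact: gen_weyl.
  - exact: monomial_weyl.
  - exact: detw.
  - by rewrite aut_mulE hc weylE // sw_snd.
have [ec|ec] : c = (i, false) \/ c = (i, true).
  by case: c {hc cm} ci => j [] /= ->; [right|left].
  apply: (step 1) => //; rewrite ?abel_mx1 ?det1 ?mul1g //; first exact: gen_transv1.
  by rewrite hc ec.
have [mn1|mn1] := ltnP m.+1 n.
  pose j := Ordinal mn1.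
  have ij : (i, false).1 != (j, false).1 by apply/eqP => /(congr1 val) /=; lia.
  apply: (step (weyl (i, false) (j, false) * weyl (i, false) (j, false))).
  - move=> l lm; rewrite aut_mulE !weylE // !sw_out //;
      by apply/eqP => /(congr1 val) /= e; lia.
  - apply: gen_transvM; exact: gen_weyl.
  - by rewrite -mulgA; do 2! apply: monomial_weyl => //.
  - by rewrite det_abel_mxM detw mulr1.
  - by rewrite 2!aut_mulE hc ec !weylE // sw_sw //= eqxx.
suff : \det (abel_mx h) = (-1)%R by rewrite h1.
have -> : abel_mx h = diag_mx (\row_j (if j == i then -1 else 1)%R).
  apply/matrixP => p q; rewrite !mxE.
  have [->|qi] := eqVneq q i.
    rewrite -[free_gen i]/(letter_val (i, false)) hc ec.
    by rewrite val_letter_val big_cons big_nil /= eq_sym addr0; case: eqP.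
  rewrite -[free_gen q]/(letter_val (q, false)) hfix.
    rewrite val_letter_val big_cons big_nil /= eq_sym addr0.
    by case: eqP => // ->; rewrite (negPf qi).
  have := ltn_ord q; rewrite ltnNge; move: qi; rewrite -val_eqE /=; lia.
rewrite det_diag (bigD1 i) //= mxE eqxx big1 ?mulr1 // => j ji.
by rewrite mxE (negPf ji).
Qed.

Lemma SAut_gen f : (2 < n)%N -> is_SAut f -> gen_transv f.
Proof.
move=> n2 /eqP f1; have [s rs] := exists_nielsen_reduced f.
have gs : gen_transv (transv_prod s) by exists s.
have d1 : \det (abel_mx (transv_prod s)) = 1%R.
  rewrite /transv_prod; elim: s {rs gs} => [|p s IH]; first by rewrite big_nil abel_mx1 det1.
  by rewrite big_cons det_abel_mxM IH det_transv // mulr1.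
set g := f * _ in rs.
have g1 : \det (abel_mx g) = 1%R by rewrite det_abel_mxM f1 d1 mulr1.
have gm : monomial g^-1 by move=> b; exact: nielsen_reduced_letter.
have /gen_transvV : gen_transv g^-1.
  by apply: gen_monomial => //; have := det_abel_mxV g; rewrite g1 mul1r.
rewrite invgK => gg; rewrite -(mulgK (transv_prod s) f).
by apply: gen_transvM => //; exact: gen_transvV.
Qed.

Definition stransv a b : SAut n := insubd (1 : SAut n) (transv a b).

Lemma val_stransv a b : (2 < n)%N -> val (stransv a b) = transv a b.
Proof. by move=> n2; rewrite val_insubd transv_is_SAut. Qed.

Lemma SAut_ind_transv (P : SAut n -> Prop) : (2 < n)%N -> P 1 ->
  (forall a b x, P x -> P (stransv a b * x)) -> forall x, P x.
Proof.
move=> n2 P1 PM x; have [s] := SAut_gen n2 (valP x).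
elim: s x => [|p s IH] x.
  by rewrite /transv_prod big_nil => e; rewrite (_ : x = 1) //; apply: val_inj.
rewrite /transv_prod big_cons => e; pose y := (stransv p.1 p.2)^-1 * x.
have -> : x = stransv p.1 p.2 * y by rewrite mulVKg.
apply/PM/IH; apply: (mulgI (transv p.1 p.2)); rewrite -e -val_stransv //.
by rewrite -valM mulVKg.
Qed.

End Generation.

(** * Lifting the Steinberg relations through a central extension *)

HB.lock Definition weyl_word n (G : groupType) (E : letter n -> letter n -> G) a b : G :=
  E (linv b) (linv a) * E (linv a) b * E b a.

Lemma weyl_wordE n (G : groupType) (E : letter n -> letter n -> G) a b :
  weyl_word E a b = E (linv b) (linv a) * E (linv a) b * E b a.
Proof. by rewrite weyl_word.unlock. Qed.

(* The commutator convention matching the composition of functions. *)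
Definition cm (G : groupType) (x y : G) : G := x * y / x / y.

(** Exactly the relations that pass to the lift. The relation [stransv_weyl4] is absent, as in a
    lift it is only known up to a central factor. *)
Record steinberg n (G : groupType) (E : letter n -> letter n -> G) : Prop := {
  st_comm a b c d : a.1 != b.1 -> c.1 != d.1 -> a != c -> a.1 != d.1 ->
    b.1 != c.1 -> commute (E a b) (E c d);
  st_inv a b : a.1 != b.1 -> E a (linv b) = (E a b)^-1;
  st_cm a b c : a.1 != b.1 -> a.1 != c.1 -> b.1 != c.1 ->
    cm (E a b) (E (linv b) c) = E a c;
  st_weyl a b c d : a.1 != b.1 -> c.1 != d.1 ->
    weyl_word E a b * E c d / weyl_word E a b = E (sw a b c) (sw a b d)
}.

Lemma stransv_steinberg n : (2 < n)%N -> steinberg (@stransv n).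
Proof.
move=> n2; have vE (a b : letter n) : val (stransv a b) = transv a b by exact: val_stransv.
have vV (x : SAut n) : val x^-1 = (val x)^-1.
  by apply: (mulgI (val x)); rewrite -valM !mulgV.
split=> *; apply: val_inj.
- by rewrite !valM !vE; apply: transv_commute.
- by rewrite vV !vE transvV.
- by rewrite !(valM, vV) !vE; apply: transv_commutator.
- by rewrite !weyl_wordE !(valM, vV) !vE; apply: weyl_conj.
Qed.

Lemma stransv_weyl4 n (a b : letter n) : (2 < n)%N -> a.1 != b.1 ->
  let w := weyl_word (@stransv n) a b in w * w * (w * w) = 1.
Proof.
move=> n2 ab w; apply: val_inj; have vE (c d : letter n) : val (stransv c d) = transv c d by exact: val_stransv.
by rewrite /w weyl_wordE !valM !vE; apply: weyl4.
Qed.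

Section MultiplicativeImage.
Variables (n : nat) (G H : groupType) (f : {multiplicative G -> H}).
Variable E : letter n -> letter n -> G.

Lemma gmul_morph_cm x y : f (cm x y) = cm (f x) (f y).
Proof. by rewrite /cm !gmulfM !gmul_morphV. Qed.

Lemma gmul_morph_weyl a b : f (weyl_word E a b) = weyl_word (fun a b => f (E a b)) a b.
Proof. by rewrite !weyl_wordE !gmulfM. Qed.

Lemma steinberg_morph : steinberg E -> steinberg (fun a b => f (E a b)).
Proof.
case=> h1 h2 h3 h4; split=> *.
- by rewrite /commute -!gmulfM h1.
- by rewrite h2 // gmul_morphV.
- by rewrite -gmul_morph_cm h3.
- by rewrite -gmul_morph_weyl -gmul_morphV -!gmulfM h4.
Qed.
End MultiplicativeImage.

Section CentralLift.
Variables (H P : groupType) (pi : {multiplicative H -> P}).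
Hypothesis ker_central : forall z, pi z = 1 -> forall x, commute z x.

Lemma lift_eq x y : pi x = pi y -> exists2 z, pi z = 1 & x = z * y.
Proof. by move=> e; exists (x / y); rewrite ?mulgVK // gmulfM gmul_morphV e mulgV. Qed.

(** Central factors cancel against their inverses; this makes commutators canonical lifts. *)
Lemma cm_lift x x' y y' : pi x = pi x' -> pi y = pi y' -> cm x y = cm x' y'.
Proof.
move=> /lift_eq[u /ker_central uC ->] /lift_eq[v /ker_central vC ->].
have hu w : cm (u * x') w = cm x' w.
  transitivity (u * (x' * w / x') / u / w); first by rewrite /cm invgM !mulgA.
  by rewrite uC mulgK.
rewrite hu; transitivity (v * (x' * y' / x' / y') / v); last by rewrite vC mulgK.
by rewrite /cm invgM !mulgA (vC x').
Qed.

Lemma conj_cm (x y z : H) : x * cm y z / x = cm (x * y / x) (x * z / x).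
Proof. by rewrite /cm !invgM !invgK !mulgA !mulgVK. Qed.

Lemma pi_conj x y : commute (pi x) (pi y) -> pi (x * y / x) = pi y.
Proof. by move=> e; rewrite !gmulfM gmul_morphV e mulgK. Qed.

Lemma commute_cm x y z : commute (pi x) (pi y) -> commute (pi x) (pi z) ->
  commute x (cm y z).
Proof.
move=> xy xz; apply: (mulIg x^-1); rewrite mulgK conj_cm.
by apply: cm_lift; exact: pi_conj.
Qed.

Variables (n : nat) (R : letter n -> letter n -> P).
Hypothesis n_gt5 : (5 < n)%N.
Hypothesis stR : steinberg R.
Hypothesis R_lift : forall a b, exists Z, pi Z = R a b.
Implicit Types a b c d m : letter n.

(** Up to a central factor [Y] is a commutator of lifts through a fresh index. Both of these commute
    with [X] modulo the kernel, so conjugation by [X] replaces them by other lifts of the same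
    elements and fixes their commutator. *)
Lemma commute_lift a b c d X Y : pi X = R a b -> pi Y = R c d ->
  a.1 != b.1 -> c.1 != d.1 -> a != c -> a.1 != d.1 -> b.1 != c.1 -> 
  commute X Y.
Proof.
move=> eX eY ab cd ac ad bc.
have [i] := @fresh_ord n [:: a.1; b.1; c.1; d.1] (ltnW n_gt5).
rewrite !inE !negb_or => /and4P[ia ib ic id].
have [S eS] := R_lift c (i, false); have [T eT] := R_lift (linv (i, false)) d.
have e : pi Y = pi (cm S T).
  by rewrite gmul_morph_cm eS eT eY (st_cm stR) //= 1?eq_sym.
have [z /ker_central zC ->] := lift_eq e.
apply: commuteM; first exact/commute_sym/zC.
apply: commute_cm; rewrite eX ?eS ?eT; apply: (st_comm stR) => //=; rewrite 1?eq_sym //.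
by rewrite letter_neq.
Qed.

(** Conjugation by [x] fixes [z] and turns [y] into [p * y]; expanding the commutator of [p * y] and
    [z] gives [q * cm p z]. *)
Lemma cm_cm (x y z p q : H) : p = cm x y -> q = cm y z -> commute x z ->
  commute p q -> commute (cm p z) q -> cm x q = cm p z.
Proof.
move=> ep eq_ xz pq e.
have e1 : x * q / x = q * cm p z.
  rewrite {1}eq_ conj_cm xz mulgK.
  have -> : x * y / x = p * y by rewrite ep /cm mulgVK.
  rewrite {1}/cm invgM; transitivity (p * (y * z / y) / p / z); first by rewrite !mulgA.
  have -> : y * z / y = q * z by rewrite eq_ /cm mulgVK.
  by rewrite /cm !mulgA pq.
by rewrite {1}/cm e1 -e mulgK.
Qed.

Lemma exists_fresh_letter a b : exists c : letter n, (c.1 != a.1) && (c.1 != b.1).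
Proof.
have [i] := @fresh_ord n [:: a.1; b.1] ltac:(by apply: leq_trans n_gt5).
by rewrite !inE negb_or => hi; exists (i, false).
Qed.

Definition fresh_letter a b : letter n := sval (cid (exists_fresh_letter a b)).

Lemma fresh_letterP a b :
  ((fresh_letter a b).1 != a.1) && ((fresh_letter a b).1 != b.1).
Proof. exact: (svalP (cid (exists_fresh_letter a b))). Qed.

Definition lift a b : H := sval (cid (R_lift a b)).
Lemma pi_lift a b : pi (lift a b) = R a b. Proof. exact: (svalP (cid (R_lift a b))). Qed.

(** The choices of the intermediate letter and of the two lifts are immaterial by
    [cm_lift_transv]. *)
Definition lift_transv a c : H :=
  let b := fresh_letter a c in cm (lift a b) (lift (linv b) c).

Lemma pi_cm_lift a b c X Y : pi X = R a b -> pi Y = R (linv b) c ->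
  a.1 != b.1 -> a.1 != c.1 -> b.1 != c.1 -> pi (cm X Y) = R a c.
Proof. by move=> eX eY ab ac bc; rewrite gmul_morph_cm eX eY (st_cm stR). Qed.

(* Independence of the intermediate letter, as in Steinberg's computation of the
   Schur multiplier. *)
Lemma cm_lift_indep_neq a b b' c X Y X' Y' :
  pi X = R a b -> pi Y = R (linv b) c -> pi X' = R a b' -> pi Y' = R (linv b') c ->
  a.1 != b.1 -> a.1 != c.1 -> b.1 != c.1 -> a.1 != b'.1 -> b'.1 != c.1 ->
  b.1 != b'.1 -> cm X Y = cm X' Y'.
Proof.
move=> eX eY eX' eY' ab ac bc ab' b'c bb'.
have [Z eZ] := R_lift (linv b) b'.
have -> : cm X Y = cm X (cm Z Y').
  by apply: cm_lift => //; rewrite eY (pi_cm_lift eZ eY').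
have -> : cm X' Y' = cm (cm X Z) Y'.
  by apply: cm_lift => //; rewrite eX' (pi_cm_lift eX eZ).
have h1 : pi (cm X Z) = R a b' by rewrite (pi_cm_lift eX eZ).
have h2 : pi (cm Z Y') = R (linv b) c by rewrite (pi_cm_lift eZ eY').
apply: cm_cm => //.
- by apply: (commute_lift eX eY') => //; rewrite ?letter_neq.
- by apply: (commute_lift h1 h2) => //; rewrite ?letter_neq // eq_sym.
- apply: (commute_lift (a := a) (b := c) _ h2) => //; rewrite ?letter_neq // 1?eq_sym //.
  by rewrite (pi_cm_lift h1 eY').
Qed.

Lemma cm_lift_transv a b c X Y : pi X = R a b -> pi Y = R (linv b) c ->
  a.1 != b.1 -> a.1 != c.1 -> b.1 != c.1 -> cm X Y = lift_transv a c.
Proof.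
move=> eX eY ab ac bc; set m := fresh_letter a c.
have /andP[ma mc] := fresh_letterP a c; rewrite -/m in ma mc.
(* The letters [b] and [m] may share their index, so the comparison passes through a third
   letter. *)
have [i] := @fresh_ord n [:: a.1; b.1; c.1; m.1] ltac:(by apply: leq_trans n_gt5).
rewrite !inE !negb_or => /and4P[ia ib ic im].
have pi1 := pi_lift a (i, false); have pi2 := pi_lift (linv (i, false)) c.
have pi3 := pi_lift a m; have pi4 := pi_lift (linv m) c.
rewrite (cm_lift_indep_neq eX eY pi1 pi2) //= 1?eq_sym //.
by rewrite (cm_lift_indep_neq pi1 pi2 pi3 pi4) //= 1?eq_sym.
Qed.

Lemma pi_lift_transv a b : a.1 != b.1 -> pi (lift_transv a b) = R a b.
Proof.
move=> ab; have /andP[ma mb] := fresh_letterP a b.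
by apply: (pi_cm_lift (pi_lift _ _) (pi_lift _ _)) => //; rewrite eq_sym.
Qed.

Lemma lift_transv_steinberg : steinberg lift_transv.
Proof.
split.
- by move=> a b c d ab cd *; apply: (commute_lift (pi_lift_transv ab) (pi_lift_transv cd)).
- move=> a b ab; have /andP[ma mb] := fresh_letterP a b; set m := fresh_letter a b in ma mb.
  have am : a.1 != m.1 by rewrite eq_sym.
  have eX := pi_lift a m; have eY := pi_lift (linv m) b.
  have eYV : pi (lift (linv m) b)^-1 = R (linv m) (linv b).
    by rewrite gmul_morphV eY (st_inv stR).
  rewrite -(cm_lift_transv eX eYV) // -(cm_lift_transv eX eY) //.
  (* When [x, y] commutes with y, the commutator of x and y^-1 is the inverse of [x, y]. *)
  have hc : commute (cm (lift a m) (lift (linv m) b)) (lift (linv m) b).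
    apply: (commute_lift (pi_cm_lift eX eY am ab mb) eY) => //; rewrite ?letter_neq //.
    by rewrite eq_sym.
  apply: (mulIg (cm (lift a m) (lift (linv m) b))); rewrite mulVg.
  set x := lift a m in hc *; set y := lift _ b in hc *.
  rewrite {1}/cm invgK -mulgA -hc /cm !mulgA.
  by rewrite (mulgVK y) (mulgVK x) (mulgVK y) mulgV.
- move=> a b c ab ac bc; apply: (cm_lift_transv (b := b)) => //; exact: pi_lift_transv.
move=> a b c d ab cd; set w := weyl_word _ _ _.
have pw : pi w = weyl_word R a b.
  by rewrite /w gmul_morph_weyl !weyl_wordE !pi_lift_transv // eq_sym.
(* From here only the image of [w] matters: conjugation by [w] takes a commutator of lifts to a
   commutator of lifts of the permuted transvections. The intermediate index is chosen among those
   that [sw a b] fixes. *)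
clearbody w.
have [i] := @fresh_ord n [:: a.1; b.1; c.1; d.1] ltac:(by apply: leq_trans n_gt5).
rewrite !inE !negb_or => /and4P[ia ib ic id].
have hw e f X : pi X = R e f -> e.1 != f.1 -> pi (w * X / w) = R (sw a b e) (sw a b f).
  by move=> eX ef; rewrite !gmulfM gmul_morphV pw eX (st_weyl stR).
rewrite -(@cm_lift_transv c (i, false) d _ _ (pi_lift _ _) (pi_lift _ _)) //= 1?eq_sym //.
rewrite conj_cm; apply: (@cm_lift_transv _ (i, false)).
- by rewrite (hw c (i, false)) ?pi_lift 1?eq_sym // [sw a b (i, false)]sw_out.
- rewrite (hw (linv (i, false)) d) ?pi_lift // [sw a b (linv _)]sw_out //.
- by rewrite -(@sw_out _ a b (i, false)) // sw_neq1 // eq_sym.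
- by rewrite sw_neq1.
- by rewrite -(@sw_out _ a b (i, false)) // sw_neq1.
Qed.

End CentralLift.

(** * Weyl elements *)

(** The letters of a pair are replaced one at a time, with two spare indices as stopovers so that
    the indices stay distinct throughout. *)
Lemma sw_transitive n (P : letter n -> letter n -> Prop) a b : (5 < n)%N ->
  (forall a b c d, a.1 != b.1 -> c.1 != d.1 -> P c d -> P (sw a b c) (sw a b d)) ->
  a.1 != b.1 -> P a b -> forall c d, c.1 != d.1 -> P c d.
Proof.
move=> n5 hP ab pab c d cd.
have [i] := @fresh_ord n [:: a.1; b.1; c.1; d.1] ltac:(by apply: leq_trans n5).
rewrite !inE !negb_or => /and4P[ia ib ic id].
have [j] := @fresh_ord n [:: a.1; b.1; c.1; d.1; i] ltac:(by apply: leq_trans n5).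
rewrite !inE !negb_or => /and5P[ja jb jc jd ji].
have movel x y z : x.1 != y.1 -> x.1 != z.1 -> y.1 != z.1 -> P x y -> P z y.
  move=> xy xz yz pxy; have zx : z.1 != x.1 by rewrite eq_sym.
  by have := hP z x x y zx xy pxy; rewrite sw_snd // sw_out // eq_sym.
have mover x y z : x.1 != y.1 -> x.1 != z.1 -> y.1 != z.1 -> P x y -> P x z.
  move=> xy xz yz pxy; have zy : z.1 != y.1 by rewrite eq_sym.
  by have := hP z y x y zy xy pxy; rewrite sw_snd // sw_out.
apply: (mover _ (j, false)) => //=; first by rewrite eq_sym.
apply: (movel (i, false)) => //=; first by rewrite eq_sym.
apply: (mover _ b) => //=; rewrite 1?eq_sym //.
by apply: (movel a) => //=; rewrite 1?eq_sym.
Qed.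

Lemma intertwine_sq (G : groupType) (x y z t : G) :
  x * y = z * x -> x * z = t * x -> x * x * y = t * (x * x).
Proof. by move=> e1 e2; rewrite -mulgA e1 mulgA e2 mulgA. Qed.

Lemma intertwine_sqr (G : groupType) (x y z : G) :
  x * y = z * x -> x * (y * y) = z * z * x.
Proof. by move=> e; rewrite mulgA e -mulgA e mulgA. Qed.

Lemma intertwine_sq_l (G : groupType) (x y z : G) :
  x * y = y * z -> x * x * y = y * (z * z).
Proof. by move=> e; rewrite -mulgA e mulgA e mulgA. Qed.

HB.lock Definition flip_word n (G : groupType) (E : letter n -> letter n -> G) a b : G :=
  weyl_word E a b * weyl_word E a b.

Lemma flip_wordE n (G : groupType) (E : letter n -> letter n -> G) a b :
  flip_word E a b = weyl_word E a b * weyl_word E a b.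
Proof. by rewrite flip_word.unlock. Qed.

Section Weyl.
Variables (n : nat) (G : groupType) (E : letter n -> letter n -> G).
Hypothesis stE : steinberg E.
Implicit Types a b c d : letter n.

Notation W := (weyl_word E).

Lemma weyl_E a b c d : a.1 != b.1 -> c.1 != d.1 ->
  W a b * E c d = E (sw a b c) (sw a b d) * W a b.
Proof. by move=> ab cd; rewrite -(st_weyl stE ab cd) mulgVK. Qed.

Lemma weyl_W a b c d : a.1 != b.1 -> c.1 != d.1 ->
  W a b * W c d = W (sw a b c) (sw a b d) * W a b.
Proof.
move=> ab cd; rewrite [W c d]weyl_wordE [W (sw _ _ _) _]weyl_wordE !mulgA.
have dc : d.1 != c.1 by rewrite eq_sym.
by rewrite weyl_E // -[E _ _ * W a b * _]mulgA weyl_E // mulgA -mulgA weyl_E // !mulgA !swV.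
Qed.

Lemma weyl_rot a b : a.1 != b.1 -> W a b = W (linv b) a.
Proof.
move=> ab; apply: (mulIg (W a b)); rewrite {1}weyl_W //.
by rewrite sw_fst sw_snd.
Qed.

Lemma weyl_linvl a b : a.1 != b.1 -> W (linv a) b = (W a b)^-1.
Proof.
move=> ab; have ba : b.1 != a.1 by rewrite eq_sym.
rewrite [W a b]weyl_rot // [W (linv a) b]weyl_rot // !weyl_wordE !linvK !invgM.
rewrite -!(st_inv stE) //= ?linvK ?mulgA //.
Qed.

Lemma weyl_swap a b : a.1 != b.1 -> W b a = (W a b)^-1.
Proof. by move=> ab; rewrite [LHS]weyl_rot 1?eq_sym // weyl_linvl. Qed.

Lemma weyl_linvr a b : a.1 != b.1 -> W a (linv b) = (W a b)^-1.
Proof. by move=> ab; rewrite [LHS]weyl_rot // linvK weyl_swap. Qed.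

Notation D := (flip_word E).

Lemma flip_E a b c d : a.1 != b.1 -> c.1 != d.1 ->
  D a b * E c d = E (sw a b (sw a b c)) (sw a b (sw a b d)) * D a b.
Proof.
by move=> ab cd; rewrite flip_wordE; apply: (intertwine_sq (weyl_E ab cd)); rewrite weyl_E // sw_neq1.
Qed.

Lemma flip_W a b c d : a.1 != b.1 -> c.1 != d.1 ->
  D a b * W c d = W (sw a b (sw a b c)) (sw a b (sw a b d)) * D a b.
Proof.
move=> ab cd; rewrite flip_wordE; apply: (intertwine_sq (weyl_W ab cd)); apply: weyl_W => //.
by rewrite sw_neq1.
Qed.

Lemma weyl_D a b c d : a.1 != b.1 -> c.1 != d.1 ->
  W a b * D c d = D (sw a b c) (sw a b d) * W a b.
Proof.
move=> ab cd; rewrite !flip_wordE; apply: intertwine_sqr.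
apply: weyl_W => //.
Qed.

Lemma flip_linvl a b : a.1 != b.1 -> D (linv a) b = (D a b)^-1.
Proof. by move=> ab; rewrite !flip_wordE weyl_linvl // [RHS]invgM. Qed.

Lemma flip_linvr a b : a.1 != b.1 -> D a (linv b) = (D a b)^-1.
Proof. by move=> ab; rewrite !flip_wordE weyl_linvr // [RHS]invgM. Qed.

Lemma flip_swap a b : a.1 != b.1 -> D b a = (D a b)^-1.
Proof. by move=> ab; rewrite !flip_wordE weyl_swap // [RHS]invgM. Qed.

Lemma weyl_E_comm a b c d : a.1 != b.1 -> c.1 != d.1 -> a.1 != c.1 ->
  a.1 != d.1 -> b.1 != c.1 -> b.1 != d.1 -> commute (W a b) (E c d).
Proof. by move=> ab cd ac ad bc bd; rewrite /commute weyl_E // !sw_out // eq_sym. Qed.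

Lemma flip_comm a b c d : a.1 != b.1 -> c.1 != d.1 -> a.1 != c.1 ->
  a.1 != d.1 -> b.1 != c.1 -> b.1 != d.1 -> commute (D a b) (D c d).
Proof.
move=> ab cd ac ad bc bd.
have h : commute (D c d) (W a b).
  by apply: commute_sym; rewrite /commute weyl_D // !sw_out // eq_sym.
by apply: commute_sym; rewrite [D a b]flip_wordE; apply: commuteM.
Qed.

(** The flip of b and c inverts exactly one of the letters a, b, so it conjugates [W a b] to its
    inverse. This reads as anticommutation when flips square to -1 and as commutation when they
    square to 1. *)
Lemma flip_anticomm a b c : a.1 != b.1 -> a.1 != c.1 -> b.1 != c.1 ->
  D a b * D b c = D b c * (D a b)^-1.
Proof.
move=> ab ac bc; have ba : b.1 != a.1 by rewrite eq_sym.
have bW : D b c * W a b = W a (linv b) * D b c.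
  by rewrite flip_W // !sw_sw // eqxx (negPf ab) (negPf ac).
rewrite weyl_linvr // in bW.
have e : W a b * D b c = D b c * (W a b)^-1.
  by apply: (mulIg (W a b)); rewrite mulgVK -mulgA bW mulVKg.
by rewrite [D a b]flip_wordE (intertwine_sq_l e) [in RHS]invgM.
Qed.

Lemma flip_mul a b c : a.1 != b.1 -> a.1 != c.1 -> b.1 != c.1 ->
  D a c = D b c * (D a b)^-1.
Proof.
move=> ab ac bc; have ba : b.1 != a.1 by rewrite eq_sym.
apply: (mulIg (W a b)).
have -> : D a c * W a b = W a b * D b c.
  by rewrite weyl_D // sw_snd // sw_out // 1?eq_sym.
have bW : D b c * W a b = W a (linv b) * D b c.
  by rewrite flip_W // !sw_sw // eqxx (negPf ab) (negPf ac).
rewrite weyl_linvr // in bW.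
have e : W a b * D b c = D b c * (W a b)^-1.
  by apply: (mulIg (W a b)); rewrite mulgVK -mulgA bW mulVKg.
rewrite e -[RHS]mulgA; congr (D b c * _).
by rewrite [D a b]flip_wordE; move: (W a b) => w; rewrite invgM -mulgA mulVg mulg1.
Qed.

End Weyl.

Local Close Scope group_scope.

(** * Linear algebra *)

Lemma exp2_ge4 m : (4 <= m -> 4 * m <= 2 ^ m)%N.
Proof.
elim: m => // m IH; rewrite leq_eqVlt => /orP[/eqP <- //|m4].
have := IH m4; rewrite expnS; move: (2 ^ m)%N => e; lia.
Qed.

Section GLAction.
Variables (K : fieldType) (V : vectType K).
Implicit Types (f g : GL V) (v : V).

Lemma GL1E v : (1 : GL V)%g v = v. Proof. exact: id_lfunE. Qed.
Lemma GLME f g v : (f * g)%g v = f (g v). Proof. exact: comp_lfunE. Qed.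
Lemma GLK f v : f^-1%g (f v) = v. Proof. by rewrite -GLME mulVg GL1E. Qed.
Lemma GLVK f v : f (f^-1%g v) = v. Proof. by rewrite -GLME mulgV GL1E. Qed.
Lemma GL_inj f : injective f. Proof. exact: can_inj (GLK f). Qed.
Lemma GL_eqP f g : (forall v, f v = g v) -> f = g.
Proof. by move=> h; apply: val_inj; apply/lfunP. Qed.

Lemma commuteE f g v : commute f g -> f (g v) = g (f v).
Proof. by rewrite -!GLME => ->. Qed.

Lemma GL_ker f : to_PGL f = 1%g -> exists c : K, forall v, f v = c *: v.
Proof.
move/to_PGL_eq/asboolP=> [c _ e]; exists c => v.
by rewrite -[GL_lfun f]/(val f) e scale_lfunE id_lfunE.
Qed.

Lemma GL_ker_central f : to_PGL f = 1%g -> forall g, commute f g.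
Proof.
move/GL_ker => [c e] g; apply: GL_eqP => v.
by rewrite !GLME !e linearZ.
Qed.

Lemma GLD f v w : f (v + w) = f v + f w. Proof. exact: linearD. Qed.
Lemma GLN f v : f (- v) = - f v. Proof. exact: linearN. Qed.
Lemma GLZ f (s : K) v : f (s *: v) = s *: f v. Proof. exact: linearZ. Qed.

End GLAction.

Section InvariantSubspaces.
Variables (K : fieldType) (V : vectType K).
Implicit Types (f g : 'End(V)) (v : V) (U : {vspace V}).

Definition stable U f := forall v, v \in U -> f v \in U.

Lemma memv_eigen (a : K) f v : (v \in lker (f - a *: \1%VF)) = (f v == a *: v).
Proof. by rewrite memv_ker add_lfunE opp_lfunE scale_lfunE id_lfunE subr_eq0. Qed.

Definition eigenpart U f (a : K) := (U :&: lker (f - a *: \1%VF))%VS.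

Lemma memv_eigenpart U f a v : (v \in eigenpart U f a) = (v \in U) && (f v == a *: v).
Proof. by rewrite memv_cap memv_eigen. Qed.

Lemma dim_eigenparts U f a b : a != b ->
  (\dim (eigenpart U f a) + \dim (eigenpart U f b) <= \dim U)%N.
Proof.
move=> ab; rewrite -dimv_disjoint_sum ?dimvS //.
  by rewrite subv_add !capvSl.
apply/eqP; rewrite -subv0; apply/subvP => v; rewrite memv_cap !memv_eigenpart.
case/andP=> /andP[_ /eqP e] /andP[_ /eqP]; rewrite e => /eqP.
by rewrite -subr_eq0 -scalerBl scaler_eq0 subr_eq0 (negPf ab) memv0.
Qed.

Lemma dim_leq_inj U U' f : (forall v, f v = 0 -> v = 0) ->
  (forall v, v \in U -> f v \in U') -> (\dim U <= \dim U')%N.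
Proof.
move=> f0 fU; rewrite -(@limg_dim_eq _ _ _ f U).
  by apply: dimvS; apply/subvP => w /memv_imgP[v vU ->]; exact: fU.
apply/eqP; rewrite -subv0; apply/subvP => v; rewrite memv_cap memv_ker memv0.
by case/andP=> _ /eqP/f0->.
Qed.

Lemma vspace_neq0 U : (0 < \dim U)%N -> exists2 v, v \in U & v != 0.
Proof.
by rewrite lt0n dimv_eq0 -vpick0 => h; exists (vpick U) => //; exact: memv_pick.
Qed.

Lemma dim_gt0 U v : v \in U -> v != 0 -> (0 < \dim U)%N.
Proof.
move=> vU v0; rewrite lt0n dimv_eq0; apply: contra v0 => /eqP e.
by rewrite e memv0 in vU.
Qed.

End InvariantSubspaces.

Section OddCharacteristic.
Variables (K : fieldType) (V : vectType K).
Hypothesis char2 : (2 : K) != 0.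

Lemma neq_opp (a : K) : a != 0 -> a != - a.
Proof.
move=> a0; rewrite -subr_eq0 opprK -mulr2n -mulr_natl mulf_eq0 negb_or.
by rewrite a0 char2.
Qed.

Lemma scaleN_eq0 (v : V) : v = - v -> v = 0.
Proof.
move/eqP; rewrite -addr_eq0 -mulr2n -scaler_nat scaler_eq0 (negPf char2) /=.
by move/eqP.
Qed.

End OddCharacteristic.

Section Eigenvectors.
Variables (K : closedFieldType) (V : vectType K).
Implicit Types (U : {vspace V}).

Lemma exists_eigenvector U (f : 'End(V)) : (0 < \dim U)%N -> stable U f ->
  exists a, exists2 v, v \in U & v != 0 /\ f v = a *: v.
Proof.
move=> U0 fU; set d := \dim U in U0; pose b := vbasis U.
have bU (i : 'I_d) : b`_i \in U by apply: vbasis_mem; rewrite mem_nth ?size_tuple.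
pose M : 'M[K]_d := \matrix_(i, j) coord b j (f b`_i).
have [|a] := closed_rootP (char_poly M) _; first by rewrite size_char_poly; lia.
rewrite -eigenvalue_root_char => /eigenvalueP[x xM x0].
have fb (i : 'I_d) : f b`_i = \sum_j M i j *: b`_j.
  rewrite {1}(coord_vbasis (fU _ (bU i))).
  by apply: eq_bigr => j _; rewrite mxE.
exists a, (\sum_i x 0 i *: b`_i); first by apply: rpred_sum => i _; rewrite rpredZ.
split.
  apply: contra_neq x0 => e; apply/rowP => i; rewrite mxE.
  have /freeP h := basis_free (vbasisP U); exact: (h (fun i => x 0 i) e i).
rewrite linear_sum scaler_sumr.
transitivity (\sum_j (x *m M) 0 j *: b`_j).
  under eq_bigr do rewrite linearZ /= fb scaler_sumr.
  rewrite exchange_big /=; apply: eq_bigr => j _.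
  by rewrite mxE scaler_suml; apply: eq_bigr => i _; rewrite scalerA.
by rewrite xM; apply: eq_bigr => j _; rewrite mxE scalerA.
Qed.

Hypothesis char2 : (2 : K) != 0.

(* Each pair [A i], [B i] doubles the dimension: [B i] exchanges two eigenspaces of
   [A i] and commutes with all the other pairs. *)
Lemma flip_dim (m : nat) (A B : nat -> GL V) U : (0 < \dim U)%N ->
  (forall i, (i < m)%N -> stable U (A i) /\ stable U (B i)) ->
  (forall i j v, (i < m)%N -> (j < m)%N -> v \in U -> A i (A j v) = A j (A i v)) ->
  (forall i j v, (i < m)%N -> (j < m)%N -> i != j -> v \in U ->
     A i (B j v) = B j (A i v)) ->
  (forall i v, (i < m)%N -> v \in U -> A i (B i v) = - B i (A i v)) ->
  (2 ^ m <= \dim U)%N.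
Proof.
elim: m U => [|m IH] U U0 st AA AB flip; first by [].
have [stA stB] := st m (ltnSn m).
have [a [v vU [v0 ev]]] := exists_eigenvector U0 stA.
have a0 : a != 0.
  apply: contra_neq v0 => e; apply: (@GL_inj _ _ (A m)).
  by rewrite ev e scale0r linear0.
have half c : c != 0 -> (forall w, w \in eigenpart U (A m) c ->
     B m w \in eigenpart U (A m) (- c)).
  move=> c0 w; rewrite !memv_eigenpart => /andP[wU /eqP e].
  by rewrite stB //= flip // e linearZ scaleNr.
have B0 w : B m w = 0 -> w = 0.
  by move=> e; apply: (@GL_inj _ _ (B m)); rewrite e linear0.
have vE : v \in eigenpart U (A m) a by rewrite memv_eigenpart vU ev eqxx.
have ind c : (0 < \dim (eigenpart U (A m) c))%N -> (2 ^ m <= \dim (eigenpart U (A m) c))%N.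
  move=> E0; have sub w : w \in eigenpart U (A m) c -> w \in U.
    by rewrite memv_eigenpart => /andP[].
  apply: IH => //.
  - move=> i im; have [sA sB] := st i (ltnW im).
    split=> w; rewrite !memv_eigenpart => /andP[wU /eqP e].
      by rewrite sA //= AA ?ltnS ?(ltnW im) // e linearZ.
    by rewrite sB //= AB ?ltnS ?(ltnW im) ?e ?linearZ // gtn_eqF.
  - by move=> i j w im jm /sub; apply: AA; rewrite ltnW.
  - by move=> i j w im jm ij /sub; apply: AB => //; rewrite ltnW.
  - by move=> i w im /sub; apply: flip; rewrite ltnW.
have h1 := ind _ (dim_gt0 vE v0).
have h2 : (2 ^ m <= \dim (eigenpart U (A m) (- a)))%N.
  apply: ind; apply: (dim_gt0 (half _ a0 _ vE)).
  by apply: contra_neq v0; exact: B0.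
apply: leq_trans (dim_eigenparts U (A m) (neq_opp char2 a0)).
by rewrite expnS mul2n -addnn leq_add.
Qed.

End Eigenvectors.

Section Weights.
Variables (K : fieldType) (V : vectType K).

(** For fixed [i0], each [j] other than [i0] has an operator that separates the two. The product of
    the factors op - chi j kills every [us j] except [us i0], which it multiplies by a nonzero
    scalar. *)
Lemma weights_independent (I : finType) (T : Type) (op : T -> 'End(V))
    (chi : I -> T -> K) (us : I -> V) :
  (forall i t, op t (us i) = chi i t *: us i) ->
  (forall i j, i != j -> exists t, chi i t != chi j t) ->
  \sum_i us i = 0 -> forall i, us i = 0.
Proof.
move=> eig sep sum0 i0.
have [t ht] : exists t : I -> option T, forall i, i != i0 ->
    exists2 s, t i = Some s & chi i s != chi i0 s.
  have /choice[t ht] : forall i, exists o : option T, i != i0 ->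
      exists2 s, o = Some s & chi i s != chi i0 s.
    move=> i; have [->|ii] := eqVneq i i0; first by exists None.
    by have [s hs] := sep _ _ ii; exists (Some s) => _; exists s.
  by exists t.
pose q j : 'End(V) := if t j is Some s then op s - chi j s *: \1%VF else \1%VF.
pose c i j := if t j is Some s then chi i s - chi j s else 1.
have qus j i : q j (us i) = c i j *: us i.
  rewrite /q /c; case: (t j) => [s|]; last by rewrite id_lfunE scale1r.
  by rewrite add_lfunE opp_lfunE scale_lfunE id_lfunE eig scalerBl.
pose js := [seq j <- enum I | j != i0].
pose Q v := foldr (fun j v => q j v) v js.
pose C i := \prod_(j <- js) c i j.
have QE i : Q (us i) = C i *: us i.
  rewrite /Q /C; elim: (js) => [|j s IH] /=; first by rewrite big_nil scale1r.
  by rewrite IH linearZ /= qus scalerA big_cons mulrC.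
have Qsum (r : seq I) : Q (\sum_(i <- r) us i) = \sum_(i <- r) Q (us i).
  rewrite /Q; elim: (js) => [|j s IH] //=; by rewrite IH linear_sum.
have Q0 : Q 0 = 0 by rewrite /Q; elim: (js) => //= j s ->; rewrite linear0.
have := Qsum (index_enum I); rewrite sum0 Q0 (bigD1 i0) //= big1 => [|i ii0].
  rewrite addr0 QE => /esym/eqP; rewrite scaler_eq0 => /orP[|/eqP //].
  rewrite prodf_seq_eq0 => /hasP[j]; rewrite mem_filter => /andP[ji _] /=.
  by have [s es hs] := ht j ji; rewrite /c es subr_eq0 eq_sym (negPf hs).
rewrite QE; apply/eqP; rewrite scaler_eq0; apply/orP; left.
rewrite prodf_seq_eq0; apply/hasP; exists i; first by rewrite mem_filter ii0 mem_enum.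
by have [s es _] := ht i ii0; rewrite /c es subrr /=.
Qed.

(** Each involution splits a vector into halves that it fixes or negates. In the induction [p] lists
    the involutions already diagonalised and [r] those still to come. *)
Lemma weights_span (op : seq 'End(V)) (U W : {vspace V}) :
  (2 : K) != 0 ->
  (forall s v, s \in op -> v \in U -> s v \in U /\ s (s v) = v) ->
  (forall s t v, s \in op -> t \in op -> s (t v) = t (s v)) ->
  (forall v, v \in U -> (forall s, s \in op -> s v = v \/ s v = - v) -> v \in W) ->
  (U <= W)%VS.
Proof.
move=> char2 inv comm h; apply/subvP.
suff main (r p : seq 'End(V)) : (forall s, (s \in op) = (s \in r ++ p)) -> forall v, v \in U ->
    (forall s, s \in p -> s v = v \/ s v = - v) -> v \in W.
  move=> v vU; by apply: (main op [::]) => //; move=> s; rewrite cats0.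
elim: r p => [|t r IH] p sub v vU hp.
  by apply: h => // s; rewrite sub; exact: hp.
have top : t \in op by rewrite sub inE eqxx.
have [tU tt] := inv t v top vU.
have -> : v = 2^-1 *: (v + t v) + 2^-1 *: (v - t v).
  rewrite -scalerDr addrACA subrr addr0 -mulr2n -scaler_nat scalerA.
  by rewrite mulVf // scale1r.
have step w : w \in U -> t w = w \/ t w = - w ->
    (forall s, s \in p -> s w = w \/ s w = - w) -> w \in W.
  move=> wU tw hw; apply: (IH (t :: p)) => //.
  - by move=> s; rewrite sub !mem_cat !inE orbCA orbA.
  - by move=> s; rewrite inE => /orP[/eqP ->|/hw].
have hs s : s \in p -> s v = v /\ s (t v) = t v \/ s v = - v /\ s (t v) = - t v.
  move=> sp; have sop : s \in op by rewrite sub mem_cat sp orbT.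
  by rewrite comm //; case: (hp s sp) => ->; [left|right]; rewrite ?linearN.
apply: memvD; apply: rpredZ; apply: step.
- by rewrite memvD.
- by left; rewrite linearD /= tt addrC.
- by move=> s /hs[[e1 e2]|[e1 e2]]; rewrite linearD /= e1 e2; [left|right]; rewrite ?opprD.
- by rewrite memvB.
- by right; rewrite linearB /= tt opprB.
- by move=> s /hs[[e1 e2]|[e1 e2]]; rewrite linearB /= e1 e2; [left|right]; rewrite ?opprD.
Qed.

End Weights.

(** * Squares of flips *)

(** The generator of index [k]; out of range the index defaults to 0. *)
HB.lock Definition std_letter n (n_gt7 : (7 < n)%N) (k : nat) : letter n :=
  (insubd (Ordinal (leq_ltn_trans (leq0n 7) n_gt7)) k, false).

Section StandardLetters.
Variables (n : nat) (n_gt7 : (7 < n)%N).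

Notation x := (std_letter n_gt7).

Lemma std_letterE k : (k < n)%N -> val (x k).1 = k.
Proof. by move=> kn; rewrite std_letter.unlock val_insubd kn. Qed.

Lemma std_letter_neq j k : (j < n)%N -> (k < n)%N -> j != k -> (x j).1 != (x k).1.
Proof. by move=> jn kn; rewrite -val_eqE /= !std_letterE. Qed.

End StandardLetters.

Section FlipSquare.
Variables (n : nat) (K : closedFieldType) (V : vectType K).
Variable E : letter n -> letter n -> GL V.
Hypothesis n_gt7 : (7 < n)%N.
Hypothesis char2 : (2 : K) != 0.
Hypothesis stE : steinberg E.
Hypothesis dimV : (\dim {:V} < 2 * n - 4)%N.
Hypothesis flip_scalar : forall a b, a.1 != b.1 ->
  exists c : K, forall v, flip_word E a b (flip_word E a b v) = c *: v.
Implicit Types (a b c d : letter n) (v : V).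

Notation W := (weyl_word E).
Notation D := (flip_word E).
Notation x := (std_letter n_gt7).

Let n_gt5 : (5 < n)%N. Proof. exact: leq_trans n_gt7. Qed.

Lemma std_neq j k : (j < 8)%N -> (k < 8)%N -> j != k -> (x j).1 != (x k).1.
Proof. by move=> j8 k8; apply: std_letter_neq; apply: leq_trans n_gt7. Qed.

(** By conjugacy all transvections are the same scalar, and each of them is a commutator of two
    others. *)
Lemma steinberg_scalar p : (forall v, E (x 0) (x 1) v = p *: v) ->
  forall a b, a.1 != b.1 -> E a b = 1%g.
Proof.
move=> e; have all_p : forall a b, a.1 != b.1 -> forall v, E a b v = p *: v.
  apply: (@sw_transitive _ (fun a b => forall v, E a b v = p *: v) (x 0) (x 1)) => //.
    move=> a b c d ab cd h v; have := weyl_E stE ab cd.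
    move/(congr1 (fun f : GL V => f ((W a b)^-1%g v))).
    by rewrite !GLME h GLVK linearZ /= GLVK => <-.
  exact: std_neq.
move=> a b ab; have [i] := @fresh_ord n [:: a.1; b.1] ltac:(by apply: leq_trans n_gt7).
rewrite !inE negb_or => /andP[ia ib].
rewrite -(@st_cm _ _ _ stE a (i, false) b) // 1?eq_sym //.
rewrite /cm; set f := E a _; set g := E _ _.
have fg : (f * g = g * f)%g.
  by apply: GL_eqP => v; rewrite !GLME /f /g !all_p //= 1?eq_sym.
by rewrite fg mulgK mulgV.
Qed.

(** Conjugacy makes the scalar the same for all pairs; it equals its own inverse because [D b a] is
    the inverse of [D a b]. *)
Lemma flip_square_uniform : exists2 c : K, c = 1 \/ c = -1 /\ (0 < \dim {:V})%N &
  forall a b, a.1 != b.1 -> forall v, D a b (D a b v) = c *: v.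
Proof.
have [d0|d0] := posnP (\dim {:V}).
  have V0 (v : V) : v = 0.
    by apply/eqP; rewrite -memv0; move/eqP: d0; rewrite dimv_eq0 => /eqP <-; exact: memvf.
  by exists 1; [left|move=> a b ab v; rewrite [RHS]V0 [LHS]V0].
have [v0 _ v0n] := vspace_neq0 d0.
have [c hc] := flip_scalar (std_neq (j := 0) (k := 1) isT isT isT).
have all_c : forall a b, a.1 != b.1 -> forall v, D a b (D a b v) = c *: v.
  apply: (@sw_transitive _ (fun a b => forall v, D a b (D a b v) = c *: v) (x 0) (x 1)) => //.
    move=> a b p q ab pq h v.
    have e w : D (sw a b p) (sw a b q) (W a b w) = W a b (D p q w).
      by rewrite -!GLME (weyl_D stE).
    by rewrite -{1}(GLVK (W a b) v) !e h linearZ /= GLVK.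
  exact: std_neq.
exists c => //; pose a := x 0; pose b := x 1.
have ab : a.1 != b.1 by exact: std_neq.
have e : v0 = (c * c) *: v0.
  have := all_c b a ltac:(by rewrite eq_sym) (D a b (D a b v0)).
  by rewrite (flip_swap stE ab) !GLK all_c // scalerA.
have : (c * c - 1) *: v0 = 0 by rewrite scalerBl -e scale1r subrr.
move/eqP; rewrite scaler_eq0 (negPf v0n) orbF subr_eq0 => /eqP cc.
have /eqP : (c - 1) * (c + 1) = 0 by rewrite -subr_sqr expr2 cc expr1n subrr.
by rewrite mulf_eq0 subr_eq0 addr_eq0 => /orP[/eqP->|/eqP->]; [left|right].
Qed.

(** The commutator of p + q A and p - q B is -2 q^2 A B when A and B anticommute, while A B v is
    nonzero. *)
Lemma pencil_commute (f g A B : GL V) (p q : K) v :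
  (forall u, f u = p *: u + q *: A u) -> (forall u, g u = p *: u - q *: B u) ->
  f (g v) = g (f v) -> B (A v) = - A (B v) -> v != 0 -> q = 0.
Proof.
move=> fE gE; rewrite !fE !gE !(linearB, linearD, linearZ) /= => comm anti v0.
rewrite anti !(scalerBr, scalerDr, scalerN, scalerA, opprK, opprD) in comm.
have : (q * q) *: A (B v) = - ((q * q) *: A (B v)).
  move: comm; set t := _ *: A (B v); set a := _ *: v.
  rewrite [q * p]mulrC; set b := _ *: A v; set c := _ *: B v => comm.
  apply: (addrI (a - c + b)); rewrite -[RHS]addrA comm !addrA.
  by rewrite [a - c + b]addrAC.
move=> /(scaleN_eq0 char2)/eqP; rewrite scaler_eq0 mulf_eq0 orbb => /orP[/eqP //|/eqP e].
by case/eqP: v0; apply: (@GL_inj _ _ B); apply: (@GL_inj _ _ A); rewrite e !linear0.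
Qed.

Section Spin.
Hypothesis dimV0 : (0 < \dim {:V})%N.
Hypothesis spin : forall a b, a.1 != b.1 -> forall v, D a b (D a b v) = - v.

Lemma spin_flipV a b v : a.1 != b.1 -> (D a b)^-1%g v = - D a b v.
Proof. by move=> ab; apply: (@GL_inj _ _ (D a b)); rewrite GLVK linearN /= spin ?opprK. Qed.

Lemma spin_anticomm a b c v : a.1 != b.1 -> a.1 != c.1 -> b.1 != c.1 ->
  D a b (D b c v) = - D b c (D a b v).
Proof.
move=> ab ac bc; have := congr1 (fun f : GL V => f v) (flip_anticomm stE ab ac bc).
by rewrite !GLME => ->; rewrite spin_flipV // linearN.
Qed.

Lemma spin_comm a b c d v : a.1 != b.1 -> c.1 != d.1 -> a.1 != c.1 ->
  a.1 != d.1 -> b.1 != c.1 -> b.1 != d.1 -> D a b (D c d v) = D c d (D a b v).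
Proof. by move=> *; apply: commuteE; apply: flip_comm. Qed.

(* The flips of disjoint pairs, with flips joining each pair to the last index,
   generate an extraspecial group, so that [2 ^ ((n - 1) / 2) <= dim V]. *)
Lemma spin_n8 : n = 8%N.
Proof.
apply/eqP; rewrite eqn_leq n_gt7 andbT leqNgt; apply/negP => n9.
set m := ((n - 1)./2)%N.
have hm i : (i < m)%N -> ((2 * i).+1 < n.-1)%N by rewrite /m; lia.
pose A i := D (x (2 * i)) (x (2 * i).+1); pose B i := D (x (2 * i).+1) (x n.-1).
have neq := @std_letter_neq n n_gt7.
have : (2 ^ m <= \dim {:V})%N.
  apply: (flip_dim char2 (A := A) (B := B) dimV0).
  - by move=> i im; split=> v _; exact: memvf.
  - move=> i j v im jm _; have [->//|ij] := eqVneq i j.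
    by have := hm i im; have := hm j jm; rewrite /A => *; apply: spin_comm; apply: neq; lia.
  - move=> i j v im jm ij _.
    by have := hm i im; have := hm j jm; rewrite /A /B => *; apply: spin_comm; apply: neq; lia.
  - move=> i v im _; have := hm i im; rewrite /A /B => *; apply: spin_anticomm; apply: neq; lia.
have : (4 * m <= 2 ^ m)%N by apply: exp2_ge4; rewrite /m; lia.
move: dimV; move: (2 ^ m)%N (\dim _) => e d; rewrite /m; lia.
Qed.

(* When [n = 8] the dimension bound leaves room for a spin module. There [E_01]
   commutes with [C] and has to be scalar on each of its two eigenspaces, so that
   [E_01 = p + q C]; since [E_01] and [E_21] commute while [C] and its conjugate
   anticommute, [q = 0]. *)
Let C := (D (x 2) (x 3) * D (x 4) (x 5) * D (x 6) (x 7))%g.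

Lemma std_comm j k p q v : all (gtn 8) [:: j; k; p; q] && uniq [:: j; k; p; q] ->
  D (x j) (x k) (D (x p) (x q) v) = D (x p) (x q) (D (x j) (x k) v).
Proof.
rewrite /= !inE !negb_or !andbT -!andbA => /and5P[j8 k8 p8 q8].
by case/and5P=> jk jp jq kp /andP[kq pq]; apply: spin_comm; apply: std_neq.
Qed.

Lemma std_anticomm j k p v : all (gtn 8) [:: j; k; p] && uniq [:: j; k; p] ->
  D (x j) (x k) (D (x k) (x p) v) = - D (x k) (x p) (D (x j) (x k) v).
Proof.
rewrite /= !inE !negb_or !andbT -!andbA => /and5P[j8 k8 p8 jk /andP[jp kp]].
by apply: spin_anticomm; apply: std_neq.
Qed.

Lemma std_anticomm' j k p v : all (gtn 8) [:: j; k; p] && uniq [:: j; k; p] ->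
  D (x k) (x p) (D (x j) (x k) v) = - D (x j) (x k) (D (x k) (x p) v).
Proof. by move=> h; rewrite std_anticomm ?opprK. Qed.

Lemma spin_C v : C (C v) = - v.
Proof.
rewrite /C !GLME (std_comm (j := 6) (k := 7) (p := 2)) // (std_comm (j := 6) (k := 7) (p := 4)) //.
by rewrite (std_comm (j := 4) (k := 5) (p := 2)) // !spin ?opprK //; exact: std_neq.
Qed.

Lemma spin_comm_C j k v : (j, k) \in [:: (2, 3); (4, 5); (3, 6); (5, 6)] ->
  D (x j) (x k) (C v) = C (D (x j) (x k) v).
Proof.
rewrite /C !GLME !inE !xpair_eqE => /or4P[] /andP[/eqP-> /eqP->].
- by rewrite (std_comm (j := 6) (p := 2)) // (std_comm (j := 4) (p := 2)).
- by rewrite (std_comm (j := 4) (p := 2)) // (std_comm (j := 6) (p := 4)).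
- rewrite (std_anticomm' (j := 2)) // (std_comm (j := 3) (p := 4)) //.
  by rewrite (std_anticomm (j := 3)) // !linearN opprK.
rewrite (std_comm (j := 5) (p := 2)) // (std_anticomm' (j := 4)) //.
by rewrite (std_anticomm (j := 5)) // !linearN /= !linearN opprK.
Qed.

Lemma spin_anticomm_C v : D (x 1) (x 2) (C v) = - C (D (x 1) (x 2) v).
Proof.
rewrite /C !GLME (std_anticomm (j := 1)) // (std_comm (j := 1) (p := 4)) //.
by rewrite (std_comm (j := 1) (p := 6)).
Qed.

Lemma spin_E_flip (j k : nat) v : all (gtn 8) [:: 0; 1; j; k]%N && uniq [:: 0; 1; j; k]%N ->
  E (x 0) (x 1) (D (x j) (x k) v) = D (x j) (x k) (E (x 0) (x 1) v).
Proof.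
rewrite /= !inE !negb_or !andbT -!andbA => /and5P[j8 k8 _ j0 /and4P[k0 j1 k1 jk]].
have x01 : (x 0).1 != (x 1).1 by exact: std_neq.
rewrite -!GLME flip_E //; last exact: std_neq.
by rewrite ![sw _ _ (x 0)]sw_out ?[sw _ _ (x 1)]sw_out //; apply: std_neq => //; rewrite eq_sym.
Qed.

Lemma spin_E_C v : E (x 0) (x 1) (C v) = C (E (x 0) (x 1) v).
Proof. by rewrite /C !GLME !spin_E_flip. Qed.

(** The anticommuting pairs are D_23, D_36 and D_45, D_56. All four flips commute with [C] and with
    E_01, so they act on the eigenspaces of [C] and on the pieces that E_01 cuts out there. *)
Lemma spin_dim4 (X : {vspace V}) : (0 < \dim X)%N ->
  (forall j k, (j, k) \in [:: (2, 3); (4, 5); (3, 6); (5, 6)] ->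
     stable X (D (x j) (x k))) -> (4 <= \dim X)%N.
Proof.
move=> X0 st.
pose A i := if i == 0%N then D (x 2) (x 3) else D (x 4) (x 5).
pose B i := if i == 0%N then D (x 3) (x 6) else D (x 5) (x 6).
apply: (flip_dim (m := 2) char2 (A := A) (B := B) X0).
- by case=> [|[|i]] // _; split; apply: st.
- case=> [|[|i]] [|[|j]] v // _ _ _; rewrite /A /=; first exact: std_comm.
  by symmetry; exact: std_comm.
- case=> [|[|i]] [|[|j]] v // _ _ _ _; rewrite /A /B /=; exact: std_comm.
- by case=> [|[|i]] v // _ _; rewrite /A /B /=; apply: std_anticomm.
Qed.

(** An eigenspace of E_01 in [X] and the image of [X] under E_01 - p are both stable under these
    flips. If the image were nonzero, both would have dimension at least 4, too much for [X]. *)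
Lemma spin_eigen_scalar (c : K) (X := eigenpart {:V} C c) :
  (0 < \dim X <= 5)%N -> exists p, forall v, v \in X -> E (x 0) (x 1) v = p *: v.
Proof.
case/andP=> X0 X5.
have memX v : (v \in X) = (C v == c *: v) by rewrite memv_eigenpart memvf.
have stX j k : (j, k) \in [:: (2, 3); (4, 5); (3, 6); (5, 6)] ->
    stable X (D (x j) (x k)).
  by move=> jk v; rewrite !memX -spin_comm_C // => /eqP ->; rewrite linearZ.
have Ejk j k w : (j, k) \in [:: (2, 3); (4, 5); (3, 6); (5, 6)] ->
    E (x 0) (x 1) (D (x j) (x k) w) = D (x j) (x k) (E (x 0) (x 1) w).
  by rewrite !inE !xpair_eqE => /or4P[] /andP[/eqP-> /eqP->]; exact: spin_E_flip.
have stE' : stable X (E (x 0) (x 1)).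
  by move=> v; rewrite !memX -spin_E_C => /eqP ->; rewrite linearZ.
have [p [v vX [v0 ev]]] := exists_eigenvector X0 stE'.
exists p; pose f : 'End(V) := GL_lfun (E (x 0) (x 1)) - p *: \1%VF.
have memY w : (w \in (X :&: lker f)%VS) = (w \in X) && (E (x 0) (x 1) w == p *: w).
  by rewrite memv_cap memv_eigen.
have Y4 : (4 <= \dim (X :&: lker f))%N.
  apply: spin_dim4; first by apply: (dim_gt0 (v := v)) => //; rewrite memY vX ev eqxx.
  move=> j k jk w; rewrite !memY => /andP[wX /eqP e].
  by rewrite (stX j k jk w wX) Ejk // e linearZ /=.
have := limg_ker_dim f X.
have [Z0 _|Z0 e] := posnP (\dim (f @: X)).
  move=> w wX; have : f w \in (f @: X)%VS by exact: memv_img.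
  move/eqP: Z0; rewrite dimv_eq0 => /eqP ->; rewrite memv0.
  by rewrite add_lfunE opp_lfunE scale_lfunE id_lfunE subr_eq0 => /eqP.
suff : (4 <= \dim (f @: X))%N by lia.
apply: spin_dim4 => // j k jk w /memv_imgP[u uX ->].
apply/memv_imgP; exists (D (x j) (x k) u); first exact: stX.
by rewrite !(add_lfunE, opp_lfunE, scale_lfunE, id_lfunE) linearB /= linearZ Ejk.
Qed.

(** Up to sign the conjugate of [C] by the Weyl element [W (x 2) (x 0)], which carries E_01 to
    E_21. *)
Let C' := (D (x 0) (x 3) * D (x 4) (x 5) * D (x 6) (x 7))%g.

Lemma spin_C_anticomm v : C' (C v) = - C (C' v).
Proof.
have -> : C (C' v) = D (x 2) (x 3) (D (x 0) (x 3) v).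
  rewrite /C /C' !GLME (std_comm (j := 6) (p := 0)) // (std_comm (j := 4) (p := 0)) //.
  rewrite (std_comm (j := 6) (p := 4)) // !spin ?linearN ?opprK //; exact: std_neq.
have -> : C' (C v) = D (x 0) (x 3) (D (x 2) (x 3) v).
  rewrite /C /C' !GLME (std_comm (j := 6) (p := 2)) // (std_comm (j := 4) (p := 2)) //.
  rewrite (std_comm (j := 6) (p := 4)) // !spin ?linearN ?opprK //; exact: std_neq.
have x30 : (x 3).1 != (x 0).1 by exact: std_neq.
have D30 u : D (x 0) (x 3) u = - D (x 3) (x 0) u.
  by rewrite (flip_swap stE x30) spin_flipV.
rewrite !D30 linearN /= opprK.
by rewrite [in RHS]std_anticomm // opprK.
Qed.

Lemma spin_false : False.
Proof.
have n8 := spin_n8.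
(* For [n = 8] the bound is 12, so two eigenspaces of equal dimension have dimension at most 5
   each. *)
have d11 : (\dim {:V} <= 11)%N by move: dimV; rewrite [in X in (_ < X)%N]n8; lia.
have [a [v _ [v0 ev]]] := exists_eigenvector dimV0 (fun v _ => memvf (C v)).
have aa : a * a = -1.
  have := spin_C v; rewrite ev linearZ /= ev scalerA => /eqP.
  by rewrite -addr_eq0 -{2}[v]scale1r -scalerDl scaler_eq0 (negPf v0) orbF addr_eq0 => /eqP.
have a0 : a != 0.
  by apply/eqP => e; move/eqP: aa; rewrite e mul0r eq_sym oppr_eq0 oner_eq0.
have memX (s : K) w : (w \in eigenpart {:V} C s) = (C w == s *: w) by rewrite memv_eigenpart memvf.
(* The flip D_12 meets just one factor of [C], in one index, so it anticommutes with [C] and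
   exchanges the eigenspaces. *)
have swap (s : K) : (\dim (eigenpart {:V} C s) <= \dim (eigenpart {:V} C (- s)))%N.
  apply: (dim_leq_inj (f := D (x 1) (x 2))).
    by move=> w e; apply: (@GL_inj _ _ (D (x 1) (x 2))); rewrite e linear0.
  move=> w; rewrite !memX => /eqP e.
  by rewrite -[C _]opprK -spin_anticomm_C e linearZ scaleNr.
have s1 := swap a; have s2 := swap (- a); rewrite opprK in s2.
have s3 := leq_trans (dim_eigenparts {:V} C (neq_opp char2 a0)) d11.
have s6 : (\dim (eigenpart {:V} C a) <= 5)%N.
  have := leq_trans (leq_add (leqnn _) s1) s3; lia.
have s4 : (0 < \dim (eigenpart {:V} C a))%N by apply: (dim_gt0 (v := v)) => //; rewrite memX ev.
have [|p hp] := @spin_eigen_scalar a; first by rewrite s4.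
have s5 : (\dim (eigenpart {:V} C (- a)) <= 5)%N by exact: leq_trans s2 s6.
have [|q hq] := @spin_eigen_scalar (- a).
  by apply/andP; split; [exact: leq_trans s4 s1|].
(* Interpolation: P + Q a = p and P - Q a = q, where [a] and [- a] are the eigenvalues of [C]. *)
pose P := 2^-1 * (p + q); pose Q := 2^-1 * a^-1 * (p - q).
have EPQ w : E (x 0) (x 1) w = P *: w + Q *: C w.
  have [u [u' [uX u'X ->]]] : exists u u', [/\ u \in eigenpart {:V} C a,
      u' \in eigenpart {:V} C (- a) & w = 2^-1 *: (u + u')].
    exists (w + a^-1 *: C w), (w - a^-1 *: C w).
    have aV : a^-1 = - a by apply: (mulfI a0); rewrite mulfV // mulrN aa opprK.
    split; last by rewrite addrACA subrr addr0 -mulr2n -scaler_nat scalerA mulVf // scale1r.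
      by rewrite memX linearD linearZ /= spin_C scalerDr scalerA mulfV // scale1r aV scalerN scaleNr opprK addrC.
    rewrite memX linearB linearZ /= spin_C scalerBr scalerA mulNr mulfV //.
    by rewrite scaleN1r opprK aV scalerN !scaleNr opprK addrC.
  have Cu : C u = a *: u by apply/eqP; rewrite -memX.
  have Cu' : C u' = - a *: u' by apply/eqP; rewrite -memX.
  rewrite !linearZ !linearD /= (hp _ uX) (hq _ u'X).
  rewrite Cu Cu' !scalerDr !scalerA addrACA -!scalerDl; congr (_ *: _ + _ *: _).
    by rewrite /P /Q; field; rewrite a0 char2.
  by rewrite /P /Q; field; rewrite a0 char2.
have : Q = 0.
  pose w := W (x 2) (x 0).
  have x20 : (x 2).1 != (x 0).1 by exact: std_neq.
  have wD b c u : b.1 != c.1 ->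
      w (D b c u) = D (sw (x 2) (x 0) b) (sw (x 2) (x 0) c) (w u).
    by move=> bc; rewrite -!GLME weyl_D.
  have sw_std k : (2 < k < 8)%N -> sw (x 2) (x 0) (x k) = x k.
    by case/andP=> k2 k8; rewrite sw_out //; apply: std_neq => //; apply/eqP => e; rewrite e in k2.
  have wC u : w (C u) = - C' (w u).
    rewrite /C !GLME !wD; try exact: std_neq.
    by rewrite sw_fst !sw_std // flip_linvl ?spin_flipV //; exact: std_neq.
  have E21 u : E (x 2) (x 1) u = P *: u - Q *: C' u.
    have e := weyl_E stE x20 (std_neq (j := 0) (k := 1) isT isT isT).
    rewrite sw_snd // sw_out in e; try exact: std_neq.
    rewrite -(GLVK w u) -GLME -e GLME EPQ linearD !linearZ /= wC.
    by rewrite scalerN.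
  have comm : E (x 0) (x 1) (E (x 2) (x 1) v) = E (x 2) (x 1) (E (x 0) (x 1) v).
    by apply/commuteE/(st_comm stE); rewrite ?letter_neq //; exact: std_neq.
  have anti : C' (C v) = - C (C' v) by exact: spin_C_anticomm.
  exact: (pencil_commute EPQ E21 comm anti v0).
(* Now E_01 is scalar, hence all transvections and flips are trivial, and flips cannot square to
   -1. *)
move=> Q0; have E1 := @steinberg_scalar P _.
have {}E1 : forall b c, b.1 != c.1 -> E b c = 1%g.
  by apply: E1 => w; rewrite EPQ Q0 scale0r addr0.
have := spin (std_neq (j := 0) (k := 1) isT isT isT) v.
rewrite !flip_wordE !weyl_wordE !E1; try exact: std_neq.
by rewrite !mulg1 !GL1E => /(scaleN_eq0 char2)/eqP; rewrite (negPf v0).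
Qed.

End Spin.

Lemma flip_square a b v : a.1 != b.1 -> D a b (D a b v) = v.
Proof.
move=> ab; have [c [->|[-> d0]] h] := flip_square_uniform; first by rewrite h ?scale1r.
by case: (spin_false d0) => p q pq w; rewrite h // scaleN1r.
Qed.

End FlipSquare.

(** * Weights *)

Lemma weights_directv (K : fieldType) (V : vectType K) (I : finType) (T : Type)
    (op : T -> 'End(V)) (chi : I -> T -> K) (Vs : I -> {vspace V}) :
  (forall i t v, v \in Vs i -> op t v = chi i t *: v) ->
  (forall i j, i != j -> exists t, chi i t != chi j t) ->
  directv (\sum_i Vs i).
Proof.
move=> eig sep; apply/directv_sum_independent => us usV sum0 i _.
apply: (@weights_independent _ _ _ _ op chi us) => // j t.
by apply: eig; exact: usV.
Qed.

Lemma weights_dim (K : fieldType) (V : vectType K) (I : finType) (T : Type)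
    (op : T -> 'End(V)) (chi : I -> T -> K) (Vs : I -> {vspace V}) :
  (forall i t v, v \in Vs i -> op t v = chi i t *: v) ->
  (forall i j, i != j -> exists t, chi i t != chi j t) ->
  (\sum_i \dim (Vs i) <= \dim {:V})%N.
Proof.
move=> eig sep; have /directvP /= <- := weights_directv eig sep.
by apply: dimvS; exact: subvf.
Qed.

Section Weights.
Variables (n : nat) (K : fieldType) (V : vectType K).
Variable E : letter n -> letter n -> GL V.
Hypothesis n_gt7 : (7 < n)%N.
Hypothesis char2 : (2 : K) != 0.
Hypothesis stE : steinberg E.
Hypothesis dimV : (\dim {:V} < 2 * n - 4)%N.
Hypothesis flip_sq : forall a b v, a.1 != b.1 ->
  flip_word E a b (flip_word E a b v) = v.
Implicit Types (a b c : letter n) (v : V) (i j k l : 'I_n) (chi : 'I_n -> K).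

Notation W := (weyl_word E).
Notation D := (flip_word E).

Definition sgn_op i j : GL V := D (i, false) (j, false).

Lemma flipV a b : a.1 != b.1 -> (D a b)^-1%g = D a b.
Proof. by move=> ab; apply: GL_eqP => v; rewrite -{1}(flip_sq v ab) GLK. Qed.

(** Inverting a letter inverts the flip, which is now its own inverse; so only the indices
    matter. *)
Lemma flip_sgn a b : a.1 != b.1 -> D a b = sgn_op a.1 b.1.
Proof.
move=> ab; case: a b ab => i s [j t] /= ij; rewrite /sgn_op.
case: s; last first.
  case: t => //; rewrite (_ : (j, true) = linv (j, false)) //.
  by rewrite flip_linvr // flipV.
rewrite (_ : (i, true) = linv (i, false)) // flip_linvl // flipV //.
case: t => //; rewrite (_ : (j, true) = linv (j, false)) //.
by rewrite flip_linvr // flipV.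
Qed.

Lemma sgn_sq i j v : i != j -> sgn_op i j (sgn_op i j v) = v.
Proof. by move=> ij; apply: flip_sq. Qed.

Lemma sgnC i j : i != j -> sgn_op j i = sgn_op i j.
Proof. by move=> ij; rewrite /sgn_op flip_swap // flipV. Qed.

Lemma sgn_mul i j k v : i != j -> i != k -> j != k ->
  sgn_op i k v = sgn_op j k (sgn_op i j v).
Proof. by move=> ij ik jk; rewrite -GLME {1}/sgn_op (@flip_mul _ _ _ stE _ (j, false)) // flipV. Qed.

Lemma sgn_comm3 i j k v : i != j -> i != k -> j != k ->
  sgn_op i j (sgn_op j k v) = sgn_op j k (sgn_op i j v).
Proof. by move=> ij ik jk; rewrite -!GLME /sgn_op flip_anticomm // flipV. Qed.

Lemma sgn_comm i j k l v : i != j -> k != l ->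
  sgn_op i j (sgn_op k l v) = sgn_op k l (sgn_op i j v).
Proof.
move=> ij kl; have [ik|ik] := eqVneq i k.
  rewrite -ik in kl *; have [->//|jl] := eqVneq j l.
  by rewrite -(sgnC ij) sgn_comm3 // eq_sym.
have [il|il] := eqVneq i l.
  rewrite -il in kl *; have [->//|jk] := eqVneq j k; first by rewrite sgnC.
  by rewrite -(sgnC ij) -(sgnC kl) sgn_comm3 // 1?eq_sym.
have [jk|jk] := eqVneq j k; first by rewrite -jk in kl *; rewrite sgn_comm3.
have [jl|jl] := eqVneq j l.
  by rewrite -jl in kl *; rewrite -(sgnC kl) sgn_comm3 // eq_sym.
by apply: commuteE; apply: flip_comm.
Qed.

(** Flips change signs in pairs, so only products of two signs are visible, and [chi] and its
    negative describe the same weight. *)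
Definition is_weight chi v := forall i j, i != j -> sgn_op i j v = (chi i * chi j) *: v.

Definition weight_space chi : {vspace V} :=
  (\bigcap_(p : 'I_n * 'I_n | p.1 != p.2)
     lker (GL_lfun (sgn_op p.1 p.2) - (chi p.1 * chi p.2) *: \1%VF))%VS.

Lemma weight_spaceP chi v : reflect (is_weight chi v) (v \in weight_space chi).
Proof.
rewrite memvE; apply: (iffP subv_bigcapP) => h.
  by move=> i j ij; have := h (i, j) ij; rewrite -memvE memv_eigen => /eqP.
by move=> [i j] /= ij; rewrite -memvE memv_eigen h.
Qed.

Lemma sgn_weyl a b i j v : a.1 != b.1 -> i != j ->
  sgn_op i j (W a b v) = W a b (sgn_op (tperm a.1 b.1 i) (tperm a.1 b.1 j) v).
Proof.
move=> ab ij; set t := tperm _ _.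
have tij : t i != t j by rewrite (inj_eq perm_inj).
rewrite [sgn_op (t i) _]/sgn_op -!GLME weyl_D // !GLME flip_sgn ?sw_neq1 //.
by rewrite !sw1 //= !tpermK.
Qed.

Lemma weight_weyl chi a b v : a.1 != b.1 -> is_weight chi v ->
  is_weight (chi \o tperm a.1 b.1) (W a b v).
Proof.
move=> ab h i j ij; rewrite sgn_weyl // h ?linearZ //.
by rewrite (inj_eq perm_inj).
Qed.

Definition single i j : K := if j == i then -1 else 1.

Lemma single_weyl a b i v : a.1 != b.1 -> is_weight (single i) v ->
  is_weight (single (tperm a.1 b.1 i)) (W a b v).
Proof.
move=> ab /(weight_weyl ab) h k l kl; rewrite h //= /single.
by rewrite -!(inj_eq (@perm_inj _ (tperm a.1 b.1)) _ i) !tpermK.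
Qed.

Lemma one_neqN1 : (1 : K) != -1.
Proof. by rewrite -subr_eq0 opprK. Qed.

(* Exchanging an index of sign -1 with one of sign 1 gives [p * (n - p)] independent
   weights, which is at least [2 * n - 4] when [2 <= p <= n - 2]. *)
Lemma weight_card chi v : (forall i, chi i = 1 \/ chi i = -1) -> v != 0 ->
  is_weight chi v ->
  (#|[pred i | chi i == (-1)%R]| <= 1)%N || (n.-1 <= #|[pred i | chi i == (-1)%R]|)%N.
Proof.
move=> sgn v0 hv; set p := #|_|; apply: contraT; rewrite negb_or -!ltnNge => /andP[p1 pn].
set J := [pred i | chi i == -1] in p p1 pn *.
have pE : p = #|J| by [].
have Jp i : i \in J = (chi i == -1) by [].
pose I := {q : 'I_n * 'I_n | (q.1 \in J) && (q.2 \in [predC J])}.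
have cardI : #|{: I}| = (p * (n - p))%N.
  rewrite card_sig -[RHS]/(#|J| * (n - #|J|))%N.
  have -> : (n - #|J|)%N = #|[predC J]|.
    rewrite -[RHS](addKn #|J|); congr (_ - _)%N.
    by rewrite cardC card_ord.
  by rewrite -cardX; apply: eq_card => q.
have neq (q : I) : ((val q).1, false).1 != ((val q).2, false).1 :> 'I_n.
  case: q => -[i j] /= /andP[iJ jJ]; apply: contraTneq iJ => ->; exact: jJ.
pose w (q : I) := W ((val q).1, false) ((val q).2, false) v.
pose psi (q : I) := chi \o tperm (val q).1 (val q).2.
have ww q : is_weight (psi q) (w q) by apply: weight_weyl.
have w0 q : w q != 0.
  by apply: contra_neq v0 => e; apply: (@GL_inj _ _ (W ((val q).1, false) ((val q).2, false)));
    rewrite linear0.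
pose T := {t : 'I_n * 'I_n | t.1 != t.2}.
have := @weights_dim K V I T (fun t => sgn_op (val t).1 (val t).2)
   (fun q t => psi q (val t).1 * psi q (val t).2) (fun q => <[w q]>%VS) _ _.
have -> : (\sum_i \dim <[w i]> = #|{: I}|)%N.
  by rewrite -sum1_card; apply: eq_bigr => q _; rewrite dim_vline w0.
have big : (2 * n - 4 <= p * (n - p))%N.
  by have := max_card J; rewrite card_ord -pE => pn'; nia.
rewrite cardI => h; suff : (p * (n - p) <= \dim {:V})%N by rewrite leqNgt (leq_trans dimV).
apply: h; first by move=> q [t tt] u /vlineP[s ->]; rewrite linearZ /= ww // !scalerA mulrC.
have psiE q k : psi q k = if (k == (val q).1) || (k == (val q).2) then - chi k else chi k.
  rewrite /psi /=; case: q => -[a b] /= /andP[aJ bJ].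
  have ca : chi a = -1 by apply/eqP.
  have cb : chi b = 1 by case: (sgn b) => // e; move: bJ; rewrite !inE e eqxx.
  have [->|ka] := eqVneq k a; first by rewrite tpermL ca cb opprK.
  have [->|kb] := eqVneq k b; first by rewrite tpermR ca cb.
  by rewrite tpermD // eq_sym.
move=> q q' qq'.
(* Both exchanges fix [l], so evaluating at a pair [(k, l)] detects a difference of the signs at
   [k]. *)
have [l] := @fresh_ord n [:: (val q).1; (val q).2; (val q').1; (val q').2]
  ltac:(by apply: leq_trans n_gt7).
rewrite !inE !negb_or => /and4P[l1 l2 l3 l4].
have key k : (k == (val q).1) || (k == (val q).2) ->
    k != (val q').1 -> k != (val q').2 ->
    exists t : T, psi q (val t).1 * psi q (val t).2 != psi q' (val t).1 * psi q' (val t).2.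
  move=> kq k1 k2; have kl : (k, l).1 != (k, l).2.
    by case/orP: kq => /eqP ->; rewrite eq_sym.
  exists (exist _ (k, l) kl) => /=; rewrite !psiE kq.
  rewrite (negPf k1) (negPf k2) (negPf l1) (negPf l2) (negPf l3) (negPf l4) /= mulNr.
  rewrite eq_sym; apply: neq_opp => //.
  have chi0 m : chi m != 0 by case: (sgn m) => ->; rewrite ?oppr_eq0 oner_eq0.
  by rewrite mulf_neq0.
case: q qq' l1 l2 key {ww w0} => -[a b] /= qJ; case: q' l3 l4 => -[a' b'] /= qJ' _ _ qq' _ _ key.
have [aJ bJ] := andP qJ; have [aJ' bJ'] := andP qJ'.
have JJ (i j : 'I_n) : i \in J -> j \in [predC J] -> i != j.
  by move=> iJ jJ; apply: contraTneq iJ => ->.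
have [ea|na] := eqVneq a a'; last by apply: (key a); rewrite ?eqxx //; exact: JJ.
have [eb|nb] := eqVneq b b'.
  by case/eqP: qq'; apply: val_inj; rewrite /= ea eb.
by apply: (key b); rewrite ?eqxx ?orbT //; rewrite eq_sym; exact: JJ.
Qed.

Lemma weight_ext chi chi' v : chi =1 chi' -> is_weight chi v -> is_weight chi' v.
Proof. by move=> e h i j ij; rewrite h // !e. Qed.

Lemma weight_opp chi v : is_weight chi v -> is_weight (fun i => - chi i) v.
Proof. by move=> h i j ij; rewrite h // mulrNN. Qed.

Lemma sub_weights (U X : {vspace V}) :
  (forall i j v, i != j -> v \in U -> sgn_op i j v \in U) ->
  (forall v, v \in U -> is_weight (fun=> 1) v -> v \in X) ->
  (forall i v, v \in U -> is_weight (single i) v -> v \in X) ->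
  (U <= X)%VS.
Proof.
move=> stU X0 X1; pose o := (std_letter n_gt7 0).1.
(* The flips through the one index [o] determine all the others by [sgn_mul]. *)
pose ops := [seq GL_lfun (sgn_op o i) | i <- enum 'I_n & i != o].
have opsP s : s \in ops -> exists2 i, o != i & s = GL_lfun (sgn_op o i).
  by move/mapP=> [i]; rewrite mem_filter eq_sym => /andP[io _] ->; exists i.
apply: (weights_span (op := ops) char2).
- by move=> s v /opsP[i oi ->] vU; rewrite stU // sgn_sq.
- by move=> s t v /opsP[i oi ->] /opsP[j oj ->]; exact: sgn_comm.
move=> v vU hv; have [->|v0] := eqVneq v 0; first exact: mem0v.
(* Requiring [chi o = 1] selects one of the two sign functions of the weight. *)
pose chi i : K := if (i == o) || (sgn_op o i v == v) then 1 else -1.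
have hsgn i : chi i = 1 \/ chi i = -1 by rewrite /chi; case: ifP; [left|right].
have ho i : o != i -> sgn_op o i v = chi i *: v.
  move=> oi; rewrite /chi eq_sym (negPf oi) /=.
  have so : GL_lfun (sgn_op o i) \in ops.
    by apply/mapP; exists i => //; rewrite mem_filter mem_enum andbT eq_sym.
  have [->|e] := hv _ so; first by rewrite eqxx scale1r.
  by rewrite e; case: eqP => [e'|_]; rewrite ?scaleN1r ?scale1r.
have hw : is_weight chi v.
  have chio : chi o = 1 by rewrite /chi eqxx.
  move=> i j ij; have [io|io] := eqVneq i o.
    rewrite io in ij *; rewrite ho //.
    by rewrite chio mul1r.
  have [jo|jo] := eqVneq j o.
    rewrite jo in ij *; have oi : o != i by rewrite eq_sym.
    by rewrite (sgnC oi) ho // chio mulr1.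
  have oi : o != i by rewrite eq_sym.
  have oj : o != j by rewrite eq_sym.
  by rewrite (@sgn_mul i o j) // (sgnC oi) ho // linearZ /= ho // scalerA.
have main chi' : (forall i, chi' i = 1 \/ chi' i = -1) -> is_weight chi' v ->
    (#|[pred i | chi' i == (-1)%R]| <= 1)%N -> v \in X.
  move=> sg w'; rewrite leq_eqVlt ltnS leqn0 => /orP[/card1P[i hi]|/eqP/card0_eq hi].
    apply: (X1 i) => //; apply: weight_ext w' => j; have := hi j; rewrite !inE /single.
    by case: (sg j) => ->; rewrite ?eqxx => <- //; rewrite (negPf one_neqN1).
  apply: X0 => //; apply: weight_ext w' => j; have := hi j; rewrite !inE.
  by case: (sg j) => ->; rewrite ?eqxx.
case/orP: (weight_card hsgn v0 hw) => [|big]; first exact: main.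
(* With at least n - 1 signs -1, the negative of [chi] has at most one. *)
apply: (main _ _ (weight_opp hw)).
  by move=> i; case: (hsgn i) => ->; rewrite ?opprK; [right|left].
have e : [pred i | - chi i == -1] =i [predC [pred i | chi i == -1]].
  move=> i; rewrite !inE eqr_opp; case: (hsgn i) => ->; rewrite ?eqxx ?(negPf one_neqN1) //.
  by rewrite eq_sym (negPf one_neqN1).
rewrite (eq_card e); have := cardC [pred i | chi i == -1]; rewrite card_ord.
move: big; move: #|_| #|_| => p q; lia.
Qed.

End Weights.

Lemma exp2_bound m : (7 < m -> 2 * m - 4 < 2 ^ (m - 4))%N.
Proof.
move=> m7; have := @exp2_ge4 (m - 4)%N ltac:(lia).
by move: (2 ^ (m - 4))%N => e; lia.
Qed.

(** * Weight multiplicities, and the case without singleton weights *)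

Section Structure.
Variables (n : nat) (K : closedFieldType) (V : vectType K).
Variable E : letter n -> letter n -> GL V.
Hypothesis n_gt7 : (7 < n)%N.
Hypothesis char2 : (2 : K) != 0.
Hypothesis stE : steinberg E.
Hypothesis dimV : (\dim {:V} < 2 * n - 4)%N.
Hypothesis flip_sq : forall a b v, a.1 != b.1 ->
  flip_word E a b (flip_word E a b v) = v.
Implicit Types (a b c : letter n) (v f : V) (i j k l : 'I_n) (chi : 'I_n -> K).

Notation W := (weyl_word E).
Notation D := (flip_word E).
Notation sgn := (sgn_op E).
Notation x := (std_letter n_gt7).

(* On a subspace where the letters' inverses cannot be distinguished, [E a b] is a
   central involution of an extraspecial group generated by the [E a c] and the [E
   c^-1 b]. *)
Lemma extraspecial (U : {vspace V}) (p q : 'I_n) :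
  (\dim U < 2 ^ (n - 4))%N ->
  (forall c d, c.1 != d.1 -> c.1 \notin [:: p; q] -> d.1 \notin [:: p; q] ->
     stable U (E c d)) ->
  (forall c d v, c.1 != d.1 -> c.1 \notin [:: p; q] -> d.1 \notin [:: p; q] ->
     v \in U -> E (linv c) d v = E c d v /\ E c (linv d) v = E c d v) ->
  forall a b v, a.1 != b.1 -> a.1 \notin [:: p; q] -> b.1 \notin [:: p; q] ->
    v \in U -> E a b v = v.
Proof.
move=> dU stU inv a b v ab apq bpq vU; have ba : b.1 != a.1 by rewrite eq_sym.
(* Inverting [b] inverts [E a b], but on [U] it changes nothing. *)
have Eab2 w : w \in U -> E a b (E a b w) = w.
  move=> wU; have [_ e] := inv a b w ab apq bpq wU.
  by rewrite -{1}e (st_inv stE) // GLVK.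
have stab : stable U (E a b) by apply: stU.
have memY w : (w \in eigenpart U (E a b) (-1)) = (w \in U) && (E a b w == - w).
  by rewrite memv_eigenpart scaleN1r.
have [d0|d0] := posnP (\dim (eigenpart U (E a b) (-1))).
  have : v - E a b v \in eigenpart U (E a b) (-1).
    by rewrite memY memvB ?stab //= linearB /= Eab2 // opprB.
  move/eqP: d0; rewrite dimv_eq0 => /eqP ->; rewrite memv0 subr_eq0.
  by move/eqP.
pose s := [seq i <- enum 'I_n | i \notin [:: p; q; a.1; b.1]].
have sz : (n - 4 <= size s)%N.
  have := cardC (mem [:: p; q; a.1; b.1]); rewrite card_ord.
  have := card_size [:: p; q; a.1; b.1].
  have -> : #|[predC mem [:: p; q; a.1; b.1]]| = size s.
    have /card_uniqP <- : uniq s by rewrite filter_uniq ?enum_uniq.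
    by apply: eq_card => i; rewrite mem_filter mem_enum andbT.
  by move: #|_| (size s) => u w /=; lia.
have snth (i : nat) : (i < size s)%N -> [/\ (nth p s i) \notin [:: p; q], a.1 != nth p s i & b.1 != nth p s i].
  move=> /(mem_nth p); rewrite mem_filter !inE !negb_or -!andbA.
  by case/and5P=> -> -> h1 h2 _; rewrite ![_.1 == _]eq_sym h1 h2.
have unth (i j : nat) : (i < size s)%N -> (j < size s)%N -> i != j -> nth p s i != nth p s j.
  by move=> is_ js ij; rewrite nth_uniq // filter_uniq ?enum_uniq.
suff : (2 ^ size s <= \dim U)%N.
  by rewrite leqNgt => /negP[]; apply: leq_trans dU _; rewrite leq_exp2l.
apply: (@leq_trans (\dim (eigenpart U (E a b) (-1)))); last by rewrite dimvS ?capvSl.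
pose y (i : nat) : letter n := (nth p s i, false).
(* The relation [st_comm] asks for distinct first letters; on [U] one [a] may be replaced by its
   inverse to obtain them. *)
have A_E (i : nat) w : (i < size s)%N -> w \in U -> E a (y i) (E a b w) = E a b (E a (y i) w).
  move=> is_ wU; have [ipq ia ib] := snth i is_.
  have [e _] := inv a b (E a (y i) w) ab apq bpq ltac:(by apply: stU).
  have [e' _] := inv a b w ab apq bpq wU.
  rewrite -e -e'; apply/commuteE/(st_comm stE) => //=; rewrite 1?eq_sym //.
  exact: linv_neq.
apply: (@flip_dim K V char2 (size s) (fun i : nat => E a (y i)) (fun i : nat => E (linv (y i)) b) _ d0).
- move=> i is_; have [ipq ia ib] := snth i is_.
  have iN : nth p s i != b.1 by rewrite eq_sym.
  split=> w; rewrite !memY => /andP[wU /eqP e].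
    rewrite (stU a (y i) ia apq ipq w wU) -A_E // e linearN /=.
    exact: eqxx.
  rewrite (stU (linv (y i)) b iN ipq bpq w wU) /=.
  rewrite (commuteE (g := E (linv (y i)) b)) ?e ?linearN //=.
  by apply: (st_comm stE) => //=; rewrite ?letter_neq.
- move=> i j w is_ js; rewrite memY => /andP[wU _].
  have [->//|ij] := eqVneq i j.
  have [ipq ia ib] := snth i is_; have [jpq ja jb] := snth j js.
  have [e _] := inv a (y i) (E a (y j) w) ia apq ipq ltac:(by apply: stU).
  have [e' _] := inv a (y i) w ia apq ipq wU.
  rewrite -e -e'; apply/commuteE/(st_comm stE) => //=; first exact: linv_neq.
  by rewrite eq_sym.
- move=> i j w is_ js ij; rewrite memY => /andP[wU _].
  have [ipq ia ib] := snth i is_; have [jpq ja jb] := snth j js.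
  have jN : nth p s j != b.1 by rewrite eq_sym.
  apply: commuteE; apply: (st_comm stE) => //; last exact: unth.
  exact: letter_neq.
move=> i w is_; rewrite memY => /andP[wU /eqP e].
have [ipq ia ib] := snth i is_.
have iN : nth p s i != b.1 by rewrite eq_sym.
have := @st_cm _ _ _ stE a (y i) b ia ab iN.
move/(congr1 (fun f : GL V => f (E (linv (y i)) b (E a (y i) w)))).
rewrite /cm !GLME !GLK => ->.
rewrite (commuteE (g := E (linv (y i)) b)); last first.
  by apply: (st_comm stE) => //=; rewrite ?letter_neq.
by rewrite -A_E // e !linearN.
Qed.

Notation E0 := (weight_space E (fun=> 1 : K)).
Notation Ei i := (weight_space E (single K i)).

Lemma fresh4 i j k l : exists h, [/\ h != i, h != j, h != k & h != l].
Proof.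
have [h] := @fresh_ord n [:: i; j; k; l] ltac:(by apply: leq_trans n_gt7).
by rewrite !inE !negb_or => /and4P[? ? ? ?]; exists h.
Qed.

Definition weight_chi (o : option 'I_n) : 'I_n -> K :=
  if o is Some i then single K i else fun=> 1.

Lemma single_self i : single K i i = -1. Proof. by rewrite /single eqxx. Qed.
Lemma single_neq i j : j != i -> single K i j = 1.
Proof. by rewrite /single => /negPf->. Qed.

Lemma weight_chi_sep (o o' : option 'I_n) : o != o' -> exists t : {t : 'I_n * 'I_n | t.1 != t.2},
  weight_chi o (val t).1 * weight_chi o (val t).2 !=
  weight_chi o' (val t).1 * weight_chi o' (val t).2.
Proof.
have N1 : (-1 : K) != 1 by rewrite eq_sym one_neqN1.
case: o o' => [i|] [j|] //=; rewrite ?(inj_eq Some_inj) => ij.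
- have [k [ki kj _ _]] := fresh4 i j i j; have ik : (i, k).1 != (i, k).2 by rewrite eq_sym.
  exists (exist _ (i, k) ik) => /=.
  by rewrite single_self (single_neq ki) (single_neq kj) single_neq // mulr1 mul1r.
- have [k [ki _ _ _]] := fresh4 i i i i; have ik : (i, k).1 != (i, k).2 by rewrite eq_sym.
  by exists (exist _ (i, k) ik) => /=; rewrite single_self (single_neq ki) !mulr1.
have [k [kj _ _ _]] := fresh4 j j j j; have jk : (j, k).1 != (j, k).2 by rewrite eq_sym.
by exists (exist _ (j, k) jk) => /=; rewrite single_self (single_neq kj) !mulr1 one_neqN1.
Qed.

Lemma weights_full : (\sum_o weight_space E (weight_chi o))%VS = {:V}%VS.
Proof.
apply/eqP; rewrite eqEsubv subvf; apply: (sub_weights n_gt7 char2 stE dimV flip_sq).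
- by move=> *; exact: memvf.
- by move=> v _ /weight_spaceP hv; apply: (subvP (sumv_sup None _ _)) hv.
- by move=> i v _ /weight_spaceP hv; apply: (subvP (sumv_sup (Some i) _ _)) hv.
Qed.

Lemma weights_direct : directv (\sum_o weight_space E (weight_chi o)).
Proof.
apply: (weights_directv (T := {t : 'I_n * 'I_n | t.1 != t.2})
  (op := fun t => sgn (val t).1 (val t).2)
  (chi := fun o t => weight_chi o (val t).1 * weight_chi o (val t).2)).
  by move=> o [t tt] v /weight_spaceP ->.
exact: weight_chi_sep.
Qed.

Lemma dim_weights : (\dim E0 + \sum_i \dim (Ei i) = \dim {:V})%N.
Proof.
have /directvP /= := weights_direct; rewrite weights_full => ->.
rewrite (bigD1 None) //=; congr (_ + _)%N.
rewrite (reindex_omap Some id) => [|[]] //=.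
by apply: eq_bigl => i; rewrite eqxx.
Qed.

Lemma dim_single_le i j : (\dim (Ei i) <= \dim (Ei j))%N.
Proof.
have [->//|ij] := eqVneq i j; have ij' : (i, false).1 != (j, false).1 by [].
apply: (dim_leq_inj (f := W (i, false) (j, false))).
  by move=> v e; apply: (@GL_inj _ _ (W (i, false) (j, false))); rewrite e linear0.
move=> v /weight_spaceP hv; apply/weight_spaceP.
by have := single_weyl stE flip_sq ij' hv; rewrite tpermL.
Qed.

Lemma dim_single i j : \dim (Ei i) = \dim (Ei j).
Proof. by apply/eqP; rewrite eqn_leq !dim_single_le. Qed.

Lemma dim_E0 i : (\dim E0 + n * \dim (Ei i) = \dim {:V})%N.
Proof.
rewrite -dim_weights; congr (_ + _)%N.
by rewrite (eq_bigr (fun=> \dim (Ei i))) ?sum_nat_const ?card_ord // => j _; exact: dim_single.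
Qed.

(** Multiplicity two would already force dimension 2n. *)
Lemma dim_single1 i : (\dim (Ei i) <= 1)%N.
Proof. by have := dim_E0 i; move: dimV; case: (\dim (Ei i)) => [|[|d]] //; nia. Qed.

Lemma sgn_E a b i j v : a.1 != b.1 -> i != j -> i != a.1 -> i != b.1 ->
  j != a.1 -> j != b.1 -> sgn i j (E a b v) = E a b (sgn i j v).
Proof.
by move=> ab ij ia ib ja jb; rewrite /sgn_op -!GLME flip_E // !sw_out //= eq_sym.
Qed.

(** The flip inverts [a] but not [b]. If it also fixes [E a b v], then [a] and its inverse act alike
    on [v], as [extraspecial] requires. *)
Lemma flip_E_fix a b c v : a.1 != b.1 -> a.1 != c.1 -> b.1 != c.1 ->
  D a c v = v -> D a c (E a b v) = E (linv a) b v.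
Proof.
move=> ab ac bc e; rewrite -GLME flip_E // GLME e !sw_sw // eqxx.
by rewrite [b.1 == _]eq_sym (negPf ab) (negPf bc).
Qed.

Lemma flip_E_fixr a b c v : a.1 != b.1 -> a.1 != c.1 -> b.1 != c.1 ->
  D b c v = v -> D b c (E a b v) = E a (linv b) v.
Proof.
move=> ab ac bc e; rewrite -GLME flip_E // GLME e !sw_sw // eqxx.
by rewrite (negPf ab) (negPf ac).
Qed.

Lemma steinberg_trivial i : \dim (Ei i) = 0%N -> forall a b, a.1 != b.1 -> E a b = 1%g.
Proof.
move=> di a b ab; have dj j : Ei j = 0%VS.
  by apply/eqP; rewrite -dimv_eq0 (dim_single j i) di.
have E0f v : v \in E0.
  suff -> : E0 = {:V}%VS by exact: memvf.
  by apply/eqP; rewrite eqEdim subvf -(dim_E0 i) di muln0 addn0 leqnn.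
have D1 c d v : c.1 != d.1 -> D c d v = v.
  by move=> cd; rewrite flip_sgn //; have /weight_spaceP -> := E0f v; rewrite // mul1r scale1r.
(* [extraspecial] sets two indices aside; here both are one index away from [a] and [b]. *)
have [p [pa pb _ _]] := fresh4 a.1 b.1 a.1 b.1.
apply: GL_eqP => v; rewrite GL1E.
apply: (@extraspecial {:V}%VS p p) => //; rewrite ?inE ?orbb 1?eq_sym // ?memvf //.
- by apply: leq_trans dimV _; apply/ltnW/exp2_bound.
- by move=> c d _ _ _ v0 _; exact: memvf.
move=> c d w cd _ _ _; have [k [kc kd _ _]] := fresh4 c.1 d.1 c.1 d.1.
have ck : c.1 != (k, false).1 by rewrite eq_sym.
have dk : d.1 != (k, false).1 by rewrite eq_sym.
split.
  by rewrite -(flip_E_fix cd ck dk) ?D1.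
by rewrite -(flip_E_fixr cd ck dk) ?D1.
Qed.

End Structure.

(** * Action on the singleton lines and on the trivial weight space *)

Section Monomial.
Variables (n : nat) (K : closedFieldType) (V : vectType K).
Variable E : letter n -> letter n -> GL V.
Hypothesis n_gt7 : (7 < n)%N.
Hypothesis char2 : (2 : K) != 0.
Hypothesis stE : steinberg E.
Hypothesis dimV : (\dim {:V} < 2 * n - 4)%N.
Hypothesis flip_sq : forall a b v, a.1 != b.1 ->
  flip_word E a b (flip_word E a b v) = v.
Notation E0 := (weight_space E (fun=> 1 : K)).
Notation Ei i := (weight_space E (single K i)).
Hypothesis dimEi : forall i, \dim (Ei i) = 1%N.
Implicit Types (a b c : letter n) (v f : V) (i j k l : 'I_n).

Notation W := (weyl_word E).
Notation D := (flip_word E).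
Notation sgn := (sgn_op E).
Notation x := (std_letter n_gt7).

Lemma single_sgnl i j v : v \in Ei i -> i != j -> sgn i j v = - v.
Proof.
move=> /weight_spaceP h ij; rewrite h // single_self single_neq 1?eq_sym //.
by rewrite mulr1 scaleN1r.
Qed.

Lemma single_sgnr i j v : v \in Ei i -> i != j -> sgn j i v = - v.
Proof. by move=> vi ij; rewrite (sgnC stE flip_sq ij) single_sgnl. Qed.

Lemma single_sgn_out i j k v : v \in Ei i -> j != k -> j != i -> k != i -> sgn j k v = v.
Proof.
by move=> /weight_spaceP h jk ji ki; rewrite h // !single_neq // mul1r scale1r.
Qed.

Lemma E0_sgn i j f : f \in E0 -> i != j -> sgn i j f = f.
Proof. by move=> /weight_spaceP h ij; rewrite h // mul1r scale1r. Qed.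

Lemma E0_flip a b f : f \in E0 -> a.1 != b.1 -> D a b f = f.
Proof. by move=> h ab; rewrite (flip_sgn stE flip_sq ab) E0_sgn. Qed.

Lemma neg_eq0 v : v = - v -> v = 0. Proof. exact: scaleN_eq0. Qed.

Lemma weyl_E0 a b f : a.1 != b.1 -> f \in E0 -> W a b f \in E0.
Proof.
by move=> ab /weight_spaceP h; apply/weight_spaceP; exact: (weight_weyl stE flip_sq ab h).
Qed.

(** Take two fresh indices l and m. The flips of k, l and of k, m commute with [E a b], and among
    the weights that occur only the singleton k is negated by both. *)
Lemma E_single_stable a b k v : a.1 != b.1 -> k != a.1 -> k != b.1 ->
  v \in Ei k -> E a b v \in Ei k.
Proof.
move=> ab ka kb vk; have [l [la lb lk _]] := fresh4 n_gt7 a.1 b.1 k k.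
have [m [ma mb mk ml]] := fresh4 n_gt7 a.1 b.1 k l.
have kl : k != l by rewrite eq_sym.
have km : k != m by rewrite eq_sym.
pose U := (lker (GL_lfun (sgn k l) - (-1) *: \1%VF) :&:
           lker (GL_lfun (sgn k m) - (-1) *: \1%VF))%VS.
have memU w : (w \in U) = (sgn k l w == - w) && (sgn k m w == - w).
  by rewrite memv_cap !memv_eigen !scaleN1r.
have : (U <= Ei k)%VS.
  apply: (sub_weights n_gt7 char2 stE dimV flip_sq).
  - move=> i j w ij; rewrite !memU => /andP[/eqP e1 /eqP e2].
    rewrite (sgn_comm stE flip_sq w kl ij) (sgn_comm stE flip_sq w km ij).
    by rewrite e1 e2 !linearN !eqxx.
  - move=> w; rewrite memU => /andP[/eqP e1 _] h.
    have : sgn k l w = w by rewrite h // mul1r scale1r.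
    by rewrite e1 => /esym/neg_eq0 ->; exact: mem0v.
  move=> i w; rewrite memU => /andP[/eqP e1 /eqP e2] /weight_spaceP h.
  have [->//|ki] := eqVneq k i.
  have [il|il] := eqVneq i l.
    have : sgn k m w = w by apply: (single_sgn_out h) => //; rewrite il.
    by rewrite e2 => /esym/neg_eq0 ->; exact: mem0v.
  have : sgn k l w = w by apply: (single_sgn_out h) => //; rewrite eq_sym.
  by rewrite e1 => /esym/neg_eq0 ->; exact: mem0v.
move/subvP; apply; rewrite memU !(sgn_E stE) // (single_sgnl vk kl) (single_sgnl vk km).
by rewrite !linearN !eqxx.
Qed.

Lemma line_scalar k (g : GL V) v : stable (Ei k) g -> v \in Ei k -> v != 0 ->
  exists2 s : K, s != 0 & forall w, w \in Ei k -> g w = s *: w.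
Proof.
move=> st vk v0; have e : Ei k = <[v]>%VS.
  apply/esym/eqP; rewrite eqEdim dimEi dim_vline v0 leqnn andbT.
  by rewrite -memvE.
have : g v \in <[v]>%VS by rewrite -e; exact: st.
case/vlineP=> s es; exists s.
  apply: contra_neq v0 => s0; apply: (@GL_inj _ _ g).
  by rewrite es s0 scale0r linear0.
by move=> w; rewrite e => /vlineP[t ->]; rewrite linearZ /= es !scalerA mulrC.
Qed.

(** [E a b] is a commutator of two transvections that act on the line by scalars. *)
Lemma E_single a b k v : a.1 != b.1 -> k != a.1 -> k != b.1 ->
  v \in Ei k -> E a b v = v.
Proof.
move=> ab ka kb vk; have [->|v0] := eqVneq v 0; first by rewrite linear0.
have [c [ca cb ck _]] := fresh4 n_gt7 a.1 b.1 k k.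
have ac : a.1 != (c, false).1 by rewrite eq_sym.
have kc : k != (c, false).1 by rewrite eq_sym.
have cb' : (linv (c, false)).1 != b.1 by [].
have [s s0 hs] := line_scalar (fun w => E_single_stable ac ka kc (v := w)) vk v0.
have [t t0 ht] := line_scalar (fun w => E_single_stable cb' kc kb (v := w)) vk v0.
have := @st_cm _ _ _ stE a (c, false) b ac ab cb.
move/(congr1 (fun f : GL V => f (E (linv (c, false)) b (E a (c, false) v)))).
rewrite /cm !GLME !GLK (hs v vk) linearZ /= (ht v vk) [E a (c, false) _]linearZ /= (hs v vk).
rewrite !scalerA linearZ /= [t * s]mulrC => e.
by apply: (@scalerI _ _ (s * t)); rewrite ?mulf_neq0.
Qed.

Lemma weyl_single a b k v : a.1 != b.1 -> k != a.1 -> k != b.1 ->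
  v \in Ei k -> W a b v = v.
Proof.
move=> ab ka kb vk; have ba : b.1 != a.1 by rewrite eq_sym.
by rewrite weyl_wordE !GLME !(E_single _ _ _ vk).
Qed.

(** [E a b] commutes with the flips away from a and b, and the singletons other than a and b are
    negated by one of these. *)
Lemma E_support a b v : a.1 != b.1 ->
  (forall k l, k != l -> k != a.1 -> k != b.1 -> l != a.1 -> l != b.1 -> sgn k l v = v) ->
  exists f y z, [/\ f \in E0, y \in Ei a.1, z \in Ei b.1 & E a b v = f + y + z].
Proof.
move=> ab hv; pose Q (p : 'I_n * 'I_n) := [&& p.1 != p.2, p.1 != a.1, p.1 != b.1,
  p.2 != a.1 & p.2 != b.1].
pose U := (\bigcap_(p : 'I_n * 'I_n | Q p) lker (GL_lfun (sgn p.1 p.2) - 1 *: \1%VF))%VS.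
have memU w : reflect (forall p, Q p -> sgn p.1 p.2 w = w) (w \in U).
  rewrite memvE; apply: (iffP subv_bigcapP) => h p Qp.
    by have := h p Qp; rewrite -memvE memv_eigen scale1r => /eqP.
  by rewrite -memvE memv_eigen scale1r h.
have : (U <= E0 + Ei a.1 + Ei b.1)%VS.
  apply: (sub_weights n_gt7 char2 stE dimV flip_sq).
  - move=> i j w ij /memU h; apply/memU => p Qp; have /andP[pp _] := Qp.
    by rewrite (sgn_comm stE flip_sq w pp ij) h.
  - move=> w _ /weight_spaceP h; rewrite -addvA; exact: (subvP (addvSl _ _)).
  move=> i w /memU h /weight_spaceP hi.
  have [ia|ia] := eqVneq i a.1.
    rewrite -ia in hi *; apply: (subvP (addvSl _ _)); exact: (subvP (addvSr _ _)).
  have [ib|ib] := eqVneq i b.1; first by rewrite -ib; exact: (subvP (addvSr _ _)).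
  have [l [la lb li _]] := fresh4 n_gt7 a.1 b.1 i i; have il : i != l by rewrite eq_sym.
  have := h (i, l) ltac:(by apply/and5P); rewrite /= (single_sgnl hi il) => /esym/neg_eq0 ->.
  exact: mem0v.
move/subvP/(_ (E a b v)); case/(_ _)/memv_addP.
  by apply/memU => -[k l] /and5P[/= *]; rewrite (sgn_E stE) ?hv.
move=> _ /memv_addP[f fE [y yE ->]] [z zE ->]; by exists f, y, z.
Qed.

Lemma single_sum_E0 a b y z : a.1 != b.1 -> y \in Ei a.1 -> z \in Ei b.1 ->
  y + z \in E0 -> y = 0 /\ z = 0.
Proof.
move=> ab ya zb h; have [l [la lb _ _]] := fresh4 n_gt7 a.1 b.1 a.1 b.1.
have al : a.1 != l by rewrite eq_sym.
have bl : b.1 != l by rewrite eq_sym.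
have ba : b.1 != a.1 by rewrite eq_sym.
have e1 := E0_sgn h al; have e2 := E0_sgn h bl.
rewrite linearD /= (single_sgnl ya al) (single_sgn_out zb) // in e1.
rewrite linearD /= (single_sgnl zb bl) (single_sgn_out ya) // in e2.
by split; apply: neg_eq0; [move/addIr: e1|move/addrI: e2] => ->.
Qed.

Definition weyl_neg a b : {vspace V} := eigenpart E0 (W a b) (-1).

Lemma weyl_negP a b f : (f \in weyl_neg a b) = (f \in E0) && (W a b f == - f).
Proof. by rewrite memv_eigenpart scaleN1r. Qed.

(** In E_cd f = g + y + z the Weyl element fixes the line components y and z but negates the whole.
    Hence y + z lies in [E0], which forces y = z = 0. *)
Lemma weyl_neg_stable a b c d : a.1 != b.1 -> c.1 != d.1 -> a.1 != c.1 ->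
  a.1 != d.1 -> b.1 != c.1 -> b.1 != d.1 -> stable (weyl_neg a b) (E c d).
Proof.
move=> ab cd ac ad bc bd f; rewrite !weyl_negP => /andP[f0 /eqP e].
have We : W a b (E c d f) = - E c d f.
  by rewrite (commuteE (g := E c d)) ?e ?linearN //; apply: weyl_E_comm.
rewrite We eqxx andbT.
have [|g [y [z [g0 yc zd eg]]]] := @E_support c d f cd.
  by move=> *; exact: E0_sgn.
have : y + z = - (2^-1 *: (g + W a b g)).
  have Wyz : W a b (E c d f) = W a b g + y + z.
    rewrite eg !linearD /= (weyl_single (k := c.1) ab _ _ yc) 1?eq_sym //.
    by rewrite (weyl_single (k := d.1) ab _ _ zd) 1?eq_sym.
  apply: (scalerI char2); rewrite scalerN scalerA mulfV // scale1r.
  rewrite We eg in Wyz; rewrite scaler_nat mulr2n.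
  apply/eqP; rewrite -addr_eq0; apply/eqP.
  have : g + y + z + (W a b g + y + z) = 0 by rewrite -Wyz subrr.
  by move=> <-; rewrite -(addrA g) -(addrA (W a b g)) [RHS]addrACA [RHS]addrC.
move=> eyz; have /(single_sum_E0 cd yc zd)[y0 z0] : y + z \in E0.
  by rewrite eyz memvN memvZ // memvD // weyl_E0.
by rewrite eg y0 z0 !addr0.
Qed.

(** Flips act trivially on [E0], so [extraspecial] applies to [weyl_neg a b] with the indices of a
    and b set aside. *)
Lemma weyl_neg_fix a b c d f : a.1 != b.1 -> c.1 != d.1 -> a.1 != c.1 ->
  a.1 != d.1 -> b.1 != c.1 -> b.1 != d.1 -> f \in weyl_neg a b -> E c d f = f.
Proof.
move=> ab cd ac ad bc bd fF.
have out p : a.1 != p -> b.1 != p -> p \notin [:: a.1; b.1].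
  by move=> ap bp; rewrite !inE !(eq_sym p) negb_or ap.
have in_ p : p \notin [:: a.1; b.1] -> a.1 != p /\ b.1 != p.
  by rewrite !inE negb_or !(eq_sym p) => /andP[].
apply: (extraspecial n_gt7 char2 stE dimV (U := weyl_neg a b) (p := a.1) (q := b.1)) => //; try exact: out.
- apply: leq_ltn_trans (dimvS (capvSl _ _)) _; apply: leq_ltn_trans (exp2_bound n_gt7).
  by have := dim_E0 n_gt7 char2 stE dimV flip_sq a.1; rewrite dimEi; move: dimV; lia.
- by move=> p q pq /in_[? ?] /in_[? ?]; apply: weyl_neg_stable.
move=> p q v pq /in_[ap bp] /in_[aq bq] vF.
have [k [kp kq _ _]] := fresh4 n_gt7 p.1 q.1 p.1 q.1.
have pk : p.1 != (k, false).1 by rewrite eq_sym.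
have qk : q.1 != (k, false).1 by rewrite eq_sym.
have v0 : v \in E0 by move: vF; rewrite weyl_negP => /andP[].
have Ev0 : E p q v \in E0.
  by have := weyl_neg_stable ab pq ap aq bp bq vF; rewrite weyl_negP => /andP[].
split.
  by rewrite -(flip_E_fix stE pq pk qk) ?E0_flip.
by rewrite -(flip_E_fixr stE pq pk qk) ?E0_flip.
Qed.

(** Conjugating W_im by W_oi shows that W_om fixes f as well; conjugating W_mi by W_om then shows
    that W_oi fixes the vector that it negates. *)
Lemma weyl_neg_move (o i m : letter n) f : o.1 != i.1 -> o.1 != m.1 -> i.1 != m.1 ->
  f \in weyl_neg o i -> W i m f = f -> f = 0.
Proof.
move=> oi om im; rewrite weyl_negP => /andP[_ /eqP e] eim.
have e1 : W o m f = f.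
  have := congr1 (fun g : GL V => g f) (weyl_W stE oi im).
  rewrite !GLME sw_snd // sw_out ?[m.1 == _]eq_sym // eim e linearN /=.
  by move/oppr_inj/esym.
have mi : m.1 != i.1 by rewrite eq_sym.
have emi : W m i f = f by rewrite (weyl_swap stE im) -{1}eim GLK.
have := congr1 (fun g : GL V => g f) (weyl_W stE om mi).
rewrite !GLME sw_snd // sw_out ?[i.1 == _]eq_sym // emi e1 e.
exact: neg_eq0.
Qed.

Lemma weyl_neg_transport a b c d : a.1 != b.1 -> c.1 != d.1 ->
  (exists2 f, f \in weyl_neg a b & f != 0) -> exists2 f, f \in weyl_neg c d & f != 0.
Proof.
move=> ab cd h; have n5 : (5 < n)%N by exact: leq_trans n_gt7.
apply: (@sw_transitive _ (fun a b => exists2 f, f \in weyl_neg a b & f != 0) a b) => //.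
move=> p q r s pq rs [f fF f0]; exists (W p q f).
  move: fF; rewrite !weyl_negP => /andP[fE /eqP e]; rewrite weyl_E0 //=.
  by rewrite -GLME -(weyl_W stE) // GLME e linearN.
by apply: contra_neq f0 => e; apply: (@GL_inj _ _ (W p q)); rewrite e linear0.
Qed.

(* Otherwise the [-1]-eigenspaces on [E0] of the Weyl elements of the pairs [(o, i)]
   would contribute [n - 2] independent vectors to [E0]. *)
Lemma weyl_neg0 a b : a.1 != b.1 -> weyl_neg a b = 0%VS.
Proof.
move=> ab; apply/eqP; rewrite -subv0; apply: contraT => /subvPn[f fF]; rewrite memv0 => f0.
pose o := x 0; pose m := x 1.
have om : o.1 != m.1 by exact: std_neq.
have /choice[F hF] : forall i : 'I_n, exists f, (i != o.1) && (i != m.1) ->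
    f \in weyl_neg o (i, false) /\ f != 0.
  move=> i; have [/andP[io im]|_] := boolP ((i != o.1) && (i != m.1)); last by exists 0.
  have oi : o.1 != (i, false).1 by rewrite eq_sym.
  by have [|g gF g0] := @weyl_neg_transport a b o (i, false) ab oi; [exists f|exists g].
have dir : directv (\sum_(i | (i != o.1) && (i != m.1)) <[F i]>).
  apply/directv_sum_independent => us usF sum0 i hi.
  have [FiF Fi0] := hF i hi; have /andP[io im] := hi.
  have [s es] := vlineP _ _ (usF i hi).
  have oi : o.1 != (i, false).1 by rewrite eq_sym.
  have im' : (i, false).1 != m.1 by [].
  (* W_im - 1 kills [F j] for the other indices j by [weyl_neg_fix], but does not kill [F i] by
     [weyl_neg_move]. *)
  have := congr1 (fun v => W (i, false) m v - v) sum0.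
  rewrite linear0 subrr linear_sum /= -sumrB (bigD1 i) //= big1 => [|j /andP[hj ji]].
    rewrite addr0 es linearZ /= -scalerBr => /eqP; rewrite scaler_eq0 subr_eq0.
    case/orP=> [/eqP ->|/eqP e]; first by rewrite scale0r.
    by case/eqP: Fi0; exact: (weyl_neg_move oi om im' FiF e).
  have [FjF _] := hF j hj; have /andP[jo jm] := hj.
  have [t ->] := vlineP _ _ (usF j hj); rewrite linearZ /= -scalerBr.
  suff -> : W (i, false) m (F j) = F j by rewrite subrr scaler0.
  have oj : o.1 != (j, false).1 by rewrite eq_sym.
  have hE c d : c.1 != d.1 -> o.1 != c.1 -> o.1 != d.1 -> j != c.1 -> j != d.1 ->
      E c d (F j) = F j.
    by move=> cd oc od jc jd; exact: (weyl_neg_fix oj cd oc od jc jd FjF).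
  have mi : m.1 != (i, false).1 by rewrite eq_sym.
  by rewrite weyl_wordE !GLME (hE m) // (hE (linv (i, false)) m) // (hE (linv m)).
have : (\dim (\sum_(i | (i != o.1) && (i != m.1)) <[F i]>) <= \dim E0)%N.
  apply: dimvS; apply/subv_sumP => i hi; rewrite -memvE.
  by have [+ _] := hF i hi; rewrite weyl_negP => /andP[].
have /directvP /= -> := dir.
rewrite (eq_bigr (fun=> 1%N)) => [|i /hF[_ Fi0]]; last by rewrite dim_vline Fi0.
rewrite sum1_card; have := cardC (mem [:: o.1; m.1]); rewrite card_ord.
have := card_size [:: o.1; m.1].
have -> : #|[predC mem [:: o.1; m.1]]| = #|[pred i | (i != o.1) && (i != m.1)]|.
  by apply: eq_card => i; rewrite !inE negb_or.
have := dim_E0 n_gt7 char2 stE dimV flip_sq a.1; rewrite dimEi.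
move: dimV; move: #|_| #|_| (\dim _) (\dim _) => r s t u /=; lia.
Qed.

(** On [E0] the square of [W a b] is a flip, hence 1, so f - W f is negated by W. *)
Lemma weyl_E0_id a b f : a.1 != b.1 -> f \in E0 -> W a b f = f.
Proof.
move=> ab f0; have : f - W a b f \in weyl_neg a b.
  rewrite weyl_negP memvB ?weyl_E0 //= linearB /=.
  by rewrite -[W a b (W a b f)]GLME -flip_wordE E0_flip // opprB.
by rewrite weyl_neg0 // memv0 subr_eq0 => /eqP.
Qed.

End Monomial.

(** * A monomial basis *)

Section Basis.
Variables (n : nat) (K : closedFieldType) (V : vectType K).
Variable E : letter n -> letter n -> GL V.
Hypothesis n_gt7 : (7 < n)%N.
Hypothesis char2 : (2 : K) != 0.
Hypothesis stE : steinberg E.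
Hypothesis dimV : (\dim {:V} < 2 * n - 4)%N.
Hypothesis flip_sq : forall a b v, a.1 != b.1 ->
  flip_word E a b (flip_word E a b v) = v.
Notation E0 := (weight_space E (fun=> 1 : K)).
Notation Ei i := (weight_space E (single K i)).
Hypothesis dimEi : forall i, \dim (Ei i) = 1%N.
Implicit Types (a b c d : letter n) (v f : V) (i j k l : 'I_n).

Notation W := (weyl_word E).
Notation x := (std_letter n_gt7).

Let o := x 0.
Definition base_vector : V := vpick (Ei o.1).

(** One vector carried around by Weyl elements. Indexing by signed letters lets the Weyl elements
    act through [sw] with no further signs, as [weyl_basis] shows. *)
Definition basis_vector a : V :=
  if a == o then base_vector else if a == linv o then - base_vector
  else W a o base_vector.
Notation ev := basis_vector.

Lemma base_vectorE : base_vector \in Ei o.1. Proof. exact: memv_pick. Qed.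
Lemma base_vector_neq0 : base_vector != 0.
Proof. by rewrite vpick0 -dimv_eq0 dimEi. Qed.

Lemma basis_vector_o : ev o = base_vector. Proof. by rewrite /basis_vector eqxx. Qed.
Lemma basis_vector_oV : ev (linv o) = - base_vector.
Proof. by rewrite /basis_vector (negPf (linv_neq _)) eqxx. Qed.
Lemma basis_vector_out a : a.1 != o.1 -> ev a = W a o base_vector.
Proof.
move=> ao; rewrite /basis_vector (negPf (letter_neq ao)) (negPf (_ : a != linv o)) //.
exact: letter_neq.
Qed.

Lemma flip_base a : a.1 != o.1 -> W a o (W a o base_vector) = - base_vector.
Proof.
move=> ao; rewrite -GLME -flip_wordE (flip_sgn stE flip_sq ao).
by rewrite (single_sgnr stE flip_sq base_vectorE) // eq_sym.
Qed.

Lemma basis_vectorV a : ev (linv a) = - ev a.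
Proof.
have [/letterP[->|->]|ao] := eqVneq a.1 o.1.
- by rewrite basis_vector_oV basis_vector_o.
- by rewrite linvK basis_vector_oV basis_vector_o opprK.
rewrite !basis_vector_out // weyl_linvl //.
by apply: (@GL_inj _ _ (W a o)); rewrite GLVK linearN /= flip_base ?opprK.
Qed.

Lemma weyl_basis_snd a b : a.1 != b.1 -> W a b (ev b) = ev a.
Proof.
move=> ab; have ba : b.1 != a.1 by rewrite eq_sym.
have [bo|bo] := eqVneq b.1 o.1.
  have ao : a.1 != o.1 by rewrite -bo.
  have /letterP[->|->] := bo; first by rewrite basis_vector_o basis_vector_out.
  rewrite basis_vectorV linearN /= weyl_linvr // -weyl_linvl //.
  by rewrite basis_vector_o -basis_vector_out // basis_vectorV opprK.
rewrite [ev b]basis_vector_out //; have [ao|ao] := eqVneq a.1 o.1.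
  have ob : o.1 != b.1 by rewrite eq_sym.
  have /letterP[->|->] := ao; first by rewrite weyl_swap // basis_vector_o GLK.
  by rewrite weyl_linvl // -weyl_swap // flip_base // basis_vectorV basis_vector_o.
rewrite -GLME weyl_W // GLME sw_snd // sw_out 1?eq_sym // [ev a]basis_vector_out //.
by rewrite (weyl_single n_gt7 char2 stE dimV flip_sq dimEi ab _ _ base_vectorE) 1?eq_sym.
Qed.

Lemma basis_vector_weight a : ev a \in Ei a.1.
Proof.
have [/letterP[->|->]|ao] := eqVneq a.1 o.1.
- by rewrite basis_vector_o base_vectorE.
- by rewrite basis_vectorV memvN basis_vector_o base_vectorE.
rewrite basis_vector_out //; apply/weight_spaceP.
have /weight_spaceP h := base_vectorE.
by have := single_weyl stE flip_sq ao h; rewrite tpermR.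
Qed.

Lemma basis_vector_neq0 a : ev a != 0.
Proof.
have [/letterP[->|->]|ao] := eqVneq a.1 o.1.
- by rewrite basis_vector_o base_vector_neq0.
- by rewrite basis_vectorV oppr_eq0 basis_vector_o base_vector_neq0.
rewrite basis_vector_out //; apply: contra_neq base_vector_neq0 => e.
by apply: (@GL_inj _ _ (W a o)); rewrite e linear0.
Qed.

Lemma weyl_basis a b c : a.1 != b.1 -> W a b (ev c) = ev (sw a b c).
Proof.
move=> ab; have ba : b.1 != a.1 by rewrite eq_sym.
have ha : W a b (ev a) = ev (linv b) by rewrite weyl_rot // weyl_basis_snd.
have [/letterP[->|->]|ca] := eqVneq c.1 a.1.
- by rewrite sw_fst.
- by rewrite swV // sw_fst !basis_vectorV linearN /= ha basis_vectorV.
have [/letterP[->|->]|cb] := eqVneq c.1 b.1.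
- by rewrite sw_snd // weyl_basis_snd.
- by rewrite swV // sw_snd // !basis_vectorV linearN /= weyl_basis_snd.
rewrite sw_out //.
by apply: (weyl_single n_gt7 char2 stE dimV flip_sq dimEi ab _ _ (basis_vector_weight c)).
Qed.

Lemma E_basis_out a b c : a.1 != b.1 -> c.1 != a.1 -> c.1 != b.1 -> E a b (ev c) = ev c.
Proof.
move=> ab ca cb.
exact: (E_single n_gt7 char2 stE dimV flip_sq dimEi ab ca cb (basis_vector_weight c)).
Qed.

Lemma memEi a v : v \in Ei a.1 -> exists s, v = s *: ev a.
Proof.
have -> : Ei a.1 = <[ev a]>%VS; last by move/vlineP.
apply/esym/eqP; rewrite eqEdim dimEi dim_vline basis_vector_neq0 leqnn andbT.
by rewrite -memvE basis_vector_weight.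
Qed.

Lemma E_form a b v : a.1 != b.1 -> v \in E0 \/ v \in Ei a.1 \/ v \in Ei b.1 ->
  exists g s t, g \in E0 /\ E a b v = g + s *: ev a + t *: ev b.
Proof.
move=> ab hv.
have [|g [y [z [g0 ya zb e]]]] := @E_support _ _ _ _ n_gt7 char2 stE dimV flip_sq a b v ab.
  move=> k l kl ka kb la lb; case: hv => [/weight_spaceP h|[h|h]].
  - by rewrite h // mulr1 scale1r.
  - exact: (single_sgn_out h).
  - exact: (single_sgn_out h).
have [s es] := memEi ya; have [t et] := memEi zb.
by exists g, s, t; rewrite e es et.
Qed.

Lemma weyl_E_apply a b c d v : a.1 != b.1 -> c.1 != d.1 ->
  W a b (E c d v) = E (sw a b c) (sw a b d) (W a b v).
Proof. by move=> ab cd; rewrite -!GLME weyl_E. Qed.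

Let ab01 : (x 0).1 != (x 1).1. Proof. exact: std_neq. Qed.
Let n_gt5 : (5 < n)%N. Proof. exact: leq_trans n_gt7. Qed.

(** Weyl elements act transitively on pairs of letters, permute the basis vectors and fix [E0], so
    the coefficients found at one pair hold at all. *)
Lemma E_uniform (h : letter n -> letter n -> V) g s t : g \in E0 ->
  (forall a b c d, a.1 != b.1 -> c.1 != d.1 -> W a b (h c d) = h (sw a b c) (sw a b d)) ->
  E (x 0) (x 1) (h (x 0) (x 1)) = g + s *: ev (x 0) + t *: ev (x 1) ->
  forall a b, a.1 != b.1 -> E a b (h a b) = g + s *: ev a + t *: ev b.
Proof.
move=> g0 hW e.
apply: (@sw_transitive _ (fun a b => E a b (h a b) = g + s *: ev a + t *: ev b) (x 0) (x 1)) => //.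
move=> a b c d ab cd ecd; rewrite -hW // -weyl_E_apply // ecd !linearD !linearZ /=.
rewrite !weyl_basis //.
by rewrite (weyl_E0_id n_gt7 char2 stE dimV flip_sq dimEi ab g0).
Qed.

Lemma E_basis_fst : exists (u : V) (al be : K), u \in E0 /\
  forall a b, a.1 != b.1 -> E a b (ev a) = u + al *: ev a + be *: ev b.
Proof.
have [|g [s [t [g0 e]]]] := @E_form (x 0) (x 1) (ev (x 0)) ab01.
  by right; left; exact: basis_vector_weight.
exists g, s, t; split=> //; apply: (E_uniform (h := fun a _ => ev a) g0) => //.
by move=> a b c d ab cd; exact: weyl_basis.
Qed.

Lemma E_basis_snd : exists (u : V) (ga et : K), u \in E0 /\
  forall a b, a.1 != b.1 -> E a b (ev b) = u + ga *: ev a + et *: ev b.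
Proof.
have [|g [s [t [g0 e]]]] := @E_form (x 0) (x 1) (ev (x 1)) ab01.
  by right; right; exact: basis_vector_weight.
exists g, s, t; split=> //; apply: (E_uniform (h := fun _ b => ev b) g0) => //.
by move=> a b c d ab cd; exact: weyl_basis.
Qed.

Lemma E_basis_E0 f : f \in E0 -> exists (g : V) (s t : K), g \in E0 /\
  forall a b, a.1 != b.1 -> E a b f = g + s *: ev a + t *: ev b.
Proof.
move=> f0; have [|g [s [t [g0 e]]]] := @E_form (x 0) (x 1) f ab01; first by left.
exists g, s, t; split=> //; apply: (E_uniform (h := fun _ _ => f) g0) => //.
by move=> a b c d ab cd; rewrite (weyl_E0_id n_gt7 char2 stE dimV flip_sq dimEi ab).
Qed.

Definition component (k : option 'I_n) : 'End(V) :=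
  sumv_pi_for (esym (weights_full n_gt7 char2 stE dimV flip_sq)) k.
Notation pr0 := (component None).

Lemma component_sum v : v = pr0 v + \sum_i component (Some i) v.
Proof.
have := sumv_pi_sum (esym (weights_full n_gt7 char2 stE dimV flip_sq)) (memvf v).
rewrite (bigD1 None) //= => {1}<-; congr (_ + _).
rewrite (reindex_omap Some id) => [|[]] //=.
by apply: eq_bigl => i; rewrite eqxx.
Qed.

Implicit Types (m r : option 'I_n).

Lemma component_mem m v : component m v \in weight_space E (weight_chi K m).
Proof. exact: memv_sum_pi. Qed.

Lemma component_weight m r v : v \in weight_space E (weight_chi K r) ->
  component m v = if m == r then v else 0.
Proof.
move=> vr; pose us m := if m == r then v else 0.
have e : \sum_m component m v == \sum_m us m.
  rewrite (sumv_pi_sum (esym (weights_full n_gt7 char2 stE dimV flip_sq)) (memvf v)).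
  by rewrite (bigD1 r) //= /us eqxx big1 ?addr0 // => j /negPf->.
move/directv_sum_unique: (weights_direct E n_gt7 char2) => h.
move: e; rewrite h => [/forall_inP/(_ m isT)/eqP //|j _|j _]; first exact: component_mem.
by rewrite /us; case: eqP => [->|] //; rewrite mem0v.
Qed.

Lemma component_id m v : component m (component m v) = component m v.
Proof. by rewrite (component_weight _ (component_mem m v)) eqxx. Qed.

Lemma pr0_E0 f : f \in E0 -> pr0 f = f.
Proof. by move=> f0; rewrite (component_weight _ (r := None)). Qed.
Lemma pr0_basis a : pr0 (ev a) = 0.
Proof. by rewrite (component_weight _ (r := Some a.1)) // basis_vector_weight. Qed.
Lemma pr0_mem v : pr0 v \in E0. Proof. exact: (component_mem None). Qed.

Definition co i v : K := coord [tuple ev (i, false)] 0 (component (Some i) v).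

Lemma co_is_scalar i : scalar (co i).
Proof. by move=> k u v; rewrite /co !linearP. Qed.
HB.instance Definition _ i := GRing.isLinear.Build K V K _ (co i) (co_is_scalar i).

Lemma co_E0 i f : f \in E0 -> co i f = 0.
Proof. by move=> f0; rewrite /co (component_weight _ (r := None)) // linear0. Qed.

Lemma co_basis i a : co i (ev a) = if a.1 == i then (if a.2 then -1 else 1) else 0.
Proof.
rewrite /co (component_weight _ (r := Some a.1)) ?basis_vector_weight //.
rewrite (inj_eq Some_inj) [i == _]eq_sym.
have co1 (j : 'I_n) : coord [tuple ev (j, false)] 0 (ev (j, false)) = 1.
  have h : free [tuple ev (j, false)] by rewrite seq1_free basis_vector_neq0.
  by have := coord_free 0 0 h; rewrite eqxx.
case: a => j s /=; case ji: (j == i); last by rewrite linear0.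
move/eqP: ji => <-; case: s; last exact: co1.
by rewrite -[(j, true)]/(linv (j, false)) basis_vectorV linearN /= co1.
Qed.

Lemma co_sum v : v = pr0 v + \sum_i co i v *: ev (i, false).
Proof.
rewrite {1}[v]component_sum; congr (_ + _); apply: eq_bigr => i _.
have [s e] := @memEi (i, false) _ (component_mem (Some i) v).
have -> : co i v = co i (component (Some i) v).
  by rewrite /co component_id.
by rewrite e linearZ /= co_basis /= eqxx mulr1.
Qed.

End Basis.

(** * Solving the relations for the coefficients *)

Section Coefficients.
Variables (n : nat) (K : closedFieldType) (V : vectType K).
Variable E : letter n -> letter n -> GL V.
Hypothesis n_gt7 : (7 < n)%N.
Hypothesis char2 : (2 : K) != 0.
Hypothesis stE : steinberg E.
Hypothesis dimV : (\dim {:V} < 2 * n - 4)%N.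
Hypothesis flip_sq : forall a b v, a.1 != b.1 ->
  flip_word E a b (flip_word E a b v) = v.
Notation E0 := (weight_space E (fun=> 1 : K)).
Notation Ei i := (weight_space E (single K i)).
Hypothesis dimEi : forall i, \dim (Ei i) = 1%N.
Implicit Types (a b c d : letter n) (v f g : V) (i j k l : 'I_n).

Notation x := (std_letter n_gt7).
Notation ev := (basis_vector E n_gt7).
Notation co := (co n_gt7 char2 stE dimV flip_sq).
Notation pr0 := (component n_gt7 char2 stE dimV flip_sq None).

Lemma E_linvr a b v w : a.1 != b.1 -> E a b v = w -> E a (linv b) w = v.
Proof. by move=> ab <-; rewrite (st_inv stE) // GLK. Qed.

Lemma E_commE a b c d v : a.1 != b.1 -> c.1 != d.1 -> a != c -> a.1 != d.1 ->
    b.1 != c.1 -> E a b (E c d v) = E c d (E a b v).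
Proof. by move=> *; apply: commuteE; apply: (st_comm stE). Qed.

Lemma E_cmE a b c v : a.1 != b.1 -> a.1 != c.1 -> b.1 != c.1 ->
  E a b (E (linv b) c v) = E a c (E (linv b) c (E a b v)).
Proof.
move=> ab ac bc; rewrite -!GLME -(st_cm stE ab ac bc) /cm.
by rewrite !mulgVK.
Qed.

Lemma E_fix_all f : f \in E0 -> E (x 0) (x 1) f = f ->
  forall a b, a.1 != b.1 -> E a b f = f.
Proof.
move=> f0 e a b ab.
have := @E_uniform _ _ _ E n_gt7 char2 stE dimV flip_sq dimEi (fun _ _ => f) f 0 0 f0 _ _ a b ab.
rewrite !scale0r !addr0; apply=> // c d *.
by rewrite (weyl_E0_id n_gt7 char2 stE dimV flip_sq dimEi).
Qed.

Let co_x (k l : nat) : (k < 8)%N -> (l < 8)%N -> co (x k).1 (ev (x l)) = (k == l)%:R.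
Proof.
move=> k8 l8; rewrite (co_basis n_gt7 char2 stE dimV flip_sq dimEi).
have -> : (x l).2 = false by rewrite std_letter.unlock.
have [->|kl] := eqVneq k l; first by rewrite eqxx.
by rewrite (negPf (_ : (x l).1 != (x k).1)) // std_neq // eq_sym.
Qed.

(* The two cases are, up to the summand [E0], the standard representation and its
   contragredient. *)
Lemma E_shape :
  ((forall a b, a.1 != b.1 -> E a b (ev a) = ev a + ev b /\ E a b (ev b) = ev b) /\
   (forall f, f \in E0 -> exists t : K, forall a b, a.1 != b.1 -> E a b f = f + t *: ev b))
  \/ exists2 u : V, u \in E0 &
   (forall a b, a.1 != b.1 -> E a b (ev a) = ev a /\ E a b (ev b) = u - ev a + ev b) /\
   (forall f, f \in E0 -> forall a b, a.1 != b.1 -> E a b f = f).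
Proof.
have lin := (GLD, GLN, GLZ).
have [u [al [be [u0 e1]]]] := E_basis_fst n_gt7 char2 stE dimV flip_sq dimEi.
have [u' [ga [et [u'0 e2]]]] := E_basis_snd n_gt7 char2 stE dimV flip_sq dimEi.
have evV a : ev (linv a) = - ev a by exact: basis_vectorV.
have e1r a b : a.1 != b.1 -> E a (linv b) (ev a) = u + al *: ev a - be *: ev b.
  by move=> ab; rewrite e1 // evV scalerN.
have e2r a b : a.1 != b.1 -> E a (linv b) (ev b) = - u' - ga *: ev a + et *: ev b.
  move=> ab; have -> : E a (linv b) (ev b) = - E a (linv b) (ev (linv b)) by rewrite evV GLN opprK.
  by rewrite e2 // evV !opprD scalerN opprK.
have e1l a b : a.1 != b.1 -> E (linv a) b (ev a) = - u + al *: ev a - be *: ev b.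
  move=> ab; have -> : E (linv a) b (ev a) = - E (linv a) b (ev (linv a)) by rewrite evV GLN opprK.
  by rewrite e1 // evV !opprD scalerN opprK.
have e2l a b : a.1 != b.1 -> E (linv a) b (ev b) = u' - ga *: ev a + et *: ev b.
  by move=> ab; rewrite e2 // evV scalerN.
have out := E_basis_out n_gt7 char2 stE dimV flip_sq dimEi.
pose a := x 0; pose b := x 1; pose p := x 2; pose q := x 3.
have [ab ap aq] : [/\ a.1 != b.1, a.1 != p.1 & a.1 != q.1] by split; apply: std_neq.
have [bp bq pq] : [/\ b.1 != p.1, b.1 != q.1 & p.1 != q.1] by split; apply: std_neq.
have [ba pa qa] : [/\ b.1 != a.1, p.1 != a.1 & q.1 != a.1] by split; apply: std_neq.
have [pb qb qp] : [/\ p.1 != b.1, q.1 != b.1 & q.1 != p.1] by split; apply: std_neq.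
have ab_pq v : E a b (E p q v) = E p q (E a b v).
  by rewrite E_commE // letter_neq.
(* Applying E_ab E_pq = E_pq E_ab to a basis vector that E_ab fixes, only the [E0]-part is left to
   compare. *)
have fu : forall a b, a.1 != b.1 -> E a b u = u.
  apply: (E_fix_all u0); have := ab_pq (ev p).
  by rewrite (out a b p) // e1 // !lin !(out a b) // => /addIr/addIr.
have fu' : forall a b, a.1 != b.1 -> E a b u' = u'.
  apply: (E_fix_all u'0); have := ab_pq (ev q).
  by rewrite (out a b q) // e2 // !lin !(out a b) // => /addIr/addIr.
have p0 := pr0_E0 n_gt7 char2 stE dimV flip_sq.
have pe : forall a, pr0 (ev a) = 0 by move=> c; apply: pr0_basis.
have c0 := co_E0 n_gt7 char2 stE dimV flip_sq.
have cs := ((@co_x 0 0 isT isT : co a.1 (ev a) = 1,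
    @co_x 0 1 isT isT : co a.1 (ev b) = 0,
    @co_x 0 2 isT isT : co a.1 (ev p) = 0,
    @co_x 0 3 isT isT : co a.1 (ev q) = 0),
  (@co_x 1 0 isT isT : co b.1 (ev a) = 0,
    @co_x 1 1 isT isT : co b.1 (ev b) = 1,
    @co_x 1 2 isT isT : co b.1 (ev p) = 0,
    @co_x 1 3 isT isT : co b.1 (ev q) = 0),
  (@co_x 2 0 isT isT : co p.1 (ev a) = 0,
    @co_x 2 1 isT isT : co p.1 (ev b) = 0,
    @co_x 2 2 isT isT : co p.1 (ev p) = 1,
    @co_x 2 3 isT isT : co p.1 (ev q) = 0),
  (@co_x 3 0 isT isT : co q.1 (ev a) = 0,
    @co_x 3 1 isT isT : co q.1 (ev b) = 0,
    @co_x 3 2 isT isT : co q.1 (ev p) = 0,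
    @co_x 3 3 isT isT : co q.1 (ev q) = 1)).
(* Four relations are evaluated and compared by coordinates: E_ab is undone by inverting b ([r3]),
   it commutes with E_{a^-1 p} ([r4]) and with E_pb ([r5]), and its commutator with E_{b^-1 q} is
   E_aq ([r6]). *)
have r3a := E_linvr ab (e1 a b ab).
have r3b := E_linvr ab (e2 a b ab).
rewrite !lin e1r // e2r // fu // in r3a.
rewrite !lin e1r // e2r // fu' // in r3b.
have lap : (linv a).1 != p.1 by [].
have aal : a != linv a by rewrite eq_sym linv_neq.
have r4 v := E_commE v ab lap aal ap ba.
have r4a := r4 (ev a).
rewrite e1 // e1l // !lin fu // fu // e1 // e1l // (out (linv a) p b) // (out a b p) // in r4a.
have r4b := r4 (ev b).
rewrite (out (linv a) p b) // e2 // !lin fu' // e1l // (out (linv a) p b) // in r4b.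
have apn : a != p by rewrite letter_neq.
have r5 v := E_commE v ab pb apn ab bp.
have r5a := r5 (ev a).
rewrite (out p b a) // e1 // !lin fu // (out p b a) // e2 // in r5a.
have lbq : (linv b).1 != q.1 by [].
have r6 v := E_cmE v ab aq bq.
have F6 := (e1 a b ab, e2 a b ab, e1 a q aq, e2 a q aq, e1l b q bq, e2l b q bq,
  out a b q ab qa qb, out a q b aq ba bq, out (linv b) q a lbq ab aq,
  (fu a b ab, fu a q aq, fu (linv b) q lbq, fu' a b ab, fu' a q aq, fu' (linv b) q lbq)).
have r6a := r6 (ev a).
rewrite !(lin, F6) in r6a.
have r6q := r6 (ev q).
rewrite !(lin, F6) in r6q.
have p0u := p0 u u0. have p0u' := p0 u' u'0.
have c0u i := c0 i u u0. have c0u' i := c0 i u' u'0.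
have h v w : v = w -> [/\ pr0 v = pr0 w, co a.1 v = co a.1 w, co b.1 v = co b.1 w,
  co p.1 v = co p.1 w & co q.1 v = co q.1 w] by move=> ->.
have coD i : {morph co i : v w / v + w} by move=> v w; rewrite linearD.
have coN i : {morph co i : v / - v} by move=> v; rewrite linearN.
have coZ i s : {morph co i : v / s *: v >-> s * v} by move=> v; rewrite linearZ.
have prD : {morph pr0 : v w / v + w} by move=> v w; rewrite linearD.
have prN : {morph pr0 : v / - v} by move=> v; rewrite linearN.
have prZ s : {morph pr0 : v / s *: v} by move=> v; rewrite linearZ.
have C := (coD, coN, coZ, prD, prN, prZ, (c0u, c0u', p0u, p0u', pe, cs),
  (mulr0, mulr1, oppr0, scaler0, subr0, add0r, addr0)).
have [q1 q2 q3 _ _] := h _ _ r3a; rewrite !C in q1 q2 q3.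
have [q4 q5 q6 _ _] := h _ _ r3b; rewrite !C in q4 q5 q6.
have [q7 _ q8 _ _] := h _ _ r4a; rewrite !C in q7 q8.
have [q9 q10 _ q11 _] := h _ _ r4b; rewrite !C in q9 q10 q11.
have [q12 _ q13 q14 _] := h _ _ r5a; rewrite !C in q12 q13 q14.
have [q15 q16 _ _ q17] := h _ _ r6a; rewrite !C in q15 q16 q17.
have [q18 q20 _ _ q19] := h _ _ r6q; rewrite !C in q18 q19 q20.
have two (v : V) : v + v = 0 -> v = 0.
  by move=> e; apply: (scaleN_eq0 char2); apply/eqP; rewrite -addr_eq0 e.
have [al1 et1 uu0 hcase] : [/\ al = 1, et = 1, u = 0 &
    (be = 1 /\ ga = 0 /\ u' = 0) \/ (be = 0 /\ ga = -1)].
  (* A nonzero [be] gives the standard representation, and [be = 0] with [ga] nonzero gives its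
     dual. *)
  have [be0|be0] := eqVneq be 0; last first.
    have al1 : al = 1 by apply: (mulIf be0); rewrite mul1r.
    have et1 : et = 1 by apply: (mulfI be0); rewrite mulr1 -q13.
    have ga0 : ga = 0 by apply: (mulfI be0); rewrite -q14 mulr0.
    have u'z : u' = 0.
      by apply: (scalerI be0); apply: (addrI u); rewrite -q12 scaler0 addr0.
    have uz : u = 0 by apply: two; rewrite -q1 u'z al1 scale1r oppr0 scaler0 addr0.
    split=> //; left; split=> //; apply: (mulfI be0).
    by move/esym/eqP: q17; rewrite al1 et1 mul1r !mulr1 mulrN subr_eq0 => /eqP.
  rewrite be0 in q2 q15 q16; have [ga0|ga0] := eqVneq ga 0; last first.
    have al1 : al = 1 by apply: (mulfI ga0); rewrite mulr1 -q10.
    have uz : u = 0.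
      apply: (scalerI ga0); apply: oppr_inj; apply: (addrI u').
      by rewrite -scalerN -q9 scaler0 subr0.
    have et1 : et = 1.
      by apply: (mulIf ga0); move/eqP: q5; rewrite al1 mulr1 mulrN subr_eq0 mul1r => /eqP.
    split=> //; right; split=> //; apply: (mulfI ga0).
    by rewrite mulrN1; move: q20; rewrite et1 mul1r => e; rewrite -[in RHS]e opprK.
  (* If both vanish, all transvections fix all basis vectors, and so do the Weyl elements; but these
     move [ev a] to [- ev b]. *)
  exfalso; rewrite ga0 in q6 q18.
  have al1 : al = 1.
    by move: q16; rewrite mul0r addr0 => ->; rewrite -q2 mul0r addr0.
  have et1 : et = 1 by rewrite q19 -q6 mul0r add0r.
  have uz : u = 0.
    apply: (addrI u); rewrite addr0 [RHS]q15 scale0r addr0 al1 scale1r //.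
  have u'z : u' = 0.
    by apply: (addrI u'); move: q18; rewrite scale0r subr0 et1 scale1r => <-; rewrite addr0.
  have fx c d e : c.1 != d.1 -> E c d (ev e) = ev e.
    move=> cd; have fst' r s : r.1 != s.1 -> E r s (ev r) = ev r.
      by move=> rs; rewrite e1 // uz al1 be0 scale1r scale0r add0r addr0.
    have snd' r s : r.1 != s.1 -> E r s (ev s) = ev s.
      by move=> rs; rewrite e2 // u'z et1 ga0 scale1r scale0r !add0r.
    have [/letterP[->|->]|ec] := eqVneq e.1 c.1; rewrite ?evV ?GLN ?fst' //.
    have [/letterP[->|->]|ed] := eqVneq e.1 d.1; rewrite ?evV ?GLN ?snd' //.
    exact: out.
  have := weyl_basis n_gt7 char2 stE dimV flip_sq dimEi a ab.
  rewrite weyl_wordE !GLME !fx // sw_fst evV => /(congr1 (co a.1)).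
  by rewrite coN !cs oppr0 => /eqP; rewrite oner_eq0.
clear q1 q2 q3 q4 q5 q6 q7 q8 q9 q10 q11 q12 q13 q14 q15 q16 q17 q18 q19 q20.
have {}uu' : be *: u' = 0.
  by case: hcase => [[_ [_ ->]]|[-> _]]; rewrite ?scaler0 ?scale0r.
have hf f : f \in E0 -> exists t : K, t * ga = 0 /\
    forall a b, a.1 != b.1 -> E a b f = f + t *: ev b.
  (* The [E0]-part of E_ab f is not yet known to be f, so the images of the successive parts g, g2
     and g3 enter as well. *)
  move=> f0; have [g [s [t [g0 eg]]]] := E_basis_E0 n_gt7 char2 stE dimV flip_sq dimEi f0.
  have [g2 [s2 [t2 [g20 eg2]]]] := E_basis_E0 n_gt7 char2 stE dimV flip_sq dimEi g0.
  have [g3 [s3 [t3 [g30 eg3]]]] := E_basis_E0 n_gt7 char2 stE dimV flip_sq dimEi g20.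
  have Cf := (C, (p0 f f0, p0 g g0, p0 g2 g20, p0 g3 g30),
    (fun i => c0 i f f0, fun i => c0 i g g0, fun i => c0 i g2 g20, fun i => c0 i g3 g30)).
  have e2s := ab_pq f.
  rewrite (eg p q) // (eg a b) // !lin (eg2 p q) // (eg2 a b) // !out // in e2s.
  have [_ es et' _ _] := h _ _ e2s; rewrite !Cf in es et'.
  have r3f := E_linvr ab (eg a b ab).
  rewrite !lin e1r // e2r // eg2 // evV es et' scalerN in r3f.
  have [f1 f2 _ _ _] := h _ _ r3f; rewrite !Cf in f1 f2.
  have r5f := r5 f.
  rewrite (eg p b) // (eg a b) // !lin (eg2 a b) // (eg2 p b) // (out a b p) // (out p b a) // e2 // e2 // es et' in r5f.
  have [_ _ _ f3 _] := h _ _ r5f; rewrite !Cf in f3.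
  have tga : t * ga = 0 by apply: (addrI s); rewrite -f3 addr0.
  have s0 : s = 0.
    move: f2; rewrite al1 mulr1 mulrN tga oppr0 addr0 => e.
    have := mulf_eq0 2 s; rewrite mulrDl mul1r e eqxx (negPf char2) /=.
    by move/esym/eqP.
  have tu' : t *: u' = 0.
    case: hcase => [[_ [_ ->]]|[_ ga1]]; first by rewrite scaler0.
    by move/eqP: tga; rewrite ga1 mulrN1 oppr_eq0 => /eqP->; rewrite scale0r.
  have eg2f : g2 = f by rewrite -f1 s0 scale0r addr0 scalerN tu' subr0.
  have r6f := r6 f.
  rewrite (eg (linv b) q) // (eg a b) // evV !lin (eg2 a b) // (eg2 (linv b) q) // evV !lin !F6 in r6f.
  rewrite !lin !F6 (eg3 a q) // in r6f.
  have [f4 _ _ _ _] := h _ _ r6f; rewrite !Cf in f4.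
  rewrite s0 uu0 uu' et' tu' scale0r !oppr0 scaler0 !addr0 scaler0 addr0 in f4.
  have egf : g = f.
    have := eg3 a b ab; rewrite eg2f (eg a b ab) s0 => /(congr1 pr0).
    by rewrite !Cf -eg2f -f4 => ->.
  by exists t; split=> // c d cd; rewrite (eg c d) // s0 scale0r addr0 egf.
rewrite uu0 al1 in e1; rewrite et1 in e2.
case: hcase => [[be1 [ga0 u'z]]|[be0 ga1]].
  left; split=> [c d cd|f /hf[t [_ ht]]]; last by exists t.
  by rewrite e1 // e2 // be1 ga0 u'z !scale1r scale0r !add0r.
right; exists u' => //; split=> [c d cd|f /hf[t [tga ht]] c d cd].
  by rewrite e1 // e2 // be0 ga1 !scale1r scale0r addr0 scaleN1r add0r.
move/eqP: tga; rewrite ga1 mulrN1 oppr_eq0 => /eqP t0.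
by rewrite ht // t0 scale0r addr0.
Qed.

End Coefficients.

(** * Representations of SL_n(Z) *)

Definition sgl (R : pzRingType) n (a : letter n) : R := if a.2 then -1 else 1.

Lemma sgl_sq (R : pzRingType) n (a : letter n) : sgl R a * sgl R a = 1.
Proof. by rewrite /sgl; case: a.2; rewrite ?mulrNN mulr1. Qed.

Lemma abelianise_letter n (a : letter n) :
  abelianise (letter_val a) = sgl int a *: delta_mx a.1 0.
Proof.
rewrite /letter_val /sgl; case: a.2; last by rewrite abelianise_gen scale1r.
by rewrite abelianiseV abelianise_gen scaleN1r.
Qed.

Lemma abel_transv n (a b : letter n) : a.1 != b.1 ->
  abel_mx (transv a b) = 1%:M + (sgl int a * sgl int b) *: delta_mx b.1 a.1.
Proof.
move=> ab; apply/matrixP => i j; rewrite [LHS]mxE.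
have -> : (1%:M + (sgl int a * sgl int b) *: delta_mx b.1 a.1 : 'M_n) i j =
    (i == j)%:R + sgl int a * sgl int b * ((i == b.1) && (j == a.1))%:R by rewrite !mxE.
have ec s : abelianise (letter_val (a.1, s)) i 0 = (if s then -1 else 1) * (i == a.1)%:R.
  by rewrite abelianise_letter !mxE eqxx andbT.
have eb : abelianise (letter_val b) i 0 = sgl int b * (i == b.1)%:R.
  by rewrite abelianise_letter !mxE eqxx andbT.
have [->|ja] := eqVneq j a.1; last first.
  have -> : free_gen j = letter_val (j, false) by [].
  by rewrite transv_out // abelianise_letter !mxE /= eqxx !andbT andbF mulr0 addr0 mul1r.
have -> : free_gen a.1 = letter_val (a.1, false) by [].
rewrite andbT [sgl int a]/sgl; case as_: a.2.
  have -> : (a.1, false) = linv a by rewrite /linv as_.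
  rewrite transv_inV // abelianiseM abelianiseV mxE [X in X + _]mxE eb /linv as_ ec /=.
  by rewrite mulN1r mul1r mulNr addrC.
have -> : (a.1, false) = a by case: (a) as_ => ? ? /= ->.
rewrite transv_in // abelianiseM mxE eb mul1r; congr (_ + _).
by have := ec a.2; rewrite -surjective_pairing as_ mul1r.
Qed.

Section MatrixAction.
Variables (n : nat) (K : fieldType) (V : vectType K).
Variables (e : 'I_n -> V) (co : 'I_n -> {scalar V}).
Hypothesis co_e : forall i j, co i (e j) = (i == j)%:R.
Implicit Types (M N : 'M[int]_n) (v : V) (z : 'cV[K]_n).

Definition coords v : 'cV[K]_n := \col_i co i v.
Definition of_coords z : V := \sum_i z i 0 *: e i.
(** [M] acts on the span of the [e i], and the common kernel of the coordinates is fixed pointwise;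
    written as v + (M - 1) v this needs no projection to that kernel. *)
Definition mx_fun M v : V := v + of_coords (map_mx intr (M - 1%:M) *m coords v).

Lemma coords_is_linear : linear coords.
Proof. by move=> s u v; apply/colP => i; rewrite !mxE linearP. Qed.
HB.instance Definition _ := GRing.isLinear.Build K V _ _ coords coords_is_linear.

Lemma of_coords_is_linear : linear of_coords.
Proof.
move=> s y z; rewrite /of_coords scaler_sumr -big_split /=.
by apply: eq_bigr => i _; rewrite !mxE scalerDl scalerA.
Qed.
HB.instance Definition _ := GRing.isLinear.Build K _ V _ of_coords of_coords_is_linear.

Lemma of_coordsK : cancel of_coords coords.
Proof.
move=> z; apply/colP => i; rewrite mxE linear_sum (bigD1 i) //= linearZ /= co_e eqxx mulr1.
by rewrite big1 ?addr0 // => j ji; rewrite linearZ /= co_e eq_sym (negPf ji) mulr0.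
Qed.

Lemma mx_fun_is_linear M : linear (mx_fun M).
Proof. by move=> s u v; rewrite /mx_fun !linearP /= scalerDr addrACA. Qed.
HB.instance Definition _ M := GRing.isLinear.Build K V V _ (mx_fun M) (mx_fun_is_linear M).

Lemma coords_mx_fun M v : coords (mx_fun M v) = map_mx intr M *m coords v.
Proof.
rewrite linearD /= of_coordsK map_mxB mulmxBl map_mx1 mul1mx addrC subrK //.
Qed.

Lemma mx_funM M N v : mx_fun M (mx_fun N v) = mx_fun (M *m N) v.
Proof.
rewrite {1}/mx_fun coords_mx_fun {1}/mx_fun -addrA -linearD /= mulmxA -mulmxDl.
rewrite -map_mxM -map_mxD; congr (_ + of_coords (map_mx _ _ *m _)).
by rewrite mulmxBl mul1mx addrC addrA subrK.
Qed.

Lemma mx_fun1 v : mx_fun 1%:M v = v.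
Proof. by rewrite /mx_fun subrr map_mx0 mul0mx linear0 addr0. Qed.

Lemma mx_fun_delta (s : int) k l v :
  mx_fun (1%:M + s *: delta_mx k l) v = v + (s%:~R * co l v) *: e k.
Proof.
have dz : delta_mx k l *m coords v = co l v *: (delta_mx k 0 : 'cV_n).
  apply/colP => i; rewrite !mxE (bigD1 l) //= big1 => [|j /negPf jl]; rewrite !mxE.
    by rewrite !eqxx !andbT addr0 mulrC.
  by rewrite jl andbF mul0r.
rewrite /mx_fun [1%:M + _]addrC addrK map_mxZ map_delta_mx -scalemxAl dz scalerA linearZ /=.
congr (_ + _ *: _); rewrite /of_coords (bigD1 k) //= big1 => [|j /negPf jk]; rewrite !mxE.
  by rewrite !eqxx scale1r addr0.
by rewrite jk scale0r.
Qed.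

Fact mx_GL_subproof (A : SL n) : lker (linfun (mx_fun (val A))) == 0%VS.
Proof.
apply/lker0P => u v; rewrite !lfunE /= => /(congr1 (mx_fun (invmx (val A)))).
by rewrite !mx_funM mulVmx ?SL_unitmx // !mx_fun1.
Qed.

Definition mx_PGL (A : SL n) : PGL V := to_PGL (MkGL (mx_GL_subproof A)).

Fact mx_PGL_is_multiplicative : {morph mx_PGL : A B / (A * B)%g}.
Proof.
move=> A B; rewrite /mx_PGL -gmulfM; congr to_PGL; apply: GL_eqP => v.
by rewrite GLME /= !lfunE /= mx_funM.
Qed.
HB.instance Definition _ := isMultiplicative.Build (SL n) (PGL V) mx_PGL mx_PGL_is_multiplicative.

Fact SL_contra_subproof (A : SL n) : (\det (val A^-1%g)^T == 1)%R.
Proof. by rewrite det_tr; exact: (valP A^-1%g). Qed.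
Definition SL_contra (A : SL n) : SL n := MkSL (SL_contra_subproof A).
Fact SL_contra_is_multiplicative : {morph SL_contra : A B / (A * B)%g}.
Proof.
by move=> A B; apply: val_inj; rewrite /= -trmx_mul; congr trmx; exact: (congr1 val (invgM A B)).
Qed.
HB.instance Definition _ := isMultiplicative.Build (SL n) (SL n) SL_contra SL_contra_is_multiplicative.

End MatrixAction.

(** * Factoring through SL_n(Z), and the trivial submodule *)

Section ProjectiveRepresentation.
Variables (n : nat) (K : closedFieldType) (V : vectType K).
Variable rho : {multiplicative SAut n -> PGL V}.
Variable E : letter n -> letter n -> GL V.
Hypothesis n_gt7 : (7 < n)%N.
Implicit Types (a b : letter n) (v u : V) (i j : 'I_n).

Hypothesis to_PGL_E : forall a b, a.1 != b.1 -> to_PGL (E a b) = rho (stransv a b).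

Let n_gt2 : (2 < n)%N. Proof. exact: leq_trans n_gt7. Qed.

Lemma stransv_id (a b : letter n) : a.1 = b.1 -> stransv a b = 1%g.
Proof. by move=> ab; apply: val_inj; rewrite val_stransv // transv_id. Qed.

Lemma factors_of_generators (sigma : {multiplicative SL n -> PGL V}) :
  (forall a b, a.1 != b.1 -> to_PGL (E a b) = sigma (SAut_to_SL n (stransv a b))) ->
  factors_through (SAut_to_SL n) rho.
Proof.
move=> h; exists sigma => xi; apply: (SAut_ind_transv (P := fun xi => _ = _) n_gt2) xi.
  by rewrite !gmul_morph1.
move=> a b xi e; rewrite !gmulfM e; congr (_ * _)%g.
have [ab|ab] := eqVneq a.1 b.1; first by rewrite stransv_id // !gmul_morph1.
by rewrite -to_PGL_E // h.
Qed.

(** Some lift of [rho xi] is a product of the [E a b] and fixes [V0] pointwise; any other lift is a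
    multiple of it. *)
Lemma trivial_submodule (V0 : {vspace V}) :
  (forall a b, a.1 != b.1 -> forall v, v \in V0 -> E a b v = v) ->
  trivial_projective_submodule rho V0.
Proof.
move=> h xi f ef.
have hfix : forall xi, exists2 g : GL V, to_PGL g = rho xi & forall v, v \in V0 -> g v = v.
  apply: (SAut_ind_transv n_gt2).
    by exists 1%g => [|v _]; rewrite ?gmul_morph1 ?GL1E.
  move=> a b y [g eg hg]; have [ab|ab] := eqVneq a.1 b.1.
    by exists g; rewrite // stransv_id // mul1g.
  exists (E a b * g)%g => [|v v0]; first by rewrite !gmulfM /= to_PGL_E // eg.
  by rewrite GLME hg // h.
have [g eg hg] := hfix xi.
have /to_PGL_eq/asboolP[c c0 efg] : to_PGL f = to_PGL g by rewrite ef eg.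
have fE v : v \in V0 -> val f v = c *: v.
  by move=> v0; rewrite efg scale_lfunE hg.
split; last by exists c.
by apply/subvP => _ /memv_imgP[v v0 ->]; rewrite fE // memvZ.
Qed.

Hypothesis char2 : (2 : K) != 0.
Hypothesis stE : steinberg E.
Hypothesis dimV : (\dim {:V} < 2 * n - 4)%N.
Hypothesis flip_sq : forall a b v, a.1 != b.1 ->
  flip_word E a b (flip_word E a b v) = v.
Notation E0 := (weight_space E (fun=> 1 : K)).
Notation Ei i := (weight_space E (single K i)).
Hypothesis not_factors : ~ factors_through (SAut_to_SL n) rho.

Notation x := (std_letter n_gt7).
Notation ev := (basis_vector E n_gt7).

Definition PGL_one_map (A : SL n) : PGL V := 1%g.
Fact PGL_one_map_is_multiplicative : {morph PGL_one_map : A B / (A * B)%g}.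
Proof. by move=> A B; rewrite /PGL_one_map mulg1. Qed.
HB.instance Definition _ := isMultiplicative.Build (SL n) (PGL V) PGL_one_map
  PGL_one_map_is_multiplicative.

(** Without singletons all [E a b] are 1, and a trivial [rho] factors. *)
Lemma dimEi i : \dim (Ei i) = 1%N.
Proof.
apply/eqP; rewrite eqn_leq (dim_single1 n_gt7 char2 stE dimV flip_sq) lt0n.
apply/eqP => /(steinberg_trivial n_gt7 char2 stE dimV flip_sq) E1.
apply: not_factors; apply: (factors_of_generators (sigma := PGL_one_map)).
by move=> a b ab; rewrite E1 // gmul_morph1.
Qed.

Definition coord_fun i : {scalar V} := co n_gt7 char2 stE dimV flip_sq i.
Definition basis i := ev (i, false).

Lemma coord_basis i j : coord_fun i (basis j) = (i == j)%:R.
Proof.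
rewrite [LHS](co_basis n_gt7 char2 stE dimV flip_sq dimEi) /= eq_sym.
by case: eqP.
Qed.

Lemma basis_vector_sgl a : ev a = sgl K a *: basis a.1.
Proof.
case: a => i []; rewrite /sgl /basis /= ?scale1r ?scaleN1r //.
by rewrite -[(i, true)]/(linv (i, false)) basis_vectorV //; exact: dimEi.
Qed.

Lemma basis_sgl a : basis a.1 = sgl K a *: ev a.
Proof. by rewrite basis_vector_sgl scalerA sgl_sq scale1r. Qed.

Lemma GL_ext (f g : GL V) : (forall v, v \in E0 -> f v = g v) ->
  (forall i, f (basis i) = g (basis i)) -> f = g.
Proof.
move=> h0 hb; apply: GL_eqP => v.
rewrite (co_sum n_gt7 char2 stE dimV flip_sq dimEi v) !linearD /= !linear_sum /=.
rewrite h0 ?pr0_mem //; congr (_ + _); apply: eq_bigr => i _.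
by rewrite !linearZ /= hb.
Qed.

Lemma coord_E0 i v : v \in E0 -> coord_fun i v = 0.
Proof. exact: (co_E0 n_gt7 char2 stE dimV flip_sq). Qed.

Lemma to_PGL_mx a b k l s (A : SL n) : val A = 1%:M + s *: delta_mx k l ->
  (forall v, v \in E0 -> E a b v = v) ->
  (forall i, E a b (basis i) = basis i + (s%:~R * (l == i)%:R) *: basis k) ->
  to_PGL (E a b) = mx_PGL coord_basis A.
Proof.
move=> eA h0 hb; congr to_PGL; apply: GL_ext => [v v0|i]; rewrite lfunE /= eA mx_fun_delta.
  by rewrite h0 // coord_E0 // mulr0 scale0r addr0.
by rewrite hb coord_basis.
Qed.

Lemma val_SAut_to_SL_stransv a b : a.1 != b.1 -> val (SAut_to_SL n (stransv a b)) =
  1%:M + (sgl int a * sgl int b) *: delta_mx b.1 a.1.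
Proof. by move=> ab; rewrite -abel_transv //= val_stransv. Qed.

Lemma val_SL_contra_stransv a b : a.1 != b.1 ->
  val (SL_contra (SAut_to_SL n (stransv a b))) =
  1%:M + (- (sgl int a * sgl int b)) *: delta_mx a.1 b.1.
Proof.
move=> ab; have -> (A : SL n) : val (SL_contra A) = (val A^-1%g)^T by [].
have -> : (SAut_to_SL n (stransv a b))^-1%g = SAut_to_SL n (stransv a (linv b)).
  by rewrite -gmul_morphV; congr SAut_to_SL; apply: val_inj; rewrite /= !val_stransv // transvV.
rewrite val_SAut_to_SL_stransv // linearD /= trmx1 linearZ /= trmx_delta.
by congr (_ + _ *: _); rewrite /sgl /=; case: a.2; case: b.2.
Qed.

Lemma sgl_intr a : (sgl int a)%:~R = sgl K a.
Proof. by rewrite /sgl; case: a.2. Qed.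

Lemma E_basis_outside a b i : a.1 != b.1 -> i != a.1 -> i != b.1 -> E a b (basis i) = basis i.
Proof. by move=> ab ia ib; exact: (E_basis_out n_gt7 char2 stE dimV flip_sq dimEi). Qed.

Lemma natural_shape :
  (forall a b, a.1 != b.1 -> E a b (ev a) = ev a + ev b /\ E a b (ev b) = ev b) ->
  exists2 f, f \in E0 & E (x 0) (x 1) f != f.
Proof.
move=> hE; apply: contra_notP not_factors => /forall2NP h.
have h0 f : f \in E0 -> E (x 0) (x 1) f = f.
  by move=> f0; case: (h f) => // /negP; rewrite negbK => /eqP.
apply: (factors_of_generators (sigma := mx_PGL coord_basis)) => a b ab.
have [ha hb] := hE a b ab.
apply: (to_PGL_mx (k := b.1) (l := a.1)); first exact: val_SAut_to_SL_stransv.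
  by move=> v v0; exact: (E_fix_all char2 stE dimV flip_sq dimEi v0 (h0 v v0)).
move=> i; rewrite rmorphM /= !sgl_intr; have [<-|ia] := eqVneq a.1 i.
  rewrite basis_sgl linearZ /= ha scalerDr mulr1; congr (_ + _).
  by rewrite -scalerA -basis_vector_sgl.
rewrite mulr0 scale0r addr0; have [->|ib] := eqVneq i b.1.
  by rewrite basis_sgl linearZ /= hb.
by rewrite E_basis_outside // eq_sym.
Qed.

Definition mx_PGL_contra (A : SL n) : PGL V := mx_PGL coord_basis (SL_contra A).
Fact mx_PGL_contra_is_multiplicative : {morph mx_PGL_contra : A B / (A * B)%g}.
Proof. by move=> A B; rewrite /mx_PGL_contra !gmulfM. Qed.
HB.instance Definition _ := isMultiplicative.Build (SL n) (PGL V) mx_PGL_contra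
  mx_PGL_contra_is_multiplicative.

Lemma dual_shape u :
  (forall a b, a.1 != b.1 -> E a b (ev a) = ev a /\ E a b (ev b) = u - ev a + ev b) ->
  (forall f, f \in E0 -> forall a b, a.1 != b.1 -> E a b f = f) -> u != 0.
Proof.
move=> hE h0; apply: contra_not_neq not_factors => u0.
apply: (factors_of_generators (sigma := mx_PGL_contra)) => a b ab.
have [ha hb] := hE a b ab.
apply: (to_PGL_mx (k := a.1) (l := b.1)); first exact: val_SL_contra_stransv.
  by move=> v v0; exact: h0.
move=> i; rewrite rmorphN rmorphM /= !sgl_intr; have [<-|ib] := eqVneq b.1 i.
  rewrite basis_sgl linearZ /= hb u0 add0r scalerDr mulr1 addrC; congr (_ + _).
  by rewrite mulrC -mulrN -scalerA scaleNr -basis_vector_sgl.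
rewrite mulr0 scale0r addr0; have [->|ia] := eqVneq i a.1.
  by rewrite basis_sgl linearZ /= ha.
by rewrite E_basis_outside // eq_sym.
Qed.

Lemma exists_trivial_submodule : (n + 1 <= \dim {:V})%N /\
  exists V0 : {vspace V}, trivial_projective_submodule rho V0 /\
    (\dim V0 = \dim {:V} - n - 1)%N.
Proof.
have dE0 := dim_E0 n_gt7 char2 stE dimV flip_sq (x 0).1.
rewrite dimEi muln1 in dE0.
(* Since dim E0 = k - n, a subspace of codimension one in [E0] gives the dimension, and its
   existence gives k >= n + 1. *)
suff [V0 triv dV0] : exists2 V0, trivial_projective_submodule rho V0 &
    (\dim V0 + 1 = \dim E0)%N.
  by split; [lia | exists V0; split=> //; lia].
have [[hE hf]|[u u0 [hE h0]]] := E_shape n_gt7 char2 stE dimV flip_sq dimEi.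
  have [f0 f00 nf0] := natural_shape hE.
  have ev0 a : ev a != 0 by apply: basis_vector_neq0 => //; exact: dimEi.
  (* On [E0] this is v -> t(v) ev_1 with t not zero, so its kernel there has codimension one. By
     [E_fix_all] a vector of [E0] fixed by one transvection is fixed by all. *)
  pose g := GL_lfun (E (x 0) (x 1)) - \1%VF.
  have gE v : g v = E (x 0) (x 1) v - v by rewrite add_lfunE opp_lfunE id_lfunE.
  exists (E0 :&: lker g)%VS.
    apply: trivial_submodule => a b ab v; rewrite memv_cap memv_ker gE subr_eq0.
    move=> /andP[v0 /eqP fv].
    exact: (E_fix_all char2 stE dimV flip_sq dimEi v0 fv).
  rewrite -(limg_ker_dim g E0); congr (_ + _)%N; apply/esym/eqP.
  have : (g @: E0 <= <[ev (x 1)]>)%VS.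
    apply/subvP => _ /memv_imgP[v v0 ->]; have [t ht] := hf v v0.
    by rewrite gE ht ?std_neq // addrC addKr memvZ // memv_line.
  move/dimvS; rewrite dim_vline ev0 => le1; rewrite eqn_leq le1.
  apply: (@dim_gt0 _ _ _ (g f0)); first exact: memv_img.
  by rewrite gE subr_eq0.
have un0 := dual_shape hE h0.
exists (E0 :\: <[u]>)%VS.
  apply: trivial_submodule => a b ab v v0; apply: h0 => //.
  exact: (subvP (diffvSl _ _)) v0.
rewrite -(dimv_cap_compl E0 <[u]>) addnC; congr (_ + _)%N.
rewrite (_ : (E0 :&: <[u]>)%VS = <[u]>%VS) ?dim_vline ?un0 //.
by apply/capv_idPr; rewrite -memvE.
Qed.

End ProjectiveRepresentation.

Theorem theorem7p12 (n : nat) (n_ge8 : (8 <= n)%N)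
  (K : closedFieldType) (K_char : 2%N \notin [pchar K]%R)
  (V : vectType K) (k : nat) (dimV : (\dim {:V} = k)%VS)
  (k_lt : (k < 2 * n - 4)%N)
  (rho : {multiplicative SAut n -> PGL V}) :
  ~ factors_through (SAut_to_SL n) rho ->
  (n + 1 <= k)%N /\
  exists V0 : {vspace V},
    trivial_projective_submodule rho V0 /\ (\dim V0 = k - n - 1)%N.
Proof.
have n2 : (2 < n)%N by apply: leq_trans n_ge8.
have n5 : (5 < n)%N by apply: leq_trans n_ge8.
subst k => not_factors.
have char2 : (2 : K)%R != 0%R by move: K_char; rewrite inE /=.
have stR := steinberg_morph rho (stransv_steinberg n2).
have ker_central z : to_PGL z = 1%g -> forall y, commute z y := @GL_ker_central K V z.
have lift_ex (a b : letter n) : exists Z : GL V, to_PGL Z = rho (stransv a b).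
  by exists (repr (rho (stransv a b))); rewrite to_PGL_repr.
have [E stE to_PGL_E] : exists2 E : letter n -> letter n -> GL V, steinberg E &
    forall a b, a.1 != b.1 -> to_PGL (E a b) = rho (stransv a b).
  exists (lift_transv n5 lift_ex); first exact: lift_transv_steinberg.
  by move=> a b; exact: pi_lift_transv.
have flip_scalar a b : a.1 != b.1 ->
    exists c : K, forall v, flip_word E a b (flip_word E a b v) = (c *: v)%R.
  (* The square of a flip is the fourth power of a Weyl element, which is 1 in SAut(F_n); in GL(V)
     it is therefore a scalar. *)
  move=> ab; suff /GL_ker[c hc] : to_PGL (flip_word E a b * flip_word E a b)%g = 1%g.
    by exists c => v; rewrite -GLME hc.
  rewrite !flip_wordE !gmulfM /=.
  have -> : to_PGL (weyl_word E a b) = rho (weyl_word (@stransv n) a b).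
    by rewrite !weyl_wordE !gmulfM /= !to_PGL_E // eq_sym.
  by rewrite -[RHS](gmul_morph1 rho) -(stransv_weyl4 n2 ab) !gmulfM.
have flip_sq a b v : a.1 != b.1 -> flip_word E a b (flip_word E a b v) = v.
  exact: flip_square.
exact: (exists_trivial_submodule n_ge8 to_PGL_E char2 stE k_lt flip_sq not_factors).
Qed.
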